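(* Suppose that, as $n\to\infty$, $q(n)\sim c_q\,L(n)\,n^{-3/2}$ for some constant $c_q>0$, and that $L'(n):=\sqrt n\,P(n)$ is slowly varying at infinity. Then for $\delta=1$, as $N\to\infty$, $$\widetilde Z^{\mathrm c}_{1,N}\ \sim\ \frac1{2\pi}\,\frac{1}{c_q\,L(N)\,\sqrt N},\qquad\qquad \widetilde Z^{\mathrm f}_{1,N}\ \sim\ \frac{L'(N)}{2\,c_q\,L(N)}.$$
   Context: For positive sequences, $a_n\sim b_n$ means $a_n/b_n\to1$. $\mathbb R^+=[0,\infty)$, $\mathbb N=\{1,2,\dots\}$. Model. $\mu$ is either Lebesgue measure on $\mathbb R$ (continuous set-up) or counting measure on $\mathbb Z$ (discrete set-up). $V:\mathbb R\to\mathbb R\cup\{+\infty\}$ satisfies $V(0)<\infty$ and $\kappa:=\int_{\mathbb R}e^{-V(y)}\mu(dy)<\infty$; in the continuous set-up $\exp(-V(\cdot))$ is continuous. Let $(Y_i)_{i\in\mathbb N}$ be IID with law $\mathbf P(Y_1\in dx)=\kappa^{-1}e^{-V(x)}\mu(dx)$, and $S_0=0$, $S_n=Y_1+\dots+Y_n$. Standing assumption (H): $\mathbf E[Y_1]=0$ and the truncated variance $\mathcal V(t):=\mathbf E[|Y_1|^2\mathbf 1_{\{|Y_1|\le t\}}]$ is slowly varying at infinity (a function $\ell$ is slowly varying if $\ell(ct)/\ell(t)\to1$ as $t\to\infty$ for each $c>0$). Partition functions. For $\varepsilon\ge0$, $N\in\mathbb N$, $a\in\{\mathrm f,\mathrm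 c\}$, $$Z^a_{\varepsilon,N}:=\int_{(\mathbb R^+)^N}e^{-H^a_N(x)}\prod_{i=1}^N\big(\mathbf 1_{(x_i>0)}\mu(dx_i)+\varepsilon\,\delta_0(dx_i)\big),$$ with $\delta_0$ the Dirac mass at $0$, $H^{\mathrm f}_N(x)=\sum_{i=0}^{N-1}V(x_{i+1}-x_i)$ with $x_0=0$, and $H^{\mathrm c}_N(x)=\sum_{i=0}^{N}V(x_{i+1}-x_i)$ with $x_0=x_{N+1}=0$. Set $Z^{\mathrm c}_{\varepsilon,0}:=e^{-V(0)}$. Let $L(\cdot)$ be the slowly varying function satisfying $L(x)\sim 1/\sqrt{\mathcal V(\sqrt x/L(x))}$ as $x\to\infty$ (explicitly $L(x)=\sqrt x/g^{-1}(x)$ with $g$ increasing and $g(x)\sim x^2/\mathcal V(x)$), so that $L(n)S_n/\sqrt n$ converges in law to a standard Gaussian. Define $\gamma:=\sum_{n\ge1}Z^{\mathrm c}_{0,n-1}/\kappa^n$, which is finite, and the probability distribution $q(n):=\gamma^{-1}Z^{\mathrm c}_{0,n-1}/\kappa^n$, $n\ge1$. Put $P(n):=\mathbf P(S_i>0,\ i=1,\dots,n)$, $P(0):=1$. Modified partition functions. For $\delta\ge 0$ and $N\ge1$, with $\varepsilon=\delta/\gamma$, $$\widetilde Z^{\mathrm c}_{\delta,N}:=\frac{(\delta/\gamma)\,Z^{\mathrm c}_{\delta/\gamma,N-1}}{\kappa^N},\qquad \widetilde Z^{\mathrm c}_{\delta,0}:=1,\qquad \widetilde Z^{\mathrm f}_{\delta,N}:=\frac{Z^{\mathrm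 f}_{\delta/\gamma,N}}{\kappa^N}.$$ *)

(* Defs.v *)
From HB Require Import structures.
From mathcomp Require Import all_boot all_order all_algebra finmap.
From mathcomp Require Import all_classical all_reals all_analysis.

Set Implicit Arguments.
Unset Strict Implicit.
Unset Printing Implicit Defensive.

Import Order.TTheory GRing.Theory Num.Theory.
Import numFieldNormedType.Exports.

Local Open Scope classical_set_scope.
Local Open Scope ring_scope.

(* The landau.v relation ~_F is a = b + o(b); here the ratio is used as such. *)
Definition asymp_equiv (R : realType) (T : Type) (F : set_system T)
    (a b : T -> R) : Prop :=
  a x / b x @[x --> F] --> (1 : R).

Definition slowly_varying (R : realType) (l : R -> R) : Prop :=
  forall c : R, 0 < c -> l (c * t) / l t @[t --> +oo] --> (1 : R).

(* A sequence is identified with the step function t |-> u (floor t). *)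
Definition slowly_varying_seq (R : realType) (u : nat -> R) : Prop :=
  slowly_varying (fun t : R => u (Num.truncn t)).

Variant setup := ContinuousCase | DiscreteCase.

Section partition_functions.
Variable R : realType.

Lemma measurable_ints :
  measurable (range (intr : int -> R) : set (measurableTypeR R)).
Proof.
rewrite (_ : range _ =
    \bigcup_(n in [set: nat]) ([set n%:R : R] `|` [set - n%:R : R])).
  by apply: bigcup_measurable => n _; apply: measurableU.
apply/seteqP; split => [_ [[n|n] _ <-]|_ [n _ [->|->]]].
- by exists n => //; left.
- by exists n.+1 => //; right; rewrite NegzE mulrNz.
- by exists n%:Z.
- by exists (- n%:Z) => //; rewrite mulrNz.
Qed.

Definition counting_ints : {measure set (measurableTypeR R) -> \bar R} :=
  mrestr counting measurable_ints.

Lemma measurable_pos :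
  measurable (`]0, +oo[%classic : set (measurableTypeR R)).
Proof. exact: measurable_itv. Qed.

Variable s : setup.

Definition mu : {measure set (measurableTypeR R) -> \bar R} :=
  match s with
  | ContinuousCase => lebesgue_measure
  | DiscreteCase => counting_ints
  end.

Definition site_measure (eps : {nonneg R}) :
    {measure set (measurableTypeR R) -> \bar R} :=
  measure_add (mrestr mu measurable_pos)
              (mscale eps (@dirac _ (measurableTypeR R) 0%R R)).

(* Integral of F over `[0, +oo[^N against the N-fold product of nu, where F is
   a function of the sequence [:: x_1; ...; x_N]; written as an iterated
   integral since the library has no N-fold products of sigma-finite
   measures. *)
Fixpoint iter_integral (nu : {measure set (measurableTypeR R) -> \bar R})
    (N : nat) (F : seq R -> \bar R) : \bar R :=
  match N with
  | 0 => F [::]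
  | N'.+1 => (\int[nu]_(x in `[0%R, +oo[)
                iter_integral nu N' (fun xs => F (x :: xs)))%E
  end.

Variable V : R -> \bar R.

(* The i-th coordinate, 0 <= i <= N + 1, of (x_0 = 0, x_1, ..., x_N,
   x_{N+1} = 0), for xs = [:: x_1; ...; x_N]. *)
Definition height (xs : seq R) (i : nat) : R := nth 0 (0 :: rcons xs 0) i.

Definition Hf (N : nat) (xs : seq R) : \bar R :=
  (\sum_(0 <= i < N) V (height xs i.+1 - height xs i)%R)%E.

Definition Hc (N : nat) (xs : seq R) : \bar R :=
  (\sum_(0 <= i < N.+1) V (height xs i.+1 - height xs i)%R)%E.

Definition Zf (eps : {nonneg R}) (N : nat) : \bar R :=
  iter_integral (site_measure eps) N (fun xs => expeR (- Hf N xs)%E).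

(* For N = 0 this is e^{-V(0)}. *)
Definition Zc (eps : {nonneg R}) (N : nat) : \bar R :=
  iter_integral (site_measure eps) N (fun xs => expeR (- Hc N xs)%E).

Definition ekappa : \bar R := (\int[mu]_y expeR (- V y))%E.

Definition kappa : R := fine ekappa.

(* No finiteness assumption is lost through fine in q below: if the series is
   +oo then q is identically 0, which excludes q n ~ c L n n^{-3/2}. *)
Definition egamma : \bar R :=
  (\sum_(1 <= n <oo) Zc (0%:nng)%R n.-1 * ((kappa ^+ n)^-1)%:E)%E.

Definition q (n : nat) : R :=
  (fine egamma)^-1 * fine (Zc 0%:nng n.-1) / kappa ^+ n.

Lemma iter_integral_ge0 nu N F :
  (forall xs, 0 <= F xs)%E -> (0 <= iter_integral nu N F)%E.
Proof.
by elim: N F => [|N IH] F F0 //=; apply: integral_ge0 => x _; apply: IH.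
Qed.

Lemma kappa_ge0 : 0 <= kappa.
Proof. by apply/fine_ge0/integral_ge0 => x _; exact: expeR_ge0. Qed.

Lemma gamma_ge0 : 0 <= fine egamma.
Proof.
apply/fine_ge0/nneseries_ge0 => n _ _; apply: mule_ge0.
  by apply: iter_integral_ge0 => xs; exact: expeR_ge0.
by rewrite lee_fin invr_ge0 exprn_ge0// kappa_ge0.
Qed.

Definition gamma : {nonneg R} := NngNum gamma_ge0.

Definition eps_of (delta : {nonneg R}) : {nonneg R} :=
  (delta%:num / gamma%:num)%:nng.

Definition tildeZc (delta : {nonneg R}) (N : nat) : \bar R :=
  match N with
  | 0 => 1%E
  | N'.+1 => ((eps_of delta)%:num%:E * Zc (eps_of delta) N'
              * ((kappa ^+ N)^-1)%:E)%E
  end.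

Definition tildeZf (delta : {nonneg R}) (N : nat) : \bar R :=
  (Zf (eps_of delta) N * ((kappa ^+ N)^-1)%:E)%E.

End partition_functions.

Section random_walk.
Context (d : measure_display) (T : measurableType d) (R : realType)
  (P : probability T R).
(* Indexed from 0: Y i is the (i+1)-st step. *)
Variable Y : nat -> {RV P >-> R}.

Definition mutually_independent : Prop :=
  forall (I : {fset nat}) (A : nat -> set R),
    (forall i, measurable (A i)) ->
    P (\bigcap_(i in [set` I]) (Y i @^-1` A i)) =
    (\prod_(i <- I) P (Y i @^-1` A i))%E.

Definition iid_with_potential (s : setup) (V : R -> \bar R) : Prop :=
  mutually_independent /\
  forall (i : nat) (A : set R), measurable A ->
    distribution P (Y i) A =
    ((kappa s V)^-1%:E * \int[mu R s]_(x in A) expeR (- V x))%E.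

Definition walk (n : nat) (w : T) : R := \sum_(i < n) Y i w.

Definition pos_prob (n : nat) : R :=
  fine (P [set w | forall i, (1 <= i <= n)%N -> 0 < walk i w]).

Definition truncated_variance (t : R) : R :=
  fine 'E_P[fun w => `|Y 0%N w| ^+ 2 * (`|Y 0%N w| <= t)%R%:R].

End random_walk.

(* Main.v *)
Require Import Defs.
From HB Require Import structures.
From mathcomp Require Import all_boot all_order all_algebra finmap.
From mathcomp Require Import all_classical all_reals all_analysis.
From mathcomp Require Import measurable_realfun ring lra zify.

Set Implicit Arguments.
Unset Strict Implicit.
Unset Printing Implicit Defensive.

Import Order.TTheory GRing.Theory Num.Theory.
Import numFieldNormedType.Exports.

Local Open Scope classical_set_scope.
Local Open Scope ring_scope.

(** At the critical value of the pinning parameter the contacts of the path with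
    the wall form a recurrent renewal process.  Cutting a pinned path at its first
    contact shows that the pinned partition function is the renewal sequence [u]
    of the law [q] (tildeZc_renewal); the same cut of a free path is a renewal
    equation (tildeZf_renewal), whose solution is the convolution of [u] with the
    probability that the walk stays positive (renewal_equation_solution).  For these identities the partition functions are
    written as iterates of a transfer operator (Zc_transfer, Zf_transfer), whose
    dependence on the pinning is a rank-one term (iter_transfer_renewal); the
    operator without pinning describes, up to the factor [kappa], a step of the
    random walk killed when it leaves the positive half-line (integral_stay_pos).

    It remains to find the asymptotics of the renewal sequence of a law with
    [q n] of order [L n / n ^ (3/2)].  An exponent 1/2 is outside the reach of the
    strong renewal theorem for general laws, but the regularity of [q] itself
    makes a short argument possible.  Differentiating the renewal equation, with
    the derivation [x |-> (n * x n)_n], gives [n * u n = (v * u * u) n] for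
    [v k = k * q k] (nu_conv).  The tail [r] of [q] satisfies [r n ~ 2 n q n] by
    Karamata's theorem (r_asymp), and [r * u = 1], so that [r * u * u] is the
    sequence [U] of partial sums of [u].  Hence [n * u n ~ U n / 2] (nu_asymp): the
    relative increments of [U] are [1 / (2 n)] up to [o(1 / n)], and both
    [U n / sqrt n] and [u n * sqrt n] are slowly varying (renewal_usv).

    The constants come from convolutions.  The weights [cbin n = C(2n, n) / 4 ^ n]
    are equivalent to [1 / sqrt (pi n)] (cvg_cbin_sq), and their convolution square
    is exactly 1 (cbin_conv).  Therefore the convolution at [n] of [X * cbin] and
    [Y * cbin], for slowly varying [X] and [Y], is equivalent to [X n * Y n]
    (conv_usv).  For [u] and [r], whose convolution is 1, this gives
    [u ~ cbin ^ 2 / r], and for [u] and the probability [p] of staying positive it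
    gives [u * p ~ u p / cbin ^ 2 ~ p / r] (renewal_asymp, renewal_conv_asymp);
    these are the two claims.

    Convolutions require slow variation to be uniform over the windows
    [[n, 2n]], whereas the hypotheses give it at each ratio separately, and [L] need
    not be measurable.  Monotonicity provides the uniformity: the probability of
    staying positive is nonincreasing (usv_of_monotone), and the relation between
    [L] and the truncated variance [W] says that [sqrt x / L x] is an asymptotic
    inverse of [s ^ 2 / W s], where [W] is nondecreasing
    (usv_asymptotic_inverse). *)

(** * Central binomial weights *)

Section cbin.
Variable R : realType.
Implicit Types n k : nat.

(** The central binomial coefficient divided by [4 ^ n], that is the coefficient
    of [x ^ n] in [(1 - x) ^ (- 1/2)], and the model of a sequence of order
    [n ^ (- 1/2)]. *)
Definition cbin n : R := \prod_(i < n) ((i.*2.+1)%:R / (i.*2.+2)%:R).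

Lemma cbin_gt0 n : 0 < cbin n.
Proof. by apply: prodr_gt0 => i _; rewrite divr_gt0 ?ltr0n. Qed.

Lemma cbin0 : cbin 0 = 1.
Proof. by rewrite /cbin big_ord0. Qed.

Lemma cbinS n : n.+1%:R * cbin n.+1 = (n%:R + 2^-1) * cbin n.
Proof.
rewrite /cbin big_ord_recr /= -!muln2 -[(n * 2).+2]/(n.+1 * 2)%N natrM.
rewrite -[(n * 2).+1]addn1 natrD natrM -natr1.
have : n%:R + 1 != 0 :> R by rewrite natr1 pnatr_eq0.
by move: (\prod_(_ < _) _) n%:R => p x x0; field.
Qed.

(** The square of the series [(1 - x) ^ (- 1/2)] is [(1 - x) ^ (- 1)], with all
    coefficients equal to 1.  Without power series: weighting the sum by [k] amounts, by
    symmetry, to weighting it by [n / 2], and [cbinS] then relates two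
    consecutive sums. *)
Lemma cbin_conv n : \sum_(k < n.+1) cbin k * cbin (n - k) = 1.
Proof.
elim: n => [|n IH]; first by rewrite big_ord1 cbin0 mulr1.
pose c m := \sum_(k < m.+1) cbin k * cbin (m - k).
have sym m : \sum_(k < m.+1) k%:R * (cbin k * cbin (m - k)) = m%:R / 2 * c m.
  set s := LHS.
  have : s + s = m%:R * c m.
    rewrite {2}/s (reindex_inj rev_ord_inj) /= -big_split mulr_sumr /=.
    apply: eq_bigr => i _; have im : (i <= m)%N by rewrite -ltnS.
    by rewrite subSS subKn// (mulrC (cbin (m - i))) -mulrDl -natrD subnKC.
  by move=> h; lra.
have e : n.+1%:R / 2 * c n.+1 = n.+1%:R / 2 * c n.
  rewrite -sym big_ord_recl /= mul0r add0r.
  under eq_bigr => i _ do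
    rewrite /bump /= add1n subSS mulrA cbinS -mulrA mulrDl.
  by rewrite big_split /= sym -mulr_sumr -/(c n) -natr1; field.
rewrite -[LHS]/(c n.+1) -[RHS]IH; apply: (mulfI _ e).
by rewrite mulf_neq0// pnatr_eq0.
Qed.

(** The antiderivative vanishing at 0 of [cos ^+ n], given by the reduction
    formula of integration by parts: its values at [pi / 2] are the Wallis
    integrals. *)
Fixpoint cosF n (x : R) : R :=
  match n with
  | 0 => x
  | 1 => sin x
  | (m.+1 as p).+1 =>
      (cos x ^+ p * sin x + p%:R * cosF m x) / p.+1%:R
  end.

Lemma cosFSS n x : cosF n.+2 x =
  (cos x ^+ n.+1 * sin x + n.+1%:R * cosF n x) / n.+2%:R.
Proof. by []. Qed.

Lemma is_derive_cosF n (x : R) : is_derive x 1 (cosF n) (cos x ^+ n).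
Proof.
elim/ltn_ind: n x => -[|[|n]] IH x /=.
- by rewrite expr0; exact: is_derive_id.
- by rewrite expr1; exact: is_derive_sin.
have IHn := IH n (ltnW (ltnSn _)) x.
rewrite (_ : (fun _ => _) =
   n.+2%:R^-1 \*: ((cos ^+ n.+1) * sin + n.+1%:R \*: cosF n)); last first.
  by apply/funext => y; rewrite /= !fctE mulrC.
apply: is_derive_eq.
have s2 : sin x * sin x = 1 - cos x ^+ 2 by rewrite -(cos2Dsin2 x); ring.
rewrite !exprS !fctE /= /GRing.scale /= -[n.+2%:R]natr1.
have : n.+1%:R + 1 != 0 :> R by rewrite natr1 pnatr_eq0.
move: s2 (cos x ^+ n) (n.+1%:R : R) => s2 p N N0.
apply: (mulfI N0); rewrite [LHS]mulrA mulfV// mul1r.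
have -> : sin x * (N * p * - sin x) = - N * p * (sin x * sin x) by ring.
by rewrite s2; ring.
Qed.

Lemma cosF0 n : cosF n 0 = 0.
Proof.
elim/ltn_ind: n => -[|[|n]] IH //=; first exact: sin0.
by rewrite sin0 mulr0 add0r IH ?mulr0 ?mul0r// ltnW.
Qed.

Lemma cosF_pihalf_even n : cosF n.*2 (pi / 2) = cbin n * (pi / 2).
Proof.
elim: n => [|n IH]; first by rewrite cbin0 mul1r.
rewrite doubleS /= cos_pihalf expr0n /= mul0r add0r IH.
have := cbinS n; rewrite -!muln2 -[(n * 2).+2]/(n.+1 * 2)%N natrM.
rewrite -[(n * 2).+1]addn1 natrD natrM -natr1.
have : n%:R + 1 != 0 :> R by rewrite natr1 pnatr_eq0.
move: (cbin n.+1) (cbin n) (n%:R : R) pi => b a N p N0 e.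
have -> : b = (N + 2^-1) * a / (N + 1) by rewrite -e; field.
by field.
Qed.

Lemma cosF_pihalf_odd n :
  cosF n.*2.+1 (pi / 2) * (n.*2.+1%:R * cbin n) = 1.
Proof.
elim: n => [|n IH]; first by rewrite /= sin_pihalf cbin0 !mulr1.
rewrite doubleS cosFSS cos_pihalf exprS !mul0r add0r -[RHS]IH.
move: (cosF n.*2.+1 _) (cbinS n) => p.
rewrite -!muln2 -[(n * 2).+3]/(n.+1 * 2).+1 -[(n * 2).+2]/(n.+1 * 2)%N.
rewrite -[(n.+1 * 2).+1]addn1 -[(n * 2).+1]addn1.
rewrite !(natrD,natrM) -natr1.
have N0 : 0 <= n%:R :> R by [].
move: (cbin n.+1) (cbin n) (n%:R : R) N0 => b a N N0 e.
have -> : (N + 1) * 2 * p / ((N + 1) * 2 + 1) * (((N + 1) * 2 + 1) * b)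
  = 2 * p * ((N + 1) * b) by field; lra.
by rewrite e; field.
Qed.

Lemma cosF_le n m : (n <= m)%N -> cosF m (pi / 2) <= cosF n (pi / 2).
Proof.
move=> nm; rewrite -subr_ge0.
have dF (x : R) : is_derive x 1 (cosF n \- cosF m) (cos x ^+ n - cos x ^+ m).
  have Fn := is_derive_cosF n x; have Fm := is_derive_cosF m x.
  exact: is_deriveB.
have cF : continuous (cosF n \- cosF m).
  by move=> x; apply/differentiable_continuous/derivable1_diffP; have [] := dF x.
have pi0 : 0 <= pi / 2 :> R by rewrite divr_ge0// pi_ge0.
suff : (cosF n \- cosF m) 0 <= (cosF n \- cosF m) (pi / 2).
  by rewrite /= !cosF0 subrr.
apply: (@ger0_derive1_le_cc _ _ 0 (pi / 2)) => //.
- move=> x; rewrite in_itv/= => /andP[x0 xpi].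
  rewrite derive1E; have [_ ->] := dF x.
  rewrite subr_ge0 ler_wiXn2l//.
  + by rewrite cos_ge0_pihalf// (ltW xpi) andbT (le_trans _ (ltW x0))// oppr_le0.
- exact: continuous_subspaceT.
- by rewrite in_itv/= lexx.
- by rewrite in_itv/= lexx andbT.
Qed.

(** The two bounds are the Wallis integrals of consecutive exponents compared
    by [cosF_le]. *)
Lemma cbin_sq_le n : n%:R * cbin n ^+ 2 <= pi^-1.
Proof.
case: n => [|n]; first by rewrite mul0r invr_ge0 pi_ge0.
have := cosF_le (leqnSn n.*2.+1); rewrite -doubleS cosF_pihalf_even.
have := cosF_pihalf_odd n; have c0 := cbin_gt0 n; have := cbinS n.
have c1 := cbin_gt0 n.+1; have := pi_gt0 R.
rewrite -!muln2 -[(n * 2).+1]addn1 !(natrD,natrM) -natr1.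
have N0 : 0 <= n%:R :> R by [].
move: (cbin n.+1) (cbin n) (n%:R : R) N0 c0 c1 pi (cosF _ _)
  => b a N N0 a0 b0 p w p0 e we ble.
rewrite -div1r ler_pdivlMr//.
have e2 : w * (2 * ((N + 1) * b)) = 1 by rewrite e -[RHS]we; field.
have h : 0 <= (N + 1) * b by rewrite mulr_ge0// ?ltW//; lra.
nra.
Qed.

Lemma cbin_sq_ge n : pi^-1 <= (n%:R + 2^-1) * cbin n ^+ 2.
Proof.
have := cosF_le (leqnSn n.*2); rewrite cosF_pihalf_even.
have := cosF_pihalf_odd n; have c0 := cbin_gt0 n; have := pi_gt0 R.
rewrite -!muln2 -[(n * 2).+1]addn1 !(natrD,natrM).
have N0 : 0 <= n%:R :> R by [].
move: (cbin n) (n%:R : R) N0 c0 pi (cosF _ _)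
  => a N N0 a0 p w p0 we wle.
rewrite -div1r ler_pdivrMr//.
have h : 0 <= (N * 2 + 1) * a by rewrite mulr_ge0// ?ltW//; lra.
have := ler_wpM2r h wle; rewrite we => /le_trans; apply.
by rewrite le_eqVlt; apply/orP; left; apply/eqP; field.
Qed.

Lemma cvg_invn : n%:R^-1 @[n --> \oo] --> (0 : R).
Proof. by rewrite -cvg_shiftS; exact: cvg_harmonic. Qed.

Lemma cvg_cbin_sq : n%:R * cbin n ^+ 2 @[n --> \oo] --> pi^-1.
Proof.
apply: (@squeeze_cvgr _ _ _ _ (fun n => pi^-1 - (2 * n%:R)^-1) (fun=> pi^-1)).
- near=> n; rewrite cbin_sq_le andbT lerBlDr.
  apply: le_trans (cbin_sq_ge n) _; rewrite mulrDl lerD2l.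
  have n0 : 0 < n%:R :> R by rewrite ltr0n; near: n; exact: nbhs_infty_gt.
  rewrite invfM ler_wpM2l// -div1r ler_pdivlMr// mulrC.
  apply: le_trans (cbin_sq_le n) _.
  by rewrite invf_le1 ?pi_gt0// (le_trans _ (pi_ge2 _))// ler1n.
- rewrite -[X in _ --> X]subr0; apply: cvgB; first exact: cvg_cst.
  under eq_fun do rewrite invfM; rewrite -(mulr0 2^-1).
  exact: cvgZr cvg_invn.
- exact: cvg_cst.
Unshelve. all: by end_near. Qed.

Lemma cbin_le n : (0 < n)%N -> cbin n <= (Num.sqrt n%:R)^-1.
Proof.
move=> n0; rewrite -[leLHS]gtr0_norm ?cbin_gt0// -sqrtr_sqr.
rewrite -sqrtrV ?ler_sqrt ?invr_ge0//.
rewrite -div1r ler_pdivlMr ?ltr0n// mulrC (le_trans (cbin_sq_le n))//.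
by rewrite invf_le1 ?pi_gt0// (le_trans _ (pi_ge2 _))// ler1n.
Qed.

End cbin.

(** * Slowly varying sequences *)

(** Uniform slow variation.  On windows [n <= k <= 2 n] of integers this is what
    estimates of convolutions consume; for a measurable function it follows from
    slow variation at fixed ratios, but not in general. *)
Definition usv (R : realType) (X : nat -> R) : Prop :=
  (\forall n \near \oo, 0 < X n) /\
  forall e : R, 0 < e -> \forall n \near \oo,
    forall k, (n <= k <= n.*2)%N -> `|X k - X n| <= e * X n.

Section usv.
Variable R : realType.
Implicit Types X Y : nat -> R.

Lemma near_eq_cvg_to X Y (l : R) : (\forall n \near \oo, X n = Y n) ->
  X n @[n --> \oo] --> l -> Y n @[n --> \oo] --> l.
Proof. by move=> XY; apply: cvg_trans; exact: near_eq_cvg. Qed.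

Lemma asymp_equivP X Y : (\forall n \near \oo, 0 < Y n) ->
  asymp_equiv \oo X Y <->
  forall e : R, 0 < e -> \forall n \near \oo, `|X n - Y n| <= e * Y n.
Proof.
move=> Y0; split.
  move=> /cvgrPdist_le XY e e0; near=> n.
  have Yn : 0 < Y n by near: n.
  have : `|1 - X n / Y n| <= e by near: n; exact: XY.
  rewrite -(ler_pM2r Yn) -[X in _ * X <= _](gtr0_norm Yn) -normrM mulrBl mul1r.
  by rewrite divfK ?gt_eqF// distrC.
move=> XY; apply/cvgrPdist_le => e e0; near=> n.
have Yn : 0 < Y n by near: n.
rewrite -(ler_pM2r Yn) -[X in _ * X <= _](gtr0_norm Yn) -normrM mulrBl mul1r.
rewrite divfK ?gt_eqF// distrC; near: n; exact: XY.
Unshelve. all: by end_near. Qed.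

Lemma near_forall_ge (P : nat -> Prop) : (\forall n \near \oo, P n) ->
  \forall n \near \oo, forall k, (n <= k)%N -> P k.
Proof.
move=> [N _ NP]; exists N => // n /= Nn k nk; apply: NP => /=.
exact: leq_trans nk.
Qed.

Lemma usv_dyadic X m (e : R) : usv X -> 0 < e -> \forall n \near \oo,
  forall k, (n <= k <= 2 ^ m * n)%N -> `|X k - X n| <= e * X n.
Proof.
move=> [X0 Xsv]; elim: m e => [|m IH] e e0.
  near=> n => k; rewrite mul1n -eqn_leq => /eqP <-.
  by rewrite subrr normr0 mulr_ge0// ltW//; near: n.
pose e' := Num.min 1 (e / 3).
have e'0 : 0 < e' by rewrite lt_min ltr01 divr_gt0.
have [e'1 e'3] : e' <= 1 /\ 3 * e' <= e.
  by split; rewrite /e' ?ge_min ?lexx// mulrC -ler_pdivlMr// ge_min lexx orbT.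
near=> n => k /andP[nk kn].
have Xn : 0 < X n by near: n.
have near2 : forall j, (n <= j)%N -> forall i, (j <= i <= j.*2)%N ->
    `|X i - X j| <= e' * X j.
  by near: n; apply: near_forall_ge; exact: Xsv.
have [k2n|k2n] := leqP k n.*2.
  apply: le_trans (near2 n _ k _) _; rewrite ?leqnn ?nk//.
  by rewrite ler_wpM2r ?ltW//; lra.
have nj : (n <= uphalf k)%N by lia.
have jn : (uphalf k <= 2 ^ m * n)%N by move: kn; rewrite expnS; lia.
have Xj : `|X (uphalf k) - X n| <= e' * X n.
  have : forall k, (n <= k <= 2 ^ m * n)%N -> `|X k - X n| <= e' * X n.
    by near: n; exact: IH.
  by apply; rewrite nj jn.
have Xk : `|X k - X (uphalf k)| <= e' * X (uphalf k).
  by apply: near2 => //; lia.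
move: Xj Xk; rewrite !ler_norml => /andP[a1 a2] /andP[b1 b2].
by apply/andP; split; nra.
Unshelve. all: by end_near. Qed.

Lemma usv_asymp X Y : (\forall n \near \oo, 0 < X n) ->
  asymp_equiv \oo X Y -> usv Y -> usv X.
Proof.
move=> X0 XY [Y0 Ysv]; split => // e e0.
pose h := Num.min (1/2) (e / 8).
have h0 : 0 < h by rewrite lt_min divr_gt0//= divr_gt0.
have [h1 h8] : h <= 1/2 /\ 8 * h <= e.
  by split; rewrite /h ?ge_min ?lexx// mulrC -ler_pdivlMr// ge_min lexx orbT.
near=> n => k /andP[nk kn].
have near1 : forall j, (n <= j)%N -> `|X j - Y j| <= h * Y j.
  near: n; apply: near_forall_ge; exact: (proj1 (asymp_equivP X Y0) XY).
have Yn : 0 < Y n by near: n.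
have Yk : `|Y k - Y n| <= h * Y n.
  have : forall k, (n <= k <= n.*2)%N -> `|Y k - Y n| <= h * Y n.
    by near: n; exact: Ysv.
  by apply; rewrite nk.
move: Yk (near1 n (leqnn n)) (near1 k nk).
rewrite !ler_norml => /andP[a1 a2] /andP[b1 b2] /andP[c1 c2].
have p1 : h * Y k <= 3 / 2 * (h * Y n) by nra.
have Xn : Y n / 2 <= X n by nra.
have p2 : 4 * (h * Y n) <= e * X n.
  have := ler_wpM2l (ltW h0) Xn; have := ler_wpM2r (_ : 0 <= X n) h8; nra.
by apply/andP; split; lra.
Unshelve. all: by end_near. Qed.

Lemma asymp_gt0 X Y : asymp_equiv \oo X Y -> (\forall n \near \oo, 0 <= X n) ->
  (\forall n \near \oo, 0 <= Y n) -> \forall n \near \oo, 0 < X n /\ 0 < Y n.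
Proof.
move=> /cvgrPdist_lt /(_ 1 ltr01) XY X0 Y0; near=> n.
have Xn : 0 <= X n by near: n.
have Yn : 0 <= Y n by near: n.
have : `|1 - X n / Y n| < 1 by near: n.
have [->|Xn0] := eqVneq (X n) 0; first by rewrite mul0r subr0 normr1 ltxx.
have [->|Yn0] := eqVneq (Y n) 0; first by rewrite invr0 mulr0 subr0 normr1 ltxx.
by rewrite !lt_def Xn Yn Xn0 Yn0.
Unshelve. all: by end_near. Qed.

Lemma asymp_sym X Y : asymp_equiv \oo X Y -> asymp_equiv \oo Y X.
Proof.
move=> /(cvgV (oner_neq0 _)); rewrite invr1; apply: cvg_trans; apply: near_eq_cvg.
by near=> n => /=; rewrite invf_div.
Unshelve. all: by end_near. Qed.

Lemma asymp_trans X Y Z : (\forall n \near \oo, 0 < Y n) ->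
  asymp_equiv \oo X Y -> asymp_equiv \oo Y Z -> asymp_equiv \oo X Z.
Proof.
move=> Y0 XY YZ.
have : (X n / Y n) * (Y n / Z n) @[n --> \oo] --> (1 * 1 : R) by exact: cvgM.
rewrite mulr1; apply: near_eq_cvg_to; near=> n.
have Yn : 0 < Y n by near: n.
by rewrite mulrA divfK ?gt_eqF.
Unshelve. all: by end_near. Qed.

Lemma asymp_mul X X' Y Y' : asymp_equiv \oo X X' -> asymp_equiv \oo Y Y' ->
  asymp_equiv \oo (fun n => X n * Y n) (fun n => X' n * Y' n).
Proof.
move=> XX YY.
have : (X n / X' n) * (Y n / Y' n) @[n --> \oo] --> (1 * 1 : R) by exact: cvgM.
rewrite mulr1; apply: near_eq_cvg_to; near=> n.
by rewrite invfM mulrACA.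
Unshelve. all: by end_near. Qed.

Lemma asymp_inv X Y : asymp_equiv \oo X Y ->
  asymp_equiv \oo (fun n => (X n)^-1) (fun n => (Y n)^-1).
Proof.
move=> /(cvgV (oner_neq0 _)); rewrite invr1; apply: cvg_trans.
by apply: near_eq_cvg; near=> n => /=; rewrite invfM.
Unshelve. all: by end_near. Qed.

Lemma asymp_refl X : (\forall n \near \oo, 0 < X n) -> asymp_equiv \oo X X.
Proof.
move=> X0; apply/asymp_equivP => // e e0; near=> n.
by rewrite subrr normr0 mulr_ge0 ?ltW//; near: n.
Unshelve. all: by end_near. Qed.

Lemma usv_cst (c : R) : 0 < c -> usv (fun=> c).
Proof.
move=> c0; split; first by near=> n.
by move=> e e0; near=> n => k _; rewrite subrr normr0 mulr_ge0// ltW.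
Unshelve. all: by end_near. Qed.

Lemma usvM X Y : usv X -> usv Y -> usv (fun n => X n * Y n).
Proof.
move=> [X0 Xsv] [Y0 Ysv]; split.
  by near=> n; rewrite mulr_gt0//; near: n.
move=> e e0; pose h := Num.min 1 (e / 3).
have h0 : 0 < h by rewrite lt_min ltr01 divr_gt0.
have [h1 h3] : h <= 1 /\ 3 * h <= e.
  by split; rewrite /h ?ge_min ?lexx// mulrC -ler_pdivlMr// ge_min lexx orbT.
near=> n => k nk.
have Xn : 0 < X n by near: n.
have Yn : 0 < Y n by near: n.
have : `|X k - X n| <= h * X n.
  by move: k nk; near: n; exact: Xsv.
have : `|Y k - Y n| <= h * Y n.
  by move: k nk; near: n; exact: Ysv.
have -> : X k * Y k - X n * Y n =
   (X k - X n) * (Y k - Y n) + (X k - X n) * Y n + X n * (Y k - Y n) by ring.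
move: (X k - X n) (Y k - Y n) => x y yh xh.
rewrite (le_trans (ler_normD _ _))// (le_trans (lerD (ler_normD _ _) (lexx _)))//.
rewrite !normrM !(gtr0_norm Xn) !(gtr0_norm Yn).
have xy := ler_pM (normr_ge0 x) (normr_ge0 y) xh yh.
have XY : 0 < X n * Y n by rewrite mulr_gt0.
have h2 : h * h <= h by rewrite ler_piMr// ltW.
have q2 : h * X n * (h * Y n) <= h * (X n * Y n).
  by rewrite mulrACA ler_wpM2r// ltW.
have q3 := ler_wpM2r (ltW Yn) xh; have q4 := ler_wpM2l (ltW Xn) yh.
have q5 := ler_wpM2r (ltW XY) h3.
nra.
Unshelve. all: by end_near. Qed.

End usv.

(** * Convolution of sequences of order n ^ (- 1/2) *)

(* [lia] on the hypotheses about [nat] only: it is slow on real ones. *)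
Ltac nat_lia :=
  repeat match goal with x := _ : nat |- _ => subst x end;
  repeat match goal with
  | H : is_true (leq _ _) |- _ => revert H
  | H : is_true (andb (leq _ _) (leq _ _)) |- _ => revert H
  | H : @eq nat _ _ |- _ => revert H
  end; clear; intros; lia.

Section convolution.
Variable R : realType.
Implicit Types X Y : nat -> R.

Lemma sqrt_nat_sqr n : Num.sqrt n%:R ^+ 2 = n%:R :> R.
Proof. by rewrite sqr_sqrtr. Qed.

Lemma le_of_sqr_le (x y : R) : 0 <= y -> x ^+ 2 <= y ^+ 2 -> x <= y.
Proof. by move=> y0 xy; rewrite leNgt; apply/negP => yx; nra. Qed.

(** From [n / 2] to [n] the right-hand side grows by a factor close to
    [sqrt 2], while the new block of the sum is at most of the order of the
    right-hand side: an induction on halves closes for [C] large enough, and the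
    values of [n] where [X] is not yet regular are absorbed in [C]. *)
Lemma cbin_sum_le X : usv X -> (forall k, 0 <= X k) -> exists2 C, 0 < C &
  \forall n \near \oo,
    \sum_(0 <= k < n.+1) X k * cbin R k <= C * (X n * Num.sqrt n%:R).
Proof.
move=> [X0 Xsv] Xge0; pose W n := \sum_(0 <= k < n.+1) X k * cbin R k.
have W0 n : 0 <= W n.
  by apply: sumr_ge0 => k _; rewrite mulr_ge0// ltW// cbin_gt0.
have h10 : 0 < 1 / 10 :> R by lra.
have : \forall n \near \oo, [/\ (8 <= n)%N, 0 < X n &
    forall k, (n <= k <= n.*2)%N -> `|X k - X n| <= 1 / 10 * X n].
  near=> n; split; first by near: n; exact: nbhs_infty_ge.
  - by near: n.
  - by near: n; exact: Xsv.
move=> [N _ HN].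
pose B := \sum_(0 <= n < N.*2.+1) W n / (X n * Num.sqrt n%:R).
have B0 n : 0 <= W n / (X n * Num.sqrt n%:R).
  by rewrite divr_ge0// mulr_ge0// sqrtr_ge0.
exists (6 + B); first by rewrite ltr_wpDr// sumr_ge0.
exists N => // n /= Nn; elim/ltn_ind: n Nn => n IH Nn.
have [n8 Xn _] := HN _ Nn.
have sn0 : 0 < Num.sqrt n%:R :> R by rewrite sqrtr_gt0 ltr0n; nat_lia.
have sn2 := sqrt_nat_sqr n.
have [nN|nN] := ltnP n N.*2.+1.
  rewrite -ler_pdivrMr ?mulr_gt0//; apply: (@le_trans _ _ B).
    by rewrite -/(W n) /B (bigD1_seq n) ?iota_uniq ?mem_index_iota//= lerDl sumr_ge0.
  by rewrite lerDr.
pose m := uphalf n.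
have [mN mn] : (N <= m)%N /\ (m < n)%N by rewrite /m; split; nat_lia.
have [m8 Xm Hm] := HN _ mN.
have := IH _ mn mN; rewrite -/(W m) -/(W n) => Wm.
have Xnm : 9 / 10 * X m <= X n.
  have := Hm n; rewrite ler_norml => /(_ _)/andP[|+ _]; last by lra.
  by rewrite /m; nat_lia.
have sm0 : 0 < Num.sqrt m%:R :> R by rewrite sqrtr_gt0 ltr0n; nat_lia.
have sm2 := sqrt_nat_sqr m.
have smn : Num.sqrt m%:R <= 3 / 4 * Num.sqrt n%:R :> R.
  apply: le_of_sqr_le; first by lra.
  rewrite exprMn sm2 sn2.
  have : (16 * m)%:R <= (9 * n)%:R :> R by rewrite ler_nat /m; nat_lia.
  by rewrite !natrM; lra.
have snm : Num.sqrt n%:R <= 3 / 2 * Num.sqrt m%:R :> R.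
  apply: le_of_sqr_le; first by lra.
  rewrite exprMn sm2 sn2.
  have : n%:R <= (2 * m)%:R :> R by rewrite ler_nat /m; nat_lia.
  by rewrite natrM; have : 0 <= m%:R :> R by []; lra.
have -> : W n = W m + \sum_(m.+1 <= k < n.+1) X k * cbin R k.
  by rewrite /W (big_cat_nat (n := m.+1))//= ltnW.
have tail : \sum_(m.+1 <= k < n.+1) X k * cbin R k
    <= 11 / 12 * (X n * Num.sqrt n%:R).
  have : \sum_(m.+1 <= k < n.+1) X k * cbin R k <=
      \sum_(m.+1 <= k < n.+1) (11 / 6 * X n / Num.sqrt n%:R).
    rewrite !big_nat; apply: ler_sum => k /andP[mk kn].
    have Xk : X k <= 11 / 9 * X n.
      have := Hm k; rewrite ler_norml => /(_ _)/andP[|_]; last by lra.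
      by rewrite /m; nat_lia.
    have ck : cbin R k <= 3 / 2 / Num.sqrt n%:R.
      apply: le_trans (cbin_le _ _) _; first by nat_lia.
      have sk : Num.sqrt m%:R <= Num.sqrt k%:R :> R.
        by rewrite ler_sqrt ?ler_nat// ltnW.
      rewrite -[leLHS]mul1r ler_pdivlMr// mulrAC ler_pdivrMr; last first.
        exact: lt_le_trans sk.
      by lra.
    have -> : 11 / 6 * X n / Num.sqrt n%:R =
      (11 / 9 * X n) * (3 / 2 / Num.sqrt n%:R) by field; rewrite gt_eqF.
    by rewrite ler_pM// ltW// cbin_gt0.
  move/le_trans; apply; rewrite sumr_const_nat -[leLHS]mulr_natr.
  have : (n.+1 - m.+1)%:R <= Num.sqrt n%:R ^+ 2 / 2 :> R.
    rewrite sn2 ler_pdivlMr// -natrM ler_nat /m; nat_lia.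
  move: (Num.sqrt _) sn0 => s s0 le.
  apply: le_trans (_ : 11 / 6 * X n / s * (s ^+ 2 / 2) <= _).
    by rewrite ler_wpM2l// divr_ge0 ?ltW// mulr_gt0.
  by rewrite le_eqVlt; apply/orP; left; apply/eqP; field; rewrite gt_eqF.
have Bge0 : 0 <= B by apply: sumr_ge0 => k _; exact: B0.
have key : X m * Num.sqrt m%:R <= 5 / 6 * (X n * Num.sqrt n%:R).
  have -> : 5 / 6 * (X n * Num.sqrt n%:R) =
    (10 / 9 * X n) * (3 / 4 * Num.sqrt n%:R) by field.
  by rewrite ler_pM ?sqrtr_ge0//; lra.
have p0 : 0 < X n * Num.sqrt n%:R by rewrite mulr_gt0.
by nra.
Unshelve. all: by end_near. Qed.

Lemma near_div (p : nat) (P : nat -> Prop) : (0 < p)%N ->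
  (\forall n \near \oo, P n) -> \forall n \near \oo, P (n %/ p)%N.
Proof.
move=> p0 [N _ NP]; exists (N * p)%N => // n /= Nn; apply: NP => /=.
by rewrite leq_divRL.
Qed.

Lemma near_uphalf (P : nat -> Prop) :
  (\forall n \near \oo, P n) -> \forall n \near \oo, P (n - n %/ 2)%N.
Proof.
move=> [N _ NP]; exists (N * 2)%N => // n /= Nn; apply: NP => /=.
by nat_lia.
Qed.

(** By [cbin_sum_le] the indices up to [h = n / 4 ^ j] contribute at most a
    multiple of [sqrt h * cbin n], hence of [2 ^ (- j)]. *)
Lemma conv_left_end X Y e : usv X -> usv Y -> (forall k, 0 <= X k) ->
  (forall k, 0 <= Y k) -> 0 < e ->
  exists J, forall j, (J <= j)%N -> \forall n \near \oo,
    \sum_(0 <= k < (n %/ 4 ^ j).+1) X k * Y (n - k)%N * (cbin R k * cbin R (n - k))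
      <= e * (X n * Y n).
Proof.
move=> Xsv Ysv Xge0 Yge0 e0.
have [C C0 HC] := cbin_sum_le Xsv Xge0.
have [J HJ] : exists J : nat, 8 * C / e <= J%:R.
  by exists (Num.truncn (8 * C / e)).+1; rewrite ltW// truncnS_gt.
exists J.+1 => j Jj.
have jpow : J%:R <= 2 ^+ j :> R.
  rewrite -natrX ler_nat (leq_trans _ (ltnW (ltn_expl j _)))//; exact: ltnW.
have half0 : 0 < 1 / 2 :> R by lra.
have p0 : (0 < 4 ^ j)%N by rewrite expn_gt0.
have NW := near_div p0 HC.
have NX := near_div p0 (usv_dyadic j.*2.+1 Xsv half0).
have NY := near_uphalf (near_forall_ge (proj2 Ysv _ half0)).
near=> n; set h := (n %/ 4 ^ j)%N.
have nbig : (4 ^ j <= n)%N by near: n; exact: nbhs_infty_ge.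
have Wh : \sum_(0 <= k < h.+1) X k * cbin R k <= C * (X h * Num.sqrt h%:R).
  by rewrite /h; near: n; exact: NW.
have Xh' k : (h <= k <= 2 ^ j.*2.+1 * h)%N -> `|X k - X h| <= 1 / 2 * X h.
  by move: k; rewrite /h; near: n; exact: NX.
have Yh m : (n - n %/ 2 <= m)%N -> forall i, (m <= i <= m.*2)%N ->
    `|Y i - Y m| <= 1 / 2 * Y m.
  by move: m; near: n; exact: NY.
have hn : (h * 4 ^ j <= n)%N by exact: leq_trunc_div.
have nh : (n < h.+1 * 4 ^ j)%N by exact: ltn_ceil.
have h1 : (0 < h)%N by rewrite divn_gt0.
have hle : (h <= n)%N by exact: leq_div.
clearbody h.
have n2h : (n <= 2 ^ j.*2.+1 * h)%N.
  by rewrite expnS -mul2n expnM -[(2 ^ 2)%N]/4%N; move: (4 ^ j)%N nh; nia.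
have Xh : X h <= 2 * X n.
  have := Xh' n; rewrite hle n2h => /(_ isT).
  by rewrite ler_norml => /andP[]; lra.
have h2 : (h.*2 <= n)%N.
  have : (2 <= 4 ^ j)%N.
    by rewrite -[2%N]/(2 ^ 1)%N -[4%N]/(2 ^ 2)%N -expnM leq_exp2l//; nat_lia.
  by move: (4 ^ j)%N hn; nia.
have n0 : (0 < n)%N by rewrite (leq_trans h1).
have Yk k : (k <= h)%N -> Y (n - k)%N <= 2 * Y n.
  move=> kh; have : `|Y n - Y (n - k)%N| <= 1 / 2 * Y (n - k)%N.
    by apply: Yh; nat_lia.
  by rewrite ler_norml => /andP[]; lra.
have sn0 : 0 < Num.sqrt n%:R :> R by rewrite sqrtr_gt0 ltr0n.
have sh0 : 0 < Num.sqrt h%:R :> R by rewrite sqrtr_gt0 ltr0n.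
have ck k : (k <= h)%N -> cbin R (n - k) <= 2 / Num.sqrt n%:R.
  move=> kh; apply: le_trans (cbin_le _ _) _.
    by nat_lia.
  have snk : Num.sqrt n%:R <= 2 * Num.sqrt (n - k)%:R :> R.
    apply: le_of_sqr_le; first by rewrite mulr_ge0 ?sqrtr_ge0.
    rewrite exprMn !sqrt_nat_sqr -natrX -natrM ler_nat.
    by nat_lia.
  have snk0 : 0 < Num.sqrt (n - k)%:R :> R by lra.
  by rewrite ler_pdivlMr// mulrC ler_pdivrMr.
apply: (@le_trans _ _ (\sum_(0 <= k < h.+1)
    (2 * Y n * (2 / Num.sqrt n%:R)) * (X k * cbin R k))).
  rewrite !big_nat; apply: ler_sum => k /andP[_]; rewrite ltnS => kh.
  have -> : X k * Y (n - k)%N * (cbin R k * cbin R (n - k)) =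
    (Y (n - k)%N * cbin R (n - k)) * (X k * cbin R k) by ring.
  apply: ler_wpM2r; first by rewrite mulr_ge0// ltW// cbin_gt0.
  by apply: ler_pM => //; [rewrite ltW// cbin_gt0|exact: Yk|exact: ck].
rewrite -mulr_sumr.
have shn : Num.sqrt h%:R * 2 ^+ j <= Num.sqrt n%:R :> R.
  apply: le_of_sqr_le; first by rewrite sqrtr_ge0.
  rewrite exprMn !sqrt_nat_sqr -exprM mulnC exprM -!natrX -natrM ler_nat.
  exact: hn.
have shn2 : Num.sqrt h%:R * (8 * C) <= e * Num.sqrt n%:R :> R.
  have : 8 * C <= e * 2 ^+ j by rewrite [leRHS]mulrC -ler_pdivrMr// (le_trans HJ).
  by move=> le; have := ler_wpM2l (ltW e0) shn; have := ler_wpM2l (ltW sh0) le; lra.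
have Yn := Yge0 n; have Xn := Xge0 n.
apply: (@le_trans _ _ (2 * Y n * (2 / Num.sqrt n%:R) *
    (C * (2 * X n * Num.sqrt h%:R)))).
  apply: ler_wpM2l; first by rewrite !mulr_ge0 ?divr_ge0 ?sqrtr_ge0.
  by apply: le_trans Wh _; rewrite ler_pM2l// ler_pM2r.
have -> : 2 * Y n * (2 / Num.sqrt n%:R) * (C * (2 * X n * Num.sqrt h%:R)) =
  (X n * Y n) * (Num.sqrt h%:R * (8 * C)) / Num.sqrt n%:R.
  by field; rewrite gt_eqF.
rewrite ler_pdivrMr// [leRHS]mulrAC (mulrC (e * _)).
by rewrite ler_wpM2l ?mulr_ge0.
Unshelve. all: by end_near. Qed.

Lemma dist_prod (d x y a b : R) : 0 < d -> d <= 1 / 2 -> 0 <= x -> 0 <= y ->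
  0 < a -> 0 < b -> `|a - x| <= d * x -> `|b - y| <= d * y ->
  `|x * y - a * b| <= 6 * (d * (a * b)).
Proof.
move=> d0 d1 x0 y0 a0 b0; rewrite !ler_norml => /andP[a1 a2] /andP[b1 b2].
have xX : x <= 2 * a by nra.
have yY : y <= 2 * b by nra.
rewrite -ler_norml.
have -> : x * y - a * b = (x - a) * y + a * (y - b) by ring.
have hx : `|x - a| <= 2 * d * a.
  by rewrite ler_norml; apply/andP; split; nra.
have hy : `|y - b| <= 2 * d * b.
  by rewrite ler_norml; apply/andP; split; nra.
apply: le_trans (ler_normD _ _) _; rewrite !normrM (ger0_norm y0).
rewrite (gtr0_norm a0).
have i1 := ler_pM (normr_ge0 _) y0 hx yY.
have i2 := ler_wpM2l (ltW a0) hy.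
by lra.
Qed.

(** Since the weights [cbin k * cbin (n - k)] sum to 1 and give little mass to
    the indices near the ends, a convolution of slowly varying multiples of
    [cbin] averages quantities that are nearly constant in the bulk. *)
Theorem conv_usv X Y : usv X -> usv Y -> (forall k, 0 <= X k) ->
  (forall k, 0 <= Y k) ->
  asymp_equiv \oo
    (fun n => \sum_(k < n.+1) (X k * cbin R k) * (Y (n - k)%N * cbin R (n - k)))
    (fun n => X n * Y n).
Proof.
move=> Xsv Ysv Xge0 Yge0.
have [X0 Xsv'] := Xsv; have [Y0 Ysv'] := Ysv.
apply/asymp_equivP; first by near=> n; rewrite mulr_gt0//; near: n.
move=> e e0.
have [J1 H1] := conv_left_end Xsv Ysv Xge0 Yge0 (divr_gt0 e0 (ltr0n _ 6)).
have [J2 H2] := conv_left_end Ysv Xsv Yge0 Xge0 (divr_gt0 e0 (ltr0n _ 6)).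
have one0 (k : nat) : 0 <= 1 :> R by [].
have [J3 H3] := conv_left_end (@usv_cst R 1 ltr01) (@usv_cst R 1 ltr01) one0 one0
  (divr_gt0 e0 (ltr0n _ 6)).
pose j := (J1 + J2 + J3).+1.
pose d := Num.min (1 / 2) (e / 18).
have d0 : 0 < d by rewrite lt_min divr_gt0//= divr_gt0.
have [d1 d8] : d <= 1 / 2 /\ 18 * d <= e.
  by split; rewrite /d ?ge_min ?lexx// mulrC -ler_pdivlMr// ge_min lexx orbT.
have p0 : (0 < 4 ^ j)%N by rewrite expn_gt0.
have NX := near_div p0 (near_forall_ge (usv_dyadic j.*2 Xsv d0)).
have NY := near_div p0 (near_forall_ge (usv_dyadic j.*2 Ysv d0)).
near=> n; pose w k := cbin R k * cbin R (n - k).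
have w0 k : 0 <= w k by rewrite mulr_ge0// ltW// cbin_gt0.
set h := (n %/ 4 ^ j)%N.
have nbig : (4 ^ j <= n)%N by near: n; exact: nbhs_infty_ge.
have Xn : 0 < X n by near: n.
have Yn : 0 < Y n by near: n.
have L1 : \sum_(0 <= k < h.+1) X k * Y (n - k)%N * w k <= e / 6 * (X n * Y n).
  by rewrite /h /w; near: n; apply: H1; rewrite /j; nat_lia.
have L2 : \sum_(0 <= k < h.+1) Y k * X (n - k)%N * w k <= e / 6 * (Y n * X n).
  by rewrite /h /w; near: n; apply: H2; rewrite /j; nat_lia.
have L3 : \sum_(0 <= k < h.+1) 1 * 1 * w k <= e / 6 * (1 * 1).
  by rewrite /h /w; near: n; apply: H3; rewrite /j; nat_lia.
have Xd k : (h <= k)%N -> forall i, (k <= i <= 2 ^ j.*2 * k)%N ->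
    `|X i - X k| <= d * X k.
  by move: k; rewrite /h; near: n; exact: NX.
have Yd k : (h <= k)%N -> forall i, (k <= i <= 2 ^ j.*2 * k)%N ->
    `|Y i - Y k| <= d * Y k.
  by move: k; rewrite /h; near: n; exact: NY.
have hn : (h * 4 ^ j <= n)%N by exact: leq_trunc_div.
have nh : (n < h.+1 * 4 ^ j)%N by exact: ltn_ceil.
have p4 : (4 <= 4 ^ j)%N by rewrite /j expnS leq_pmulr ?expn_gt0.
have h1 : (0 < h)%N by rewrite divn_gt0.
have n2h k : (h < k)%N -> (n <= 2 ^ j.*2 * k)%N.
  rewrite -mul2n expnM -[(2 ^ 2)%N]/4%N => hk.
  by move: (4 ^ j)%N nh hk; clear => p; nia.
clearbody h.
have h2 : (h.*2.+1 <= n)%N by move: (4 ^ j)%N p4 hn h1; clear => p; nia.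
clear hn nh p4 nbig.
have XYn : 0 < X n * Y n by exact: mulr_gt0.
have w1 : \sum_(0 <= k < n.+1) w k = 1 by rewrite big_mkord cbin_conv.
have -> : \sum_(k < n.+1) (X k * cbin R k) * (Y (n - k)%N * cbin R (n - k)) -
    X n * Y n = \sum_(0 <= k < n.+1) (X k * Y (n - k)%N - X n * Y n) * w k.
  rewrite big_mkord -[X in _ - X]mulr1 -w1 mulr_sumr big_mkord -sumrB.
  by apply: eq_bigr => k _; rewrite /w; ring.
apply: le_trans (ler_norm_sum _ _ _) _.
pose f (k : nat) : R := `|(X k * Y (n - k)%N - X n * Y n) * w k|.
have fle k : f k <= X k * Y (n - k)%N * w k + (X n * Y n) * (1 * 1 * w k).
  rewrite /f normrM (ger0_norm (w0 k)) !mul1r -mulrDl ler_wpM2r//.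
  by apply: le_trans (ler_normB _ _) _; rewrite !ger0_norm ?mulr_ge0.
rewrite -[X in X <= _]/(\sum_(0 <= k < n.+1) f k) (big_cat_nat (n := h.+1))//=; last by nat_lia.
rewrite [X in _ + X](big_cat_nat (n := (n - h)%N))//=; [|by nat_lia|by nat_lia].
have F1 : \sum_(0 <= k < h.+1) f k <= e / 3 * (X n * Y n).
  apply: le_trans (ler_sum _ (fun k _ => fle k)) _.
  rewrite big_split/= -mulr_sumr.
  apply: le_trans (lerD L1 (ler_wpM2l (ltW XYn) L3)) _.
  by rewrite le_eqVlt; apply/orP; left; apply/eqP; field.
have F3 : \sum_(n - h <= k < n.+1) f k <= e / 3 * (X n * Y n).
  rewrite -[(n - h)%N]add0n big_addn big_nat_rev/= add0n.
  rewrite (_ : n.+1 - (n - h) = h.+1)%N; last by nat_lia.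
  have : \sum_(0 <= k < h.+1) f (h.+1 - k.+1 + (n - h))%N <=
     \sum_(0 <= k < h.+1) (Y k * X (n - k)%N * w k + (X n * Y n) * (1 * 1 * w k)).
    rewrite !big_nat; apply: ler_sum => k /andP[_]; rewrite ltnS => kh.
    rewrite (_ : h.+1 - k.+1 + (n - h) = n - k)%N; last by nat_lia.
    apply: le_trans (fle _) _; rewrite subKn; last by nat_lia.
    rewrite (mulrC (X _)) /w subKn; last by nat_lia.
    by rewrite (mulrC (cbin R (n - k))).
  move/le_trans; apply.
  rewrite big_split/= -mulr_sumr.
  apply: le_trans (lerD L2 (ler_wpM2l (ltW XYn) L3)) _.
  by rewrite le_eqVlt; apply/orP; left; apply/eqP; field.
have F2 : \sum_(h.+1 <= k < n - h) f k <= e / 3 * (X n * Y n).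
  apply: (@le_trans _ _ (\sum_(h.+1 <= k < n - h) (e / 3 * (X n * Y n)) * w k)).
    rewrite !big_nat; apply: ler_sum => k /andP[hk kn].
    rewrite /f normrM (ger0_norm (w0 k)) ler_wpM2r//.
    have : `|Y n - Y (n - k)%N| <= d * Y (n - k)%N.
      by apply: Yd; rewrite ?n2h//; nat_lia.
    have : `|X n - X k| <= d * X k by apply: Xd; rewrite ?n2h//; nat_lia.
    move=> hx hy; have := dist_prod d0 d1 (Xge0 k) (Yge0 _) Xn Yn hx hy.
    move/le_trans; apply.
    rewrite mulrA ler_wpM2r ?(ltW XYn)//.
    by move: d8; clear; lra.
  rewrite -mulr_sumr ler_piMr//; first by rewrite mulr_ge0 ?divr_ge0// ltW.
  rewrite -w1 [leRHS](big_cat_nat (n := h.+1))//=; last by nat_lia.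
  rewrite [X in _ <= _ + X](big_cat_nat (n := (n - h)%N))//=; [|by nat_lia|by nat_lia].
  by rewrite addrCA lerDl addr_ge0// sumr_ge0.
apply: le_trans (lerD F1 (lerD F2 F3)) _.
by rewrite le_eqVlt; apply/orP; left; apply/eqP; field.
Unshelve. all: by end_near. Qed.

End convolution.

(** * Renewal sequences of exponent 1/2 *)

Section convolution_algebra.
Variable R : comNzRingType.
Implicit Types x y z : nat -> R.

Definition conv x y n : R := \sum_(k < n.+1) x k * y (n - k)%N.

(* Up to the index [n], convolution is multiplication of polynomials: this is
   where its algebraic laws come from. *)
Let trunc n x := \poly_(i < n.+1) x i.

Let coef_trunc n x k : (k <= n)%N -> (trunc n x)`_k = x k.
Proof. by move=> kn; rewrite coef_poly ltnS kn. Qed.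

Let convE n x y k : (k <= n)%N -> conv x y k = (trunc n x * trunc n y)`_k.
Proof.
move=> kn; rewrite coefM; apply: eq_bigr => i _.
have ik : (i <= k)%N by rewrite -ltnS.
by rewrite !coef_trunc ?(leq_trans ik)// (leq_trans (leq_subr _ _)).
Qed.

Lemma convC x y n : conv x y n = conv y x n.
Proof. by rewrite !(convE _ _ (leqnn n)) mulrC. Qed.

Lemma convA x y z n : conv x (conv y z) n = conv (conv x y) z n.
Proof.
have [l r] : conv x (conv y z) n = (trunc n x * (trunc n y * trunc n z))`_n /\
    conv (conv x y) z n = ((trunc n x * trunc n y) * trunc n z)`_n.
  split; rewrite coefM; apply: eq_bigr => i _; have ik : (i <= n)%N by rewrite -ltnS.
    by rewrite coef_trunc// -convE// leq_subr.
  by rewrite -convE// coef_trunc// leq_subr.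
by rewrite l r mulrA.
Qed.

Lemma convDl x x' y n :
  conv (fun k => x k + x' k) y n = conv x y n + conv x' y n.
Proof. by rewrite /conv -big_split; apply: eq_bigr => k _; rewrite mulrDl. Qed.

Lemma eq_conv x x' y y' n : x =1 x' -> y =1 y' -> conv x y n = conv x' y' n.
Proof. by move=> xx yy; apply: eq_bigr => k _; rewrite xx yy. Qed.

(** Multiplication by the index is a derivation of the convolution algebra. *)
Lemma conv_deriv x y n : n%:R * conv x y n =
  conv (fun k => k%:R * x k) y n + conv x (fun k => k%:R * y k) n.
Proof.
rewrite /conv mulr_sumr -big_split; apply: eq_bigr => k _ /=.
have kn : (k <= n)%N by rewrite -ltnS.
by rewrite -{1}(subnKC kn) natrD; ring.
Qed.

End convolution_algebra.

Section growth.
Variable R : realType.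

Lemma near_half (P : nat -> Prop) :
  (\forall n \near \oo, P n) -> \forall n \near \oo, P n./2.
Proof.
move=> [N _ NP]; exists N.*2 => // n /= Nn; apply: NP => /=.
by rewrite -(doubleK N) half_leq.
Qed.

(** Iterating the growth over one doubling gives geometric growth in the number
    of doublings; a linear lower bound in that number is enough. *)
Lemma near_unbounded (f : nat -> R) :
  (\forall n \near \oo, 0 < f n) ->
  (\forall n \near \oo, 6 / 5 * f n./2 <= f n) ->
  forall A, \forall n \near \oo, A <= f n.
Proof.
move=> [N0 _ f0] [N1 _ f1].
pose N := (N0 + N1).+1.
have [c c0 fc] : exists2 c, 0 < c & forall n, (N <= n)%N -> c <= f n.
  pose B := \sum_(0 <= n < N.*2) `|(f n)^-1|.
  have Bge0 : 0 <= B by apply: sumr_ge0.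
  have B1 : 0 < 1 + B by rewrite ltr_pwDl.
  exists (1 + B)^-1; first by rewrite invr_gt0.
  elim/ltn_ind => n IH Nn.
  have fn : 0 < f n by apply: f0 => /=; move: Nn; rewrite /N; clear; lia.
  have [nN|nN] := ltnP n N.*2.
    rewrite -(invrK (f n)) lef_pV2 ?posrE ?invr_gt0//.
    apply: (@le_trans _ _ B); last by rewrite lerDr.
    rewrite /B (bigD1_seq n) ?iota_uniq ?mem_index_iota//=.
    by rewrite ger0_norm ?invr_ge0 ?(ltW fn)// lerDl sumr_ge0.
  have h : (1 + B)^-1 <= f n./2.
    by apply: IH; move: Nn nN; rewrite /N; clear; lia.
  have : 6 / 5 * f n./2 <= f n.
    by apply: f1 => /=; move: Nn; rewrite /N; clear; lia.
  have : 0 < (1 + B)^-1 by rewrite invr_gt0.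
  by move: h; clear; lra.
have claim j : \forall n \near \oo, c * (1 + j%:R / 5) <= f n.
  elim: j => [|j IH].
    by exists N => // n Nn; rewrite mul0r addr0 mulr1; exact: fc.
  have IH2 := near_half IH; near=> n.
  have : c * (1 + j%:R / 5) <= f n./2 by near: n; exact: IH2.
  have : 6 / 5 * f n./2 <= f n by near: n; exists N1.
  rewrite -natr1; have : 0 <= j%:R :> R by [].
  by move: c0; clear; nra.
move=> A; have [j Aj] : exists j : nat, A <= c * (1 + j%:R / 5).
  exists (Num.truncn (5 * `|A| / c)).+1.
  have := truncnS_gt (5 * `|A| / c); rewrite ltr_pdivrMr//.
  by have := ler_norm A; move: c0; clear; nra.
by apply: filterS (claim j) => n; exact: le_trans.
Unshelve. all: by end_near. Qed.

(** Relative increments [o(1 / n)] add up to [o(1)] over a window of length [n]. *)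
Lemma usv_small_steps (w : nat -> R) : (\forall n \near \oo, 0 < w n) ->
  (forall e, 0 < e -> \forall n \near \oo, `|w n.+1 - w n| * n%:R <= e * w n) ->
  usv w.
Proof.
move=> w0 step; split => // e e0.
pose h := Num.min (1 / 2) (e / 2).
have h0 : 0 < h by rewrite lt_min divr_gt0//= divr_gt0.
have [h1 h2] : h <= 1 / 2 /\ 2 * h <= e.
  by split; rewrite /h ?ge_min ?lexx// mulrC -ler_pdivlMr// ge_min lexx orbT.
near=> n => k /andP[nk kn].
have n0 : (0 < n)%N by near: n; exact: nbhs_infty_gt.
have wn : 0 < w n by near: n.
have stepn i : (n <= i)%N -> `|w i.+1 - w i| * i%:R <= h * w i.
  by move: i; near: n; apply: near_forall_ge; exact: step.
have N0 : 0 < n%:R :> R by rewrite ltr0n.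
suff H j : (j <= n)%N -> `|w (n + j)%N - w n| * n%:R <= 2 * h * j%:R * w n.
  have kn' : (k - n <= n)%N by nat_lia.
  have := H _ kn'; rewrite subnKC//; have : (k - n)%:R <= n%:R :> R by rewrite ler_nat.
  move: `|_| (k - n)%:R => a b bn le; rewrite -(ler_pM2r N0).
  apply: le_trans le _.
  have : 0 <= n%:R * w n by rewrite ltW// mulr_gt0.
  have : 0 <= 2 * h * w n by rewrite ltW// !mulr_gt0.
  by move: bn h2; clear; nra.
elim: j => [|j IH] jn; first by rewrite addn0 subrr normr0 mul0r mulr0 mul0r.
have {}IH := IH (ltnW jn).
have jN : j%:R <= n%:R :> R by rewrite ler_nat ltnW.
have wj : w (n + j)%N <= 2 * w n.
  have : `|w (n + j)%N - w n| <= w n.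
    rewrite -(ler_pM2r N0); apply: le_trans IH _.
    have : 0 <= j%:R :> R by [].
    move=> j0; rewrite [leRHS]mulrC ler_wpM2r ?(ltW wn)//.
    by move: j0 jN (h1) (h0); clear; nra.
  by rewrite ler_norml => /andP[_]; lra.
have s1 := stepn (n + j)%N (leq_addr _ _).
have s2 : `|w (n + j).+1 - w (n + j)%N| * n%:R <= 2 * h * w n.
  apply: (@le_trans _ _ (h * w (n + j)%N)).
    apply: le_trans s1; apply: ler_wpM2l => //.
    by rewrite ler_nat leq_addr.
  by move: wj (h0); clear; nra.
rewrite addnS -natr1.
have -> : w (n + j).+1 - w n = (w (n + j).+1 - w (n + j)%N) + (w (n + j)%N - w n).
  by ring.
apply: (@le_trans _ _ (`|w (n + j).+1 - w (n + j)%N| * n%:R +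
   `|w (n + j)%N - w n| * n%:R)).
  by rewrite -mulrDl ler_wpM2r// ler_normD.
by move: IH s2; lra.
Unshelve. all: by end_near. Qed.

End growth.

Section renewal.
Variable R : realType.
Variables (q u : nat -> R).
Hypotheses (q0 : q 0 = 0) (q_ge0 : forall n, 0 <= q n).
Hypothesis q_sum : \sum_(k < n.+1) q k @[n --> \oo] --> (1 : R).
Hypothesis q_usv : usv (fun n => 2 * n%:R * q n / cbin R n).
Hypotheses (u0 : u 0 = 1)
  (uS : forall n, u n.+1 = \sum_(k < n.+1) q k.+1 * u (n - k)%N).

(* [r] is the tail of [q] and [U] the renewal function; [G] is the equivalent of
   [r] given by Karamata's theorem, and [y] its slowly varying part. *)
Let r n : R := 1 - \sum_(k < n.+1) q k.
Let U n : R := \sum_(k < n.+1) u k.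
Let v n : R := n%:R * q n.
Let G n : R := 2 * n%:R * q n.
Let y n : R := G n / cbin R n.

Let r0 : r 0 = 1.
Proof. by rewrite /r big_ord1 q0 subr0. Qed.

Let rS n : r n.+1 = r n - q n.+1.
Proof. by rewrite /r big_ord_recr /= opprD addrA. Qed.

Let r_le m n : (m <= n)%N -> r n <= r m.
Proof.
by move/subnKC <-; elim: (n - m)%N => [|k IH];
  rewrite ?addn0// addnS rS (le_trans _ IH)// gerBl.
Qed.

Let r_cvg : r n @[n --> \oo] --> (0 : R).
Proof. by rewrite -(subrr 1); apply: cvgB => //; exact: cvg_cst. Qed.

Let r_ge0 n : 0 <= r n.
Proof.
rewrite leNgt; apply/negP => rn; have /cvgrPdist_lt/(_ (- r n)) := r_cvg.
rewrite oppr_gt0 => /(_ rn) [N _ /(_ (maxn n N) (leq_maxr _ _))].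
rewrite sub0r normrN => /ltr_normlP[+ _].
by have := r_le (leq_maxl n N); lra.
Qed.

Let u_ge0 n : 0 <= u n.
Proof.
elim/ltn_ind: n => -[|n] IH; first by rewrite u0.
by rewrite uS sumr_ge0// => k _; rewrite mulr_ge0// IH// ltnS leq_subr.
Qed.

Let conv_qu n : conv q u n = u n - (n == 0%N)%:R.
Proof.
case: n => [|n]; first by rewrite /conv big_ord1 q0 u0 mul0r subrr.
rewrite /conv big_ord_recl q0 mul0r add0r subr0 uS.
by apply: eq_bigr => k _; rewrite lift0 subSS.
Qed.

(** The age of the renewal process at time [n] is [k] with probability
    [r k * u (n - k)]. *)
Let conv_ru n : conv r u n = 1.
Proof.
elim: n => [|n IH]; first by rewrite /conv big_ord1 r0 u0 mulr1.
rewrite -[RHS]IH /conv big_ord_recl r0 mul1r subn0 uS -big_split /=.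
apply: eq_bigr => k _; rewrite /bump /= add1n subSS rS; ring.
Qed.

Let conv_ruu n : conv r (conv u u) n = U n.
Proof.
by rewrite convA convC /conv; apply: eq_bigr => k _; rewrite -/(conv r u _) conv_ru mulr1.
Qed.

(** The derivation [n * x n] applied to [u = 1 + q * u] gives
    [u' = q' * u + q * u'], and convolving with [u], the inverse of [1 - q],
    isolates [u' = q' * u * u]. *)
Let nu_conv n : n%:R * u n = conv v (conv u u) n.
Proof.
pose w k := k%:R * u k.
have wE k : w k = conv v u k + conv q w k.
  rewrite -conv_deriv conv_qu mulrBr; case: k => [|k]; rewrite /w ?mul0r ?subr0//.
  by rewrite mulr0 subr0.
have quw : conv u (conv q w) n = conv u w n - w n.
  rewrite convA; transitivity (conv (fun k => u k - (k == 0%N)%:R) w n).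
    by apply: eq_conv => // k; rewrite convC conv_qu.
  rewrite convDl; congr (_ + _); rewrite /conv big_ord_recl /= big1.
    by rewrite subn0 addr0 mulN1r.
  by move=> k _; rewrite oppr0 mul0r.
have : conv u w n = conv u (conv v u) n + conv u (conv q w) n.
  rewrite [RHS]addrC (convC _ (conv v u)) (convC _ (conv q w)) -convDl convC.
  by apply: eq_conv => // k; rewrite wE addrC.
rewrite quw; have -> : conv u (conv v u) n = conv v (conv u u) n.
  rewrite convA [RHS]convA; apply: eq_conv => // k; exact: convC.
by move=> h; have : w n = conv v (conv u u) n by lra.
Qed.

Let GE n : G n = y n * cbin R n.
Proof. by rewrite /y divfK// gt_eqF// cbin_gt0. Qed.

Let G_ge0 n : 0 <= G n.
Proof. by rewrite !mulr_ge0. Qed.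

Let y_gt0 : \forall n \near \oo, 0 < y n.
Proof. by have [] := q_usv. Qed.

(* [q] written as a slowly varying multiple of the increments of [cbin], so that
   it can be summed by telescoping. *)
Let qE n : q n.+1 =
  y n.+1 * (cbin R n - cbin R n.+1) * (1 - (2 * n.+1%:R)^-1).
Proof.
have N0 : n%:R + 1 != 0 :> R by rewrite natr1 pnatr_eq0.
rewrite /y /G; have := cbinS R n; have := cbin_gt0 R n.+1.
rewrite -natr1; have : 0 <= n%:R :> R by [].
move: (cbin R n) (cbin R n.+1) (q n.+1) (n%:R : R) N0 => a b c N N1 N0 b0 e.
have -> : a = (N + 1) * b / (N + 2^-1) by rewrite e; field; lra.
by field; rewrite N1 (gt_eqF b0)/=; lra.
Qed.

Let cbin_double n : (4 <= n)%N -> cbin R n.*2 <= 3 / 4 * cbin R n.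
Proof.
move=> n4; apply: le_of_sqr_le.
  by rewrite mulr_ge0 ?divr_ge0// ltW ?cbin_gt0.
have := cbin_sq_le R n.*2; have := cbin_sq_ge R n.
rewrite -mul2n natrM; have : (4%:R : R) <= n%:R by rewrite ler_nat.
have : 0 < pi^-1 :> R by rewrite invr_gt0 pi_gt0.
move: (cbin R (2 * n)) (cbin R n) (n%:R : R) pi^-1 => b a N p p0 N4 h1 h2.
have -> : (3 / 4 * a) ^+ 2 = 9 / 16 * a ^+ 2 by field.
have a0 : 0 <= a ^+ 2 by exact: sqr_ge0.
have b0 : 0 <= b ^+ 2 by exact: sqr_ge0.
by move: (a ^+ 2) (b ^+ 2) a0 b0 h1 h2 => A B; nra.
Qed.

(** Karamata's theorem for the tail of [q]: its increments over dyadic blocks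
    are those of [G], and both tend to 0. *)
Let r_asymp : asymp_equiv \oo r G.
Proof.
apply/asymp_equivP.
  by near=> n; rewrite GE mulr_gt0 ?cbin_gt0//; near: n.
move=> e e0; pose h := Num.min (1 / 30) (e / 26).
have h0 : 0 < h by rewrite lt_min divr_gt0//= divr_gt0.
have [h1 h2] : h <= 1 / 30 /\ 26 * h <= e.
  by split; rewrite /h ?ge_min ?lexx// mulrC -ler_pdivlMr// ge_min lexx orbT.
pose D n := r n - G n.
have [N HN] : exists N, forall n, (N <= n)%N -> [/\ (4 <= n)%N, 0 < G n,
    G n.*2 <= 4 / 5 * G n & `|D n - D n.*2| <= 3 * h * G n].
  suff : \forall n \near \oo, [/\ (4 <= n)%N, 0 < G n,
    G n.*2 <= 4 / 5 * G n & `|D n - D n.*2| <= 3 * h * G n].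
    by move=> [N _ HN]; exists N.
  near=> n.
  have n4 : (4 <= n)%N by near: n; exact: nbhs_infty_ge.
  have yn : 0 < y n by near: n.
  have ysv k : (n <= k <= n.*2)%N -> `|y k - y n| <= h * y n.
    by move: k; near: n; exact: (proj2 q_usv).
  have nh : n%:R^-1 <= h.
    rewrite -(invrK h) lef_pV2 ?posrE ?invr_gt0//.
      by near: n; exact: nbhs_infty_ger.
    by rewrite ltr0n; nat_lia.
  have cn := cbin_gt0 R n; have c2n := cbin_gt0 R n.*2.
  have c2 := cbin_double n4.
  have y2n : `|y n.*2 - y n| <= h * y n by apply: ysv; nat_lia.
  have Gn : 0 < G n by rewrite GE mulr_gt0.
  split => //.
    rewrite !GE; move: y2n; rewrite ler_norml => /andP[_ b].
    have y2 : y n.*2 <= 16 / 15 * y n by move: b h1 yn; nra.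
    apply: le_trans (ler_wpM2r (ltW c2n) y2) _.
    by have := ler_wpM2l (ltW yn) c2; lra.
  have cle i : cbin R i.+1 <= cbin R i.
    have := cbinS R i; have := cbin_gt0 R i; have := cbin_gt0 R i.+1.
    rewrite -natr1; have : 0 <= i%:R :> R by [].
    by nra.
  have -> : D n - D n.*2 =
     \sum_(n <= i < n.*2) (q i.+1 - y n * (cbin R i - cbin R i.+1)) +
       (y n.*2 - y n) * cbin R n.*2.
    rewrite sumrB -mulr_sumr.
    have -> : \sum_(n <= i < n.*2) q i.+1 = r n - r n.*2.
      rewrite -[RHS]opprB -telescope_sumr; last by nat_lia.
      by rewrite -sumrN; apply: eq_bigr => i _; rewrite rS; ring.
    have -> : \sum_(n <= i < n.*2) (cbin R i - cbin R i.+1) =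
        cbin R n - cbin R n.*2.
      rewrite -[RHS]opprB -telescope_sumr; last by nat_lia.
      by rewrite -sumrN; apply: eq_bigr => i _; ring.
    by rewrite /D !GE; ring.
  have S : `|\sum_(n <= i < n.*2) (q i.+1 - y n * (cbin R i - cbin R i.+1))|
     <= 3 * h * y n * (cbin R n - cbin R n.*2).
    apply: le_trans (ler_norm_sum _ _ _) _.
    have -> : cbin R n - cbin R n.*2 =
        \sum_(n <= i < n.*2) (cbin R i - cbin R i.+1).
      rewrite -[LHS]opprB -telescope_sumr; last by nat_lia.
      by rewrite -sumrN; apply: eq_bigr => i _; ring.
    rewrite mulr_sumr !big_nat; apply: ler_sum => i /andP[ni i2n].
    have yi : `|y i.+1 - y n| <= h * y n by apply: ysv; nat_lia.
    have ih : (0 : R) <= (2 * i.+1%:R)^-1 <= h.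
      rewrite invr_ge0 mulr_ge0//=; apply: le_trans nh.
      rewrite lef_pV2 ?posrE ?mulr_gt0 ?ltr0n//; last by nat_lia.
      by rewrite -natrM ler_nat; nat_lia.
    rewrite qE.
    have := cle i; move: (y i.+1) yi ((2 * i.+1%:R)^-1) ih.
    rewrite -subr_ge0; move: (cbin R i - _) (y n) yn => d Y Y0 y'.
    rewrite ler_norml => /andP[a1 a2] t /andP[t0 th] d0.
    have -> : y' * d * (1 - t) - Y * d = (y' * (1 - t) - Y) * d by ring.
    rewrite normrM (ger0_norm d0) ler_wpM2r// ler_norml.
    have : y' * t <= 2 * Y * h.
      have y'Y : y' <= 2 * Y by move: a2 h1 Y0; nra.
      by move: y'Y t0 th Y0; nra.
    have : 0 <= y' * t by rewrite mulr_ge0//; move: a1 h1 Y0; nra.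
    by move=> p1 p2; apply/andP; split; lra.
  apply: le_trans (ler_normD _ _) _; rewrite normrM (gtr0_norm c2n) GE.
  have := ler_wpM2r (ltW c2n) y2n.
  have : 0 <= h * (y n * cbin R n.*2).
    by apply/ltW/mulr_gt0 => //; exact: mulr_gt0.
  by move: (`|\sum_(n <= i < n.*2) _|) S => t S; lra.
have Gr n : (N <= n)%N -> `|D n| <= 11 * r n.
  move=> /HN[n4 Gn G2n]; rewrite ler_norml => /andP[+ _].
  rewrite {1 2}/D => le; have := r_ge0 n; have := r_ge0 n.*2 => r2 r1.
  have : 3 * h * G n <= 1 / 10 * G n by rewrite ler_wpM2r ?(ltW Gn)//; lra.
  by move=> le2; rewrite /D ler_norml; apply/andP; split; lra.
have claim J n : (N <= n)%N -> `|D n| <= `|D (2 ^ J * n)%N| + 15 * h * G n.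
  elim: J n => [|J IH] n Nn.
    by rewrite mul1n lerDl !mulr_ge0// ltW.
  have [n4 Gn G2n d2] := HN n Nn.
  have := IH n.*2; rewrite -mul2n mulnA -expnSr mul2n => /(_ _)H.
  have N2n : (N <= n.*2)%N by rewrite (leq_trans Nn)// -addnn leq_addr.
  have {H} := H N2n => i1.
  have i2 : 15 * h * G n.*2 <= 12 * (h * G n).
    by have := ler_wpM2l (ltW h0) G2n; lra.
  have i3 : `|D n| <= `|D n - D n.*2| + `|D n.*2|.
    by rewrite -{1}(subrK (D n.*2) (D n)) ler_normD.
  by move: i1 i2 i3 d2; lra.
exists N => // n Nn /=; have [n4 Gn _ _] := HN n Nn.
have hG : 0 < h * G n by rewrite mulr_gt0.
have /cvgrPdist_le/(_ _ hG) [M _ rM] := r_cvg.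
have := claim M n Nn.
have Mn : (M <= 2 ^ M * n)%N by have := ltn_expl M (isT : 1 < 2)%N; move: n4; nia.
have Nn' : (N <= 2 ^ M * n)%N.
  by rewrite (leq_trans Nn)// leq_pmull// expn_gt0.
have := Gr _ Nn'; have := rM _ Mn; rewrite /= sub0r normrN => /ler_normlW rle i1 i2.
have i3 := ler_wpM2r (ltW Gn) h2.
by rewrite -/(D n); move: rle i1 i2 i3; lra.
Unshelve. all: by end_near. Qed.

Let r_gt0 n : 0 < r n.
Proof.
have : asymp_equiv \oo r G := r_asymp.
move=> /asymp_gt0 /(_ _ _)[].
- by near=> m; exact: r_ge0.
- by near=> m; exact: G_ge0.
- move=> N _ /(_ (maxn n N) (leq_maxr _ _))[rn _].
  by apply: lt_le_trans rn _; apply: r_le; exact: leq_maxl.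
Unshelve. all: by end_near. Qed.

Let v_ge0 n : 0 <= v n.
Proof. by rewrite mulr_ge0. Qed.

Let v_le : exists2 C, 0 < C & forall k, v k <= C * r k.
Proof.
have half0 : 0 < 1 / 2 :> R by lra.
have [N _ HN] : \forall n \near \oo, `|r n - G n| <= 1 / 2 * G n.
  apply: (proj1 (asymp_equivP _ _) r_asymp) => //.
  by near=> n; rewrite GE mulr_gt0 ?cbin_gt0//; near: n.
pose B := \sum_(0 <= k < N) v k / r k.
have B0 k : 0 <= v k / r k by rewrite divr_ge0.
have Bge0 : 0 <= B by apply: sumr_ge0.
exists (1 + B) => [|k]; first by rewrite ltr_pwDl.
have [kN|Nk] := ltnP k N.
  rewrite -ler_pdivrMr//; apply: (@le_trans _ _ B); last by rewrite lerDr.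
  by rewrite /B (bigD1_seq k) ?iota_uniq ?mem_index_iota//= lerDl sumr_ge0.
have := HN _ Nk; rewrite ler_norml => /andP[+ _].
have -> : G k = 2 * v k by rewrite /G /v; ring.
by have := mulr_ge0 Bge0 (r_ge0 k); lra.
Unshelve. all: by end_near. Qed.

Let U_ge1 n : 1 <= U n.
Proof. by rewrite /U big_ord_recl u0 lerDl sumr_ge0. Qed.

Let U_gt0 n : 0 < U n.
Proof. exact: lt_le_trans (U_ge1 n). Qed.

Let US n : U n.+1 = U n + u n.+1.
Proof. by rewrite /U big_ord_recr. Qed.

Let U_le m n : (m <= n)%N -> U m <= U n.
Proof.
by move/subnKC <-; elim: (n - m)%N => [|k IH];
  rewrite ?addn0// addnS US (le_trans IH)// lerDl.
Qed.

Let uu_ge0 n : 0 <= conv u u n.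
Proof. by apply: sumr_ge0 => k _; rewrite mulr_ge0. Qed.

Let nu_le : exists2 C, 0 < C & forall n, n%:R * u n <= C * U n.
Proof.
have [C C0 HC] := v_le; exists C => // n; rewrite nu_conv -conv_ruu mulr_sumr.
by apply: ler_sum => k _; rewrite mulrA ler_wpM2r.
Qed.

(* One of the two factors of each term has index at least half of [m]. *)
Let uu_le : exists2 C, 0 < C & forall n, n%:R * conv u u n <= C * U n ^+ 2.
Proof.
have [C C0 HC] := nu_le; exists (4 * C) => [|m]; first by rewrite mulr_gt0.
have le1 k : (k <= m)%N -> (m <= k.*2)%N -> m%:R * u k <= 2 * C * U m.
  move=> km mk; apply: (@le_trans _ _ (2 * (k%:R * u k))).
    by rewrite mulrA ler_wpM2r// -natrM ler_nat mul2n.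
  by rewrite -mulrA ler_wpM2l// (le_trans (HC k))// ler_wpM2l ?(ltW C0)// U_le.
rewrite /conv mulr_sumr.
apply: (@le_trans _ _ (\sum_(k < m.+1) 2 * C * U m * (u k + u (m - k)%N))).
  apply: ler_sum => k _; have km : (k <= m)%N by rewrite -ltnS.
  have c0 : 0 <= 2 * C * U m by rewrite !mulr_ge0// ltW.
  have [mk|mk] := leqP m k.*2.
    have := ler_wpM2r (u_ge0 (m - k)%N) (le1 _ km mk).
    by have := mulr_ge0 c0 (u_ge0 k); lra.
  have := ler_wpM2r (u_ge0 k) (le1 (m - k)%N (leq_subr _ _) _).
  rewrite (_ : (m <= (m - k).*2)%N); last by nat_lia.
  by move=> /(_ isT); have := mulr_ge0 c0 (u_ge0 (m - k)%N); lra.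
rewrite -mulr_sumr big_split /=.
have -> : \sum_(i < m.+1) u (m - i)%N = U m.
  by rewrite [RHS](reindex_inj rev_ord_inj); apply: eq_bigr => k _; rewrite /= subSS.
by rewrite le_eqVlt; apply/orP; left; apply/eqP; rewrite /U; ring.
Qed.

Let Ur_le1 n : U n * r n <= 1.
Proof.
rewrite -(conv_ru n) convC /U mulr_suml; apply: ler_sum => k _.
by rewrite ler_wpM2l// r_le// leq_subr.
Qed.

(** [U * r <= 1] bounds [U] by the inverse of the tail, and [n * r n] tends to
    infinity. *)
Let U_o_n e : 0 < e -> \forall n \near \oo, U n <= e * n%:R.
Proof.
move=> e0.
have Gbig : forall A, \forall n \near \oo, A <= n%:R * G n.
  apply: near_unbounded.
    near=> n; have yn : 0 < y n by near: n.
    have n0 : (0 < n)%N by near: n; exact: nbhs_infty_gt.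
    by apply: mulr_gt0; rewrite ?ltr0n// GE mulr_gt0// cbin_gt0.
  have e20 : 0 < 1 / 20 :> R by lra.
  have ysv := near_half (usv_dyadic 2 q_usv e20).
  have ypos := near_half y_gt0.
  near=> n; have n20 : (20 <= n)%N by near: n; exact: nbhs_infty_ge.
  have yn : `|y n - y n./2| <= 1 / 20 * y n./2.
    have : forall k, (n./2 <= k <= 2 ^ 2 * n./2)%N ->
      `|y k - y n./2| <= 1 / 20 * y n./2 by near: n; exact: ysv.
    by apply; rewrite -[(2 ^ 2)%N]/4%N; nat_lia.
  have yh : 0 < y n./2 by near: n; exact: ypos.
  rewrite !GE.
  have := cbin_sq_ge R n; have := cbin_sq_le R n./2.
  have c1 := cbin_gt0 R n; have c2 := cbin_gt0 R n./2.
  have h10 : 10 <= (n./2)%:R :> R by rewrite ler_nat; nat_lia.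
  have hn : n%:R <= 2 * (n./2)%:R + 1 :> R.
    by rewrite -natrM natr1 ler_nat; nat_lia.
  have hn2 : 2 * (n./2)%:R <= n%:R :> R by rewrite -natrM ler_nat; nat_lia.
  have : 0 < pi^-1 :> R by rewrite invr_gt0 pi_gt0.
  move: yn; rewrite ler_norml => /andP[y1 _].
  move: (y n) (y n./2) yh y1 (cbin R n) (cbin R n./2) c1 c2 (n%:R) ((n./2)%:R)
    pi^-1 h10 hn hn2 => a b b0 ab c d c0 d0 x z p z10 xz zx p0 i1 i2.
  have cd : 68 / 100 * d <= c.
    apply: le_of_sqr_le; first exact: ltW.
    rewrite exprMn.
    have s1 : 0 <= c ^+ 2 by exact: sqr_ge0.
    have s2 : 0 <= d ^+ 2 by exact: sqr_ge0.
    move: (c ^+ 2) (d ^+ 2) s1 s2 i1 i2 => C D C0 D0 i1 i2.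
    have : (x + 2^-1) * C <= (2 * z + 3 / 2) * C by rewrite ler_wpM2r//; lra.
    by nra.
  have ac : 19 / 20 * b * (68 / 100 * d) <= a * c.
    by apply: ler_pM => //; lra.
  have bd : 0 < b * d by rewrite mulr_gt0.
  have ac0 : 0 <= a * c by lra.
  have := ler_wpM2r ac0 zx.
  have : 0 <= z * (a * c - 19 / 20 * b * (68 / 100 * d)).
    by rewrite mulr_ge0//; lra.
  have : 0 <= z * (b * d) by rewrite mulr_ge0 ?(ltW bd)//; lra.
  by lra.
have half0 : 0 < 1 / 2 :> R by lra.
have rG : \forall n \near \oo, `|r n - G n| <= 1 / 2 * G n.
  apply: (proj1 (asymp_equivP _ _) r_asymp) => //.
  by near=> n; rewrite GE mulr_gt0 ?cbin_gt0//; near: n.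
near=> n.
have : 2 / e <= n%:R * G n by near: n; exact: Gbig.
have : `|r n - G n| <= 1 / 2 * G n by near: n.
rewrite ler_norml => /andP[+ _] => i1; rewrite ler_pdivrMr// => i2.
have i3 := Ur_le1 n; have n0 : 0 <= n%:R :> R by [].
have i4 : 1 <= e * n%:R * r n.
  have : 0 <= e * n%:R * (r n - G n / 2) by rewrite !mulr_ge0 ?(ltW e0)//; lra.
  by lra.
by rewrite -(ler_pM2r (r_gt0 n)); exact: le_trans i4.
Unshelve. all: by end_near. Qed.

(** By [nu_conv] and [conv_ruu] the two sides are the convolutions of [u * u] with
    [n * q n] and with half the tail [r], and these two weights are equivalent.
    The finitely many indices where they are not yet close contribute
    [O(U n ^ 2 / n)], negligible by [U_o_n]. *)
Let nu_asymp : asymp_equiv \oo (fun n => n%:R * u n) (fun n => U n / 2).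
Proof.
apply/asymp_equivP; first by near=> n; rewrite divr_gt0.
move=> e e0.
have [C C0 HC] := v_le; have [C2 C20 HC2] := uu_le.
pose e1 := Num.min (1 / 2) (e / 4).
have e10 : 0 < e1 by rewrite lt_min divr_gt0//= divr_gt0.
have [e11 e12] : e1 <= 1 / 2 /\ 4 * e1 <= e.
  by split; rewrite /e1 ?ge_min ?lexx// mulrC -ler_pdivlMr// ge_min lexx orbT.
have [K _ HK] : \forall n \near \oo, `|r n - G n| <= e1 * G n.
  apply: (proj1 (asymp_equivP _ _) r_asymp) => //.
  by near=> n; rewrite GE mulr_gt0 ?cbin_gt0//; near: n.
have K1 k : (K <= k)%N -> `|v k - r k / 2| <= e1 * r k.
  move=> /HK; have -> : G k = 2 * v k by rewrite /G /v; ring.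
  have := v_ge0 k; rewrite !ler_norml => v0 /andP[a1 a2].
  have vr : v k <= r k by nra.
  by have := ler_wpM2l (ltW e10) vr; move=> h; apply/andP; split; lra.
have K2 k : `|v k - r k / 2| <= C + 1.
  apply: le_trans (ler_normB _ _) _.
  rewrite !ger0_norm ?divr_ge0//; have := r_le (leq0n k); rewrite r0 => rk1.
  have : C * r k <= C by rewrite ler_piMr// ltW.
  by have := HC k; have := r_ge0 k; lra.
pose B := 8 * (K.+1%:R * ((C + 1) * C2)).
have B0 : 0 < B by rewrite !mulr_gt0 ?ltr0n//; lra.
have UoN := U_o_n (divr_gt0 e0 B0).
near=> n.
have nK : (K.*2.+2 <= n)%N by near: n; exact: nbhs_infty_ge.
have UN : U n <= e / B * n%:R by near: n.
have n0 : 0 < n%:R :> R by rewrite ltr0n; nat_lia.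
have uuE : U n = \sum_(0 <= k < n.+1) r k * conv u u (n - k)%N.
  by rewrite -conv_ruu big_mkord.
have uvE : n%:R * u n = \sum_(0 <= k < n.+1) v k * conv u u (n - k)%N.
  by rewrite nu_conv big_mkord.
have -> : n%:R * u n - U n / 2 =
    \sum_(0 <= k < n.+1) (v k - r k / 2) * conv u u (n - k)%N.
  rewrite uvE uuE mulr_suml -sumrB.
  by apply: eq_bigr => k _; move: (conv u u _) => X; ring.
apply: le_trans (ler_norm_sum _ _ _) _.
rewrite (big_cat_nat (n := K))//=; last by nat_lia.
have S2 : \sum_(K <= k < n.+1) `|(v k - r k / 2) * conv u u (n - k)%N| <= e1 * U n.
  rewrite uuE mulr_sumr.
  rewrite [leRHS](big_cat_nat (n := K))//=; last by nat_lia.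
  apply: (@le_trans _ _ (\sum_(K <= k < n.+1) e1 * (r k * conv u u (n - k)%N))).
    rewrite !big_nat; apply: ler_sum => k /andP[Kk _].
    by rewrite normrM (ger0_norm (uu_ge0 _)) mulrA ler_wpM2r// K1.
  rewrite lerDr; apply: sumr_ge0 => k _.
  by rewrite !mulr_ge0// ltW.
have S1 : \sum_(0 <= k < K) `|(v k - r k / 2) * conv u u (n - k)%N| <= e / 4 * U n.
  apply: (@le_trans _ _ (\sum_(0 <= k < K) (C + 1) * (2 * C2 * U n ^+ 2 / n%:R))).
    rewrite !big_nat; apply: ler_sum => k /andP[_ kK].
    rewrite normrM (ger0_norm (uu_ge0 _)) ler_pM// ler_pdivlMr//.
    have := HC2 (n - k)%N.
    have Um : U (n - k)%N ^+ 2 <= U n ^+ 2.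
      by rewrite lerXn2r ?nnegrE ?(ltW (U_gt0 _))// U_le// leq_subr.
    have := ler_wpM2l (ltW C20) Um.
    have nk : n%:R <= 2 * (n - k)%:R :> R by rewrite -natrM ler_nat; nat_lia.
    have := ler_wpM2r (uu_ge0 (n - k)%N) nk.
    by lra.
  rewrite sumr_const_nat subn0 -[leLHS]mulr_natr.
  have KK : (K%:R : R) <= K.+1%:R by rewrite ler_nat.
  have UN' : U n * B <= e * n%:R.
    by rewrite -ler_pdivlMr// mulrAC.
  have -> : (C + 1) * (2 * C2 * U n ^+ 2 / n%:R) * K%:R =
     (U n * (8 * (K%:R * ((C + 1) * C2)))) * U n / n%:R / 4.
    by field; rewrite gt_eqF.
  have : U n * (8 * (K%:R * ((C + 1) * C2))) <= e * n%:R.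
    apply: le_trans UN'; rewrite ler_wpM2l ?(ltW (U_gt0 n))//.
    rewrite /B ler_wpM2l// ler_wpM2r// mulr_ge0 ?(ltW C20)//; lra.
  move=> h; have := ler_wpM2r (ltW (U_gt0 n)) h => {}h.
  rewrite ler_pdivrMr// ler_pdivrMr//; apply: le_trans h _.
  by rewrite le_eqVlt; apply/orP; left; apply/eqP; field.
apply: le_trans (lerD S1 S2) _; clear S1 S2 uuE uvE.
have := ler_wpM2r (ltW (U_gt0 n)) e12.
by move=> h; have := U_gt0 n; lra.
Unshelve. all: by end_near. Qed.

Let u_gt0 : \forall n \near \oo, 0 < u n.
Proof.
have /asymp_gt0 : asymp_equiv \oo (fun n => n%:R * u n) (fun n => U n / 2).
  exact: nu_asymp.
move=> /(_ _ _)[].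
- by near=> n; rewrite mulr_ge0.
- by near=> n; rewrite divr_ge0// ltW.
- move=> N _ HN; near=> n.
  have [+ _] : 0 < n%:R * u n /\ 0 < U n / 2 by apply: HN; near: n; exists N.
  by rewrite pmulr_rgt0 ?ltr0n//; near: n; exact: nbhs_infty_gt.
Unshelve. all: by end_near. Qed.

(** By [nu_asymp] the relative increments of [U] are [1 / (2 n)] up to
    [o(1 / n)], and those of [cbin] are the opposite. *)
Let Ucbin_usv : usv (fun n => U n * cbin R n).
Proof.
apply: usv_small_steps.
  by near=> n; rewrite mulr_gt0 ?cbin_gt0.
move=> e e0; pose h := Num.min (1 / 2) (e / 2).
have h0 : 0 < h by rewrite lt_min divr_gt0//= divr_gt0.
have [h1 h2] : h <= 1 / 2 /\ 2 * h <= e.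
  by split; rewrite /h ?ge_min ?lexx// mulrC -ler_pdivlMr// ge_min lexx orbT.
have [N _ HN] : \forall n \near \oo, `|n%:R * u n - U n / 2| <= h * (U n / 2).
  apply: (proj1 (asymp_equivP _ _) nu_asymp) => //.
  by near=> n; rewrite divr_gt0.
near=> n.
have n1 : 1 <= n%:R :> R by rewrite ler1n; near: n; exact: nbhs_infty_gt.
have : `|n.+1%:R * u n.+1 - U n.+1 / 2| <= h * (U n.+1 / 2).
  by apply: HN => /=; apply: ltnW; near: n; exists N.
have := cbinS R n; have := cbin_gt0 R n; have := cbin_gt0 R n.+1.
have := US n; have := U_gt0 n; have := U_gt0 n.+1.
rewrite -natr1; move: (U n.+1) (U n) (u n.+1) (cbin R n.+1) (cbin R n)
  (n%:R : R) n1 => U' V u' c' c x x1 U'0 V0 UE c'0 c0 cE.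
rewrite ler_norml => /andP[a1 a2].
have dE : (U' * c' - V * c) * (x + 2^-1) = c' * ((x + 1) * u' - U' / 2).
  have -> : V = U' - u' by lra.
  have -> : c = (x + 1) * c' / (x + 2^-1) by rewrite cE; field; lra.
  by field; lra.
have Uc : 0 < U' * c' by rewrite mulr_gt0.
have Vc : 0 < V * c by rewrite mulr_gt0.
have d1 : `|U' * c' - V * c| * (x + 2^-1) <= h / 2 * (U' * c').
  rewrite -[x + _ in leLHS]gtr0_norm; last by lra.
  rewrite -normrM dE normrM (gtr0_norm c'0).
  have : `|(x + 1) * u' - U' / 2| <= h * (U' / 2).
    by rewrite ler_norml a1 a2.
  by move=> h'; have := ler_wpM2l (ltW c'0) h'; lra.
move: (U' * c') (V * c) Uc Vc d1 => A B A0 B0 d1.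
have d0 : 0 <= `|A - B| by [].
have d2 : `|A - B| <= A / 2 by nra.
have A2 : A <= 2 * B by move: d2; rewrite ler_norml => /andP[]; lra.
have d3 : `|A - B| * x <= h / 2 * A by nra.
by nra.
Unshelve. all: by end_near. Qed.

Lemma renewal_usv : usv (fun n => u n / cbin R n).
Proof.
apply: (@usv_asymp _ _ (fun n => pi / 2 * (U n * cbin R n))).
- by near=> n; rewrite divr_gt0 ?cbin_gt0//; near: n.
- have : asymp_equiv \oo (fun n => n%:R * u n * (n%:R * cbin R n ^+ 2)^-1)
     (fun n => U n / 2 * (pi^-1)^-1).
    apply: asymp_mul; first exact: nu_asymp.
    apply: asymp_inv; rewrite /asymp_equiv -[X in _ --> X](mulfV (_ : pi^-1 != 0)).
      by apply: cvgMl; exact: cvg_cbin_sq.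
    by rewrite invr_eq0 gt_eqF// pi_gt0.
  apply: near_eq_cvg_to; near=> n.
  have n0 : n%:R != 0 :> R.
    by rewrite pnatr_eq0 -lt0n; near: n; exact: nbhs_infty_gt.
  have c0 : cbin R n != 0 by rewrite gt_eqF// cbin_gt0.
  have p0 : pi != 0 :> R by rewrite gt_eqF// pi_gt0.
  have U0 : U n != 0 by rewrite gt_eqF.
  rewrite !invrK; move: (n%:R) (cbin R n) (U n) (pi : R) n0 c0 U0 p0.
  by move=> a b c d *; field; repeat (apply/andP; split).
- apply: usvM; last exact: Ucbin_usv.
  by apply: usv_cst; rewrite divr_gt0// pi_gt0.
Unshelve. all: by end_near. Qed.

(** The two slowly varying factors multiply to 1 because the convolution of
    [u] with the tail [r] is identically 1. *)
Theorem renewal_asymp :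
  asymp_equiv \oo u (fun n => cbin R n ^+ 2 / (2 * n%:R * q n)).
Proof.
have yG0 : \forall n \near \oo, 0 < G n.
  by near=> n; rewrite GE mulr_gt0 ?cbin_gt0//; near: n.
have rc : asymp_equiv \oo (fun n => r n / cbin R n) y.
  apply: (asymp_mul r_asymp); apply: asymp_refl.
  by near=> n; rewrite invr_gt0 cbin_gt0.
have r_usv : usv (fun n => r n / cbin R n).
  apply: usv_asymp rc q_usv; near=> n; by rewrite divr_gt0 ?cbin_gt0.
have rc0 k : 0 <= r k / cbin R k by rewrite divr_ge0// ltW// cbin_gt0.
have uc0 k : 0 <= u k / cbin R k by rewrite divr_ge0// ltW// cbin_gt0.
have := conv_usv renewal_usv r_usv uc0 rc0.
have -> : (fun n => \sum_(k < n.+1) u k / cbin R k * cbin R k *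
   (r (n - k)%N / cbin R (n - k) * cbin R (n - k))) = fun=> 1 :> R.
  apply/funext => n; rewrite -(conv_ru n) convC; apply: eq_bigr => k _.
  by rewrite !divfK ?gt_eqF ?cbin_gt0.
move=> one; have := asymp_inv r_asymp.
move/asymp_sym => Gr; have := asymp_mul one Gr.
move/asymp_sym; apply: near_eq_cvg_to; near=> n.
have c0 : cbin R n != 0 by rewrite gt_eqF// cbin_gt0.
have r00 : r n != 0 by rewrite gt_eqF.
have g0 : G n != 0 by rewrite gt_eqF//; near: n.
rewrite /G in g0 *; rewrite mul1r; move: (2 * _ * _) g0 => g g0.
by field; rewrite c0 r00 g0.
Unshelve. all: by end_near. Qed.

(** A sequence of order [n ^ (- 1/2)] convolved with [u]: the slowly varying
    factors multiply, and that of [u] is known from [renewal_asymp]. *)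
Theorem renewal_conv_asymp (p : nat -> R) : (forall n, 0 <= p n) ->
  usv (fun n => p n / cbin R n) ->
  asymp_equiv \oo (conv u p) (fun n => p n / (2 * n%:R * q n)).
Proof.
move=> p0 p_usv.
have pc0 k : 0 <= p k / cbin R k by rewrite divr_ge0// ltW// cbin_gt0.
have uc0 k : 0 <= u k / cbin R k by rewrite divr_ge0// ltW// cbin_gt0.
have := conv_usv renewal_usv p_usv uc0 pc0.
have -> : (fun n => \sum_(k < n.+1) u k / cbin R k * cbin R k *
   (p (n - k)%N / cbin R (n - k) * cbin R (n - k))) = conv u p.
  apply/funext => n; apply: eq_bigr => k _.
  by rewrite !divfK ?gt_eqF ?cbin_gt0.
move=> up.
have pp : \forall n \near \oo, 0 < p n.
  near=> n; have : 0 < p n / cbin R n by near: n; exact: (proj1 p_usv).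
  by rewrite pmulr_lgt0// invr_gt0 cbin_gt0.
have yG0 : \forall n \near \oo, 0 < G n.
  by near=> n; rewrite GE mulr_gt0 ?cbin_gt0//; near: n.
have pcc : asymp_equiv \oo (fun n => p n / cbin R n ^+ 2) (fun n => p n / cbin R n ^+ 2).
  by apply: asymp_refl; near=> n; rewrite divr_gt0 ?exprn_gt0 ?cbin_gt0//; near: n.
apply: asymp_trans up _.
  near=> n; rewrite mulr_gt0 ?divr_gt0 ?cbin_gt0//; near: n.
    exact: u_gt0.
  exact: pp.
have := asymp_mul renewal_asymp pcc; rewrite /asymp_equiv.
apply: near_eq_cvg_to; near=> n.
have c0 : cbin R n != 0 by rewrite gt_eqF// cbin_gt0.
have u1 : u n != 0 by rewrite gt_eqF//; near: n.
have p1 : p n != 0 by rewrite gt_eqF//; near: n.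
have g0 : G n != 0 by rewrite gt_eqF//; near: n.
rewrite /G in g0 *; move: (2 * _ * _) g0 => g g0.
by field; rewrite ?c0 ?u1 ?g0 ?p1.
Unshelve. all: by end_near. Qed.

End renewal.

(** * Uniform slow variation from monotonicity *)

Section near_pinfty.
Variable R : realType.

Lemma near_pinfty_ge (P : R -> Prop) : (\forall x \near +oo, P x) ->
  exists M, forall x, M <= x -> P x.
Proof.
move=> [M [_ MP]]; exists (M + 1) => x Mx; apply: MP.
by rewrite (lt_le_trans _ Mx)// ltrDl.
Qed.

Lemma near_natr (P : R -> Prop) : (\forall x \near +oo, P x) ->
  \forall n \near \oo, P n%:R.
Proof.
move=> /near_pinfty_ge[M MP]; near=> n; apply: MP.
by near: n; exact: nbhs_infty_ger.
Unshelve. all: by end_near. Qed.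

Lemma near_all_lt (K : nat) (P : nat -> nat -> Prop) :
  (forall j, (j < K)%N -> \forall n \near \oo, P j n) ->
  \forall n \near \oo, forall j, (j < K)%N -> P j n.
Proof.
elim: K => [|K IH] H; first by near=> n.
have {}IH := IH (fun j jK => H j (ltnW jK)); have HK := H K (ltnSn _).
near=> n => j; rewrite ltnS leq_eqVlt => /predU1P[->|]; first by near: n.
by move: j; near: n.
Unshelve. all: by end_near. Qed.

Lemma slowly_varying_le (l : R -> R) c e : slowly_varying l ->
  (\forall x \near +oo, 0 < l x) -> 0 < c -> 0 < e ->
  \forall x \near +oo, `|l (c * x) - l x| <= e * l x.
Proof.
move=> sv l0 c0 e0; have /cvgrPdist_le/(_ e e0) H := sv c c0.
near=> x; have lx : 0 < l x by near: x.
have : `|1 - l (c * x) / l x| <= e by near: x.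
rewrite -(ler_pM2r lx) -[X in _ * X <= _](gtr0_norm lx) -normrM mulrBl mul1r.
by rewrite divfK ?gt_eqF// distrC.
Unshelve. all: by end_near. Qed.

(** A nonnegative slowly varying function is eventually positive, since a
    ratio with value 0 does not tend to 1. *)
Lemma slowly_varying_gt0 (l : R -> R) : slowly_varying l ->
  (\forall x \near +oo, 0 <= l x) -> \forall x \near +oo, 0 < l x.
Proof.
move=> sv l0; have /cvgrPdist_lt/(_ 1 ltr01) H := sv 1 ltr01.
near=> x; have lx : 0 <= l x by near: x.
rewrite lt_def lx andbT; apply/eqP => l00.
have : `|1 - l (1 * x) / l x| < 1 by near: x.
by rewrite l00 invr0 mulr0 subr0 normr1 ltxx.
Unshelve. all: by end_near. Qed.

End near_pinfty.

Section slowly_varying_uniform.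
Variable R : realType.

(** For a monotone function slow variation is uniform for free: the values at
    [k] between [n] and [n.*2] are caught between those at the points of a
    finite grid of multiples of [n]. *)
Lemma usv_of_monotone (p : nat -> R) :
  (forall m n, (m <= n)%N -> p n <= p m) -> (forall n, 0 <= p n) ->
  slowly_varying_seq (fun n => Num.sqrt n%:R * p n) ->
  usv (fun n => Num.sqrt n%:R * p n).
Proof.
move=> pmono p0 sv; pose f n := Num.sqrt n%:R * p n.
have fpos : \forall n \near \oo, 0 < f n.
  have : \forall x \near +oo, 0 < f (Num.truncn (x : R)).
    apply: slowly_varying_gt0 => //.
    by near=> x; rewrite mulr_ge0 ?sqrtr_ge0.
  by move/near_natr; apply: filterS => n; rewrite natrK.
split => // e e0.
pose h := Num.min 1 (e / 6).
have h0 : 0 < h by rewrite lt_min ltr01 divr_gt0.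
have [h1 h2] : h <= 1 /\ 6 * h <= e.
  by split; rewrite /h ?ge_min ?lexx// mulrC -ler_pdivlMr// ge_min lexx orbT.
have [M M0 Mh] : exists2 M, (0 < M)%N & M%:R^-1 <= h :> R.
  exists (Num.truncn h^-1).+1 => //; rewrite -(invrK h) lef_pV2 ?posrE ?invr_gt0//.
  by rewrite invrK ltW// truncnS_gt.
have M0' : 0 < M%:R :> R by rewrite ltr0n.
pose c j : R := 1 + j%:R / M%:R.
have c1 j : 1 <= c j by rewrite lerDl divr_ge0.
pose a j n := Num.truncn (c j * n%:R).
have sva : \forall n \near \oo, forall j, (j < M.+2)%N -> `|f (a j n) - f n| <= h * f n.
  apply: near_all_lt => j _.
  have c0 : 0 < c j by exact: lt_le_trans (c1 j).
  have fpos' : \forall x \near +oo, 0 < f (Num.truncn (x : R)).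
    apply: slowly_varying_gt0 => //.
    by near=> x; rewrite mulr_ge0 ?sqrtr_ge0.
  have /near_natr := slowly_varying_le sv fpos' c0 h0.
  by apply: filterS => n; rewrite natrK.
near=> n => k /andP[nk kn].
have nM : (M <= n)%N by near: n; exact: nbhs_infty_ge.
have fn : 0 < f n by near: n.
have Hj j : (j < M.+2)%N -> `|f (a j n) - f n| <= h * f n.
  by move: j; near: n.
have n0 : (0 < n)%N by nat_lia.
have N0 : 0 < n%:R :> R by rewrite ltr0n.
pose j := ((k - n) * M %/ n)%N.
have j1 : (j * n <= (k - n) * M)%N by exact: leq_trunc_div.
have j2 : ((k - n) * M < j.+1 * n)%N by exact: ltn_ceil.
have jM : (j <= M)%N.
  rewrite -(leq_pmul2r n0) (leq_trans j1)// mulnC leq_mul2l; apply/orP; right.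
  by nat_lia.
clearbody j.
have kR : k%:R = n%:R + (k - n)%:R :> R by rewrite -natrD subnKC.
have r1 : j%:R * n%:R <= (k - n)%:R * M%:R :> R by rewrite -!natrM ler_nat.
have r2 : (k - n)%:R * M%:R <= (j%:R + 1) * n%:R :> R.
  by rewrite natr1 -!natrM ler_nat ltnW.
have K0 : 0 < k%:R :> R by rewrite ltr0n (leq_trans n0).
have NK : n%:R <= k%:R :> R by rewrite ler_nat.
have nM' : M%:R <= n%:R :> R by rewrite ler_nat.
have cjk : c j * n%:R <= k%:R.
  rewrite /c kR mulrDl mul1r lerD2l mulrAC ler_pdivrMr//.
have kcj : k%:R <= c j.+1 * n%:R.
  by rewrite /c kR mulrDl mul1r lerD2l mulrAC ler_pdivlMr// -natr1.
have cc : c j.+1 * n%:R = c j * n%:R + n%:R / M%:R.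
  by rewrite /c -natr1; field; rewrite gt_eqF.
have ca0 i : 0 <= c i * n%:R by rewrite mulr_ge0// (le_trans _ (c1 i)).
have [a1 a2] : (a j n <= k)%N /\ (n <= a j n)%N.
  split; last first.
    by rewrite truncn_ge_nat// ler_peMl.
  by rewrite -(ler_nat R) (le_trans _ cjk)// truncn_le.
have b1 : (k <= a j.+1 n)%N by rewrite truncn_ge_nat.
have a3 : k%:R <= (1 + 2 * h) * (a j n)%:R.
  have : c j * n%:R < (a j n)%:R + 1 by rewrite natr1 truncnS_gt.
  have nMh : n%:R / M%:R <= h * n%:R by rewrite mulrC ler_wpM2r.
  have : 1 <= h * n%:R.
    by apply: le_trans nMh; rewrite ler_pdivlMr// mul1r.
  have : h * n%:R <= h * (a j n)%:R by rewrite ler_wpM2l ?ler_nat// ltW.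
  by move: nMh; lra.
have b2 : (a j.+1 n)%:R <= (1 + h) * k%:R.
  have : (a j.+1 n)%:R <= c j.+1 * n%:R by rewrite truncn_le.
  have : n%:R / M%:R <= h * n%:R by rewrite mulrC ler_wpM2r.
  have : h * n%:R <= h * k%:R by rewrite ler_wpM2l// ltW.
  by lra.
have sqrt_le (x y : R) d : 0 <= d -> 0 <= y -> x <= (1 + d) * y ->
    Num.sqrt x <= (1 + d) * Num.sqrt y.
  move=> d0 y0 xy; apply: (@le_trans _ _ (Num.sqrt ((1 + d) ^+ 2 * y))).
    rewrite ler_sqrt; last by rewrite mulr_ge0 ?sqr_ge0.
    by apply: le_trans xy _; rewrite ler_wpM2r//; nra.
  by rewrite sqrtrM ?sqr_ge0// sqrtr_sqr ger0_norm//; lra.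
have up : f k <= (1 + 2 * h) * f (a j n).
  rewrite /f mulrA ler_pM ?sqrtr_ge0//; last exact: pmono.
  by apply: sqrt_le => //; rewrite mulr_ge0// ltW.
have lo : f (a j.+1 n) <= (1 + h) * f k.
  rewrite /f mulrA ler_pM ?sqrtr_ge0//; last exact: pmono.
  by apply: sqrt_le => //; rewrite ltW.
have := Hj _ (leqW (jM : (j < M.+1)%N)); have := Hj j.+1 (jM : (j.+1 < M.+2)%N).
rewrite -!/(f _); move: (f k) (f (a j n)) (f (a j.+1 n)) (f n) fn up lo => x A B F F0 up lo.
rewrite !ler_norml => /andP[p1 p2] /andP[p3 p4].
have hF : 0 < h * F by rewrite mulr_gt0.
have hhF : h * (h * F) <= h * F by rewrite ler_piMl// ltW.
have eF : 6 * (h * F) <= e * F by rewrite mulrA ler_wpM2r// ltW.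
have hA : h * A <= 2 * (h * F) by have := ler_wpM2l (ltW h0) p4; lra.
have x2 : x <= F + 5 * (h * F) by lra.
have hx : h * x <= 6 * (h * F).
  by have := ler_wpM2l (ltW h0) x2; lra.
have hx2 : h * x <= h * (F + 5 * (h * F)) by rewrite ler_wpM2l// ltW.
have x3 : F <= x + 2 * (h * F) \/ x < F by case: (leP F x) => ?; [left; lra|right].
apply/andP; split; last by lra.
have hxF : x <= F -> h * x <= h * F by move=> ?; rewrite ler_wpM2l// ltW.
by case: (leP F x) => [?|/ltW /hxF]; lra.
Unshelve. all: by end_near. Qed.

Section asymptotic_inverse.
Variables L W : R -> R.
Hypotheses (W_le : forall s t, s <= t -> W s <= W t) (W_ge0 : forall s, 0 <= W s)
  (W_sv : slowly_varying W) (L_sv : slowly_varying L).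
Let t x := Num.sqrt x / L x.
Hypothesis L_def : asymp_equiv +oo%R L (fun x => (Num.sqrt (W (t x)))^-1).

Let L_gt0 : \forall x \near +oo, 0 < L x.
Proof.
have /cvgrPdist_lt/(_ 1 ltr01) H := L_def; near=> x.
have : `|1 - L x / (Num.sqrt (W (t x)))^-1| < 1 by near: x.
rewrite invrK => /ltr_normlP[_] h; have {h} : 0 < L x * Num.sqrt (W (t x)) by lra.
have := sqrtr_ge0 (W (t x)); move: (Num.sqrt _) => s s0 h.
by rewrite ltNge; apply/negP => l0; nra.
Unshelve. all: by end_near. Qed.

Let L2W h : 0 < h -> \forall x \near +oo, `|L x ^+ 2 * W (t x) - 1| <= h.
Proof.
move=> h0; have : (L x / (Num.sqrt (W (t x)))^-1) * (L x / (Num.sqrt (W (t x)))^-1)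
  @[x --> +oo] --> (1 * 1 : R) by exact: cvgM.
rewrite mulr1 => /cvgrPdist_le/(_ h h0); apply: filterS => x.
by rewrite distrC invrK mulrACA -!expr2 sqr_sqrtr.
Qed.

Let W_gt0 : \forall s \near +oo, 0 < W s.
Proof. by apply: slowly_varying_gt0 => //; near=> s. Unshelve. all: by end_near. Qed.

(** If [t x < S] for a large [x], then [L x] is so large that the same holds
    at [2 * x], at [4 * x] and so on, and [L] grows like a square root along
    these points, which slow variation forbids. *)
Let t_unbounded S : \forall x \near +oo, S <= t x.
Proof.
have [S1 SS1 WS1] : exists2 S1, S <= S1 & 0 < W S1.
  have [M MP] := near_pinfty_ge W_gt0.
  by exists (Num.max S M); [rewrite le_max lexx|apply: MP; rewrite le_max lexx orbT].
suff : \forall x \near +oo, S1 <= t x by apply: filterS => x; exact: le_trans.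
pose S2 := Num.max 1 S1.
have [S20 S12] : 0 < S2 /\ S1 <= S2.
  by rewrite /S2 lt_max ltr01 le_max lexx orbT.
have WS2 : 0 < W S2 by apply: lt_le_trans WS1 _; exact: W_le.
suff : \forall x \near +oo, S2 <= t x by apply: filterS => x; exact: le_trans.
have h10 : 0 < 1 / 10 :> R by lra.
have H : \forall x \near +oo, [/\ 0 < L x, `|L x ^+ 2 * W (t x) - 1| <= 1 &
    `|L (2 * x) - L x| <= 1 / 10 * L x].
  have l1 := L_gt0; have l2 := L2W ltr01.
  have l3 := slowly_varying_le L_sv L_gt0 (ltr0n _ 2 : 0 < 2) h10.
  by near=> x; split; near: x.
have [M HM] := near_pinfty_ge H.
pose X0 := Num.max 1 (Num.max M (9 * S2 ^+ 2 / W S2)).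
exists X0; split; first by rewrite num_real.
have step x : X0 < x -> t x < S2 -> t (2 * x) < S2.
  rewrite !gt_max => /and3P[x1 Mx Sx] tx; rewrite ltNge; apply/negP => t2x.
  have [Lx _ L2x] := HM x (ltW Mx).
  have [L2 A2 _] : [/\ 0 < L (2 * x), `|L (2 * x) ^+ 2 * W (t (2 * x)) - 1| <= 1 &
    `|L (2 * (2 * x)) - L (2 * x)| <= 1 / 10 * L (2 * x)] by apply: HM; lra.
  move: tx; rewrite /t ltr_pdivrMr// => tx.
  have : x < (S2 * L x) ^+ 2.
    rewrite -[ltLHS]sqr_sqrtr; last by lra.
    by rewrite ltrXn2r// ?nnegrE ?sqrtr_ge0// mulr_ge0// ltW.
  have : L (2 * x) ^+ 2 * W S2 <= 2.
    apply: (@le_trans _ _ (L (2 * x) ^+ 2 * W (t (2 * x)))).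
      by rewrite ler_wpM2l ?sqr_ge0// W_le.
    by move: A2; rewrite ler_norml => /andP[_]; lra.
  move: L2x; rewrite ler_norml => /andP[L2x _].
  have : 9 / 10 * L x <= L (2 * x) by lra.
  move: Sx; rewrite ltr_pdivrMr// exprMn.
  move: (L x) (L (2 * x)) (W S2) Lx L2 WS2 => a b w a0 b0 w0 p1 p2 p3 p4.
  have q1 : (9 / 10 * a) ^+ 2 <= b ^+ 2.
    by rewrite lerXn2r// ?nnegrE; lra.
  rewrite exprMn in q1.
  have q2 : a ^+ 2 * w <= 250 / 100 by have := ler_wpM2r (ltW w0) q1; lra.
  have s2 : 0 < S2 ^+ 2 by rewrite exprn_gt0.
  have := ltr_pM2r w0 x (S2 ^+ 2 * a ^+ 2); rewrite p4 => q3.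
  have := ler_wpM2l (ltW s2) q2; lra.
move=> x X0x; rewrite /= leNgt; apply/negP => tx.
have iter J : X0 < 2 ^+ J * x /\ t (2 ^+ J * x) < S2.
  elim: J => [|J [IH1 IH2]]; first by rewrite expr0 mul1r.
  rewrite exprS -mulrA; split; last exact: step.
  have : 0 < 2 ^+ J * x by rewrite (lt_trans _ IH1)// lt_max ltr01.
  lra.
have Lx J : L (2 ^+ J * x) ^+ 2 * (1 + J%:R / 2) <= 2 ^+ J * L x ^+ 2.
  elim: J => [|J IH]; first by rewrite !expr0 !mul1r mul0r addr0 mulr1.
  have [+ _] := iter J; rewrite !gt_max => /and3P[_ MJ _].
  have [LJ _ ] := HM _ (ltW MJ); rewrite ler_norml => /andP[l1 l2].
  rewrite (exprS 2 J) -(mulrA 2 (2 ^+ J) x) -[J.+1%:R]natr1.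
  have b0 : 0 <= L (2 * (2 ^+ J * x)) by lra.
  have : L (2 * (2 ^+ J * x)) ^+ 2 <= (11 / 10 * L (2 ^+ J * x)) ^+ 2.
    by rewrite lerXn2r// ?nnegrE; lra.
  rewrite exprMn; have := sqr_ge0 (L (2 ^+ J * x)).
  move: (L (2 * (2 ^+ J * x)) ^+ 2) (L (2 ^+ J * x) ^+ 2) IH => a b IH b1 ab.
  have J0 : 0 <= J%:R :> R by [].
  move: (2 ^+ J) IH => c IH; apply: (@le_trans _ _ (2 * (b * (1 + J%:R / 2)))).
    have J1 : 0 <= 1 + (J%:R + 1) / 2 :> R by lra.
    have := ler_wpM2r J1 ab; have := mulr_ge0 b1 J0; lra.
  by rewrite -mulrA ler_wpM2l.
have [J HJ] : exists J : nat, L x ^+ 2 * S2 ^+ 2 / x < 1 + J%:R / 2.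
  exists (2 * (Num.truncn (L x ^+ 2 * S2 ^+ 2 / x)).+1)%N.
  rewrite natrM; have := truncnS_gt (L x ^+ 2 * S2 ^+ 2 / x); lra.
have [X1 +] := iter J; move: (X1); rewrite !gt_max => /and3P[x1 MJ _].
have [LJ _ _] := HM _ (ltW MJ).
have x0 : 0 < x by move: X0x; rewrite !gt_max => /and3P[]; lra.
rewrite /t ltr_pdivrMr// => tJ.
have : 2 ^+ J * x < (S2 * L (2 ^+ J * x)) ^+ 2.
  rewrite -[ltLHS]sqr_sqrtr; last by lra.
  by rewrite ltrXn2r// ?nnegrE ?sqrtr_ge0// mulr_ge0// ltW.
rewrite exprMn => k1; have k2 := Lx J.
have J0 : 0 < 1 + J%:R / 2 :> R by rewrite ltr_pwDl// divr_ge0.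
have k3 := ltr_pM2r J0 (2 ^+ J * x) (S2 ^+ 2 * L (2 ^+ J * x) ^+ 2).
rewrite k1 in k3.
have k4 := ler_wpM2l (ltW (exprn_gt0 2 S20)) k2.
have P0 : 0 < 2 ^+ J :> R by rewrite exprn_gt0.
have k5 : 2 ^+ J * (x * (1 + J%:R / 2)) < 2 ^+ J * (S2 ^+ 2 * L x ^+ 2).
  by lra.
move: k5; rewrite ltr_pM2l// => k5.
by move: HJ; rewrite ltr_pdivrMr//; lra.
Unshelve. all: by end_near. Qed.

(** Slow variation along powers of 2 keeps [W] from growing faster than
    linearly. *)
Let W_potter : exists S, forall s' s, S <= s' -> s' <= s ->
  W s * s' <= 2 * s * W s'.
Proof.
have h4 : 0 < 1 / 4 :> R by lra.
have [M HM] := near_pinfty_ge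
  (slowly_varying_le W_sv W_gt0 (ltr0n _ 2 : 0 < 2) h4).
have {}HM s : M <= s -> W (2 * s) <= 2 * W s.
  by move/HM; rewrite ler_norml => /andP[_]; have := W_ge0 s; lra.
exists (Num.max M 1) => s' s; rewrite ge_max => /andP[Ms' s'1] ss'.
have [m] : exists m : nat, s <= 2 ^+ m * s'.
  exists (Num.truncn (s / s')).+1; rewrite -ler_pdivrMr; last by lra.
  apply: ltW; apply: lt_le_trans (truncnS_gt _) _.
  by rewrite -natrX ler_nat ltnW// ltn_expl.
elim: m s ss' => [|m IH] s ss' sm.
  have -> : s = s' by apply/eqP; rewrite eq_le ss' andbT -[leRHS]mul1r.
  have : 0 <= W s' * s' by rewrite mulr_ge0//; lra.
  by lra.
have [s2|s2] := leP s (2 * s').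
  have : W s <= 2 * W s' by apply: le_trans (HM s' Ms'); exact: W_le.
  move=> h; have s'0 : 0 <= s' by lra.
  have := ler_wpM2r s'0 h; have := W_ge0 s' => w0.
  have := ler_wpM2l w0 ss'; lra.
have := IH (s / 2); move=> /(_ _ _)H.
have {}H : W (s / 2) * s' <= 2 * (s / 2) * W s'.
  by apply: H; [lra|move: sm; rewrite exprS -mulrA; lra].
have : W s <= 2 * W (s / 2).
  have := HM (s / 2); have -> : 2 * (s / 2) = s by field.
  by apply; lra.
move=> h; have s'0 : 0 <= s' by lra.
by have := ler_wpM2r s'0 h; lra.
Qed.

(** By [W_potter] the bounds relating [s], [s'] and [c] force [c] to be at most 8:
    then [s <= 16 * s'] and slow variation at the ratio 16 applies. *)
Let W_comparable h : 0 < h -> exists S, forall s' s c, S <= s' -> 1 <= c ->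
  s <= 2 * c * s' -> c ^+ 2 * W s' <= 2 * W s -> W s <= (1 + h) * W s'.
Proof.
move=> h0; have [S HS] := W_potter.
have [M HM] := near_pinfty_ge
  (slowly_varying_le W_sv W_gt0 (ltr0n _ 16 : 0 < 16) h0).
have [M' HM'] := near_pinfty_ge W_gt0.
exists (Num.max 1 (Num.max S (Num.max M M'))) => s' s c.
rewrite !ge_max => /and4P[s'1 Ss' Ms' M's'] c1 sc cW.
have Ws' := HM' _ M's'.
have [ss'|ss'] := leP s s'.
  by apply: le_trans (W_le ss') _; have := mulr_ge0 (ltW h0) (ltW Ws'); lra.
have := HS _ _ Ss' (ltW ss') => p1.
have p2 : W s * s' <= (4 * c * W s') * s'.
  by apply: le_trans p1 _; have := ler_wpM2r (ltW Ws') sc; lra.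
have s'0 : 0 < s' by lra.
rewrite ler_pM2r// in p2.
have c8 : c <= 8.
  have : c * (c * W s') <= 8 * (c * W s') by lra.
  by rewrite ler_pM2r// mulr_gt0//; lra.
have : W s <= W (16 * s').
  by apply: W_le; apply: le_trans sc _; rewrite ler_pM2r//; lra.
move=> /le_trans; apply.
by have := HM _ Ms'; rewrite ler_norml => /andP[_]; lra.
Qed.

(** [t] is an asymptotic inverse of [s ^ 2 / W s]; the monotonicity of [W]
    makes slow variation of [L] uniform without any regularity of [L]. *)
Lemma usv_asymptotic_inverse : usv (fun n => L n%:R).
Proof.
split; first exact: near_natr L_gt0.
suff H e : 0 < e -> exists M, forall x y, M <= x -> x <= y <= 2 * x ->
    `|L y - L x| <= e * L x.
  move=> e e0; have [M HM] := H e e0; near=> n => k /andP[nk kn].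
  apply: HM; first by near: n; exact: nbhs_infty_ger.
  by rewrite -natrM !ler_nat mul2n nk.
move=> e0; pose h := Num.min (1 / 8) (e / 16).
have h0 : 0 < h by rewrite lt_min divr_gt0//= divr_gt0.
have [h1 h2] : h <= 1 / 8 /\ 16 * h <= e.
  by split; rewrite /h ?ge_min ?lexx// mulrC -ler_pdivlMr// ge_min lexx orbT.
have [S HS] := W_comparable h0.
have [M' HW] := near_pinfty_ge W_gt0.
have : \forall x \near +oo, [/\ 0 < L x, `|L x ^+ 2 * W (t x) - 1| <= h &
    Num.max S M' <= t x].
  have l1 := L_gt0; have l2 := L2W h0; have l3 := t_unbounded (Num.max S M').
  by near=> x; split; near: x.
move=> /near_pinfty_ge[M HM]; exists (Num.max 1 M) => x y.
rewrite ge_max => /andP[x1 Mx] /andP[xy y2x].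
have [Lx Ax] := HM x Mx; rewrite ge_max => /andP[Sx M'x].
have [Ly Ay] := HM y (le_trans Mx xy); rewrite ge_max => /andP[Sy M'y].
have Wx := HW _ M'x; have Wy := HW _ M'y.
(* With [c] the ratio of [L a] to [L b], the equivalent of [L] turns a large [c]
   into a large ratio of [W], against [W_comparable]. *)
have key a b : 0 < L a -> 0 < L b -> 0 < W (t a) -> 0 < W (t b) ->
    S <= t a -> 0 < a -> 0 < b -> b <= 4 * a ->
    `|L a ^+ 2 * W (t a) - 1| <= h -> `|L b ^+ 2 * W (t b) - 1| <= h ->
    L a <= (1 + 8 * h) * L b.
  move=> La Lb Wa Wb Sa a0 b0 ba Aa Ab.
  have [ab|/ltW ab] := leP (L a) (L b).
    by apply: le_trans ab _; have := mulr_gt0 h0 Lb; lra.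
  pose c := L a / L b.
  have Lac : L a = c * L b by rewrite /c divfK// gt_eqF.
  have c1 : 1 <= c by rewrite /c ler_pdivlMr// mul1r.
  have tb : t b <= 2 * c * t a.
    rewrite /t Lac.
    have -> : 2 * c * (Num.sqrt a / (c * L b)) = 2 * Num.sqrt a / L b.
      by field; rewrite (gt_eqF Lb)/=; lra.
    rewrite ler_pM2r ?invr_gt0//; apply: le_of_sqr_le.
      by rewrite mulr_ge0 ?sqrtr_ge0.
    by rewrite exprMn !sqr_sqrtr ?(ltW a0) ?(ltW b0)//; lra.
  move: Aa Ab; rewrite !ler_norml Lac => /andP[a1 a2] /andP[b1 b2].
  have cWab : c ^+ 2 * W (t a) * (1 - h) <= W (t b) * (1 + h).
    have : (c ^+ 2 * W (t a)) * (L b ^+ 2 * W (t b)) <= (1 + h) * W (t b).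
      rewrite exprMn in a2.
      have -> : c ^+ 2 * W (t a) * (L b ^+ 2 * W (t b)) =
        (c ^+ 2 * L b ^+ 2 * W (t a)) * W (t b) by ring.
      by rewrite ler_pM2r//; lra.
    have : (c ^+ 2 * W (t a)) * (1 - h) <=
        (c ^+ 2 * W (t a)) * (L b ^+ 2 * W (t b)).
      by apply: ler_wpM2l; [rewrite mulr_ge0 ?sqr_ge0 ?ltW|lra].
    by lra.
  have c20 : 0 <= c ^+ 2 * W (t a) by rewrite mulr_ge0 ?sqr_ge0 ?ltW.
  have p1 : W (t b) <= (1 + h) * W (t a).
    apply: HS Sa c1 tb _.
    by have := ler_wpM2r c20 h1; have := ler_wpM2r (ltW Wb) h1; lra.
  have p2 : c ^+ 2 * (1 - h) * W (t a) <= (1 + h) ^+ 2 * W (t a).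
    have h1' : 0 <= 1 + h by lra.
    by have := ler_wpM2l h1' p1; lra.
  rewrite ler_pM2r// in p2; rewrite ler_pM2r//.
  rewrite leNgt; apply/negP => ch.
  have q1 : (1 + 8 * h) ^+ 2 <= c ^+ 2 by rewrite lerXn2r// ?nnegrE; lra.
  have q2 : (1 + 8 * h) ^+ 2 * (1 - h) <= (1 + h) ^+ 2.
    by apply: le_trans p2; rewrite ler_wpM2r//; lra.
  have q3 := mulr_gt0 h0 h0; have q4 := ler_wpM2r (ltW q3) h1.
  by lra.
have k1 : L y <= (1 + 8 * h) * L x by apply: key => //; lra.
have k2 : L x <= (1 + 8 * h) * L y by apply: key => //; lra.
have k3 := ler_wpM2r (ltW Lx) h2; have hL := mulr_gt0 h0 Lx.
have k4 := ler_wpM2l (ltW h0) k1.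
have k5 : h * (h * L x) <= 1 / 8 * (h * L x) by rewrite ler_wpM2r// ltW.
by rewrite ler_norml; apply/andP; split; lra.
Unshelve. all: by end_near. Qed.

End asymptotic_inverse.
End slowly_varying_uniform.

(** * Integration with respect to the reference measures *)

Section integration.
Variable R : realType.
Local Open Scope ereal_scope.
Import HBNNSimple.

(** The integral of a nonnegative function is a supremum over simple functions,
    which may be replaced by 0 outside of [S]: hence no measurability of [f] and
    [g].  It is used for functions of the potential, which is arbitrary
    off the integers in the discrete set-up. *)
Lemma integral_conull d (T : measurableType d) (nu : {measure set T -> \bar R})
    (S D : set T) (f g : T -> \bar R) :
  measurable S -> measurable D -> nu (~` S) = 0 ->
  (forall x, D x -> 0 <= f x) -> (forall x, D x -> 0 <= g x) ->
  (forall x, D x -> S x -> f x = g x) ->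
  \int[nu]_(x in D) f x = \int[nu]_(x in D) g x.
Proof.
move=> mS mD nuS.
wlog suff: f g / (forall x, D x -> 0 <= f x) -> (forall x, D x -> 0 <= g x) ->
    (forall x, D x -> S x -> f x = g x) ->
    \int[nu]_(x in D) f x <= \int[nu]_(x in D) g x.
  move=> le f0 g0 fg; apply/eqP; rewrite eq_le le//=; apply: le => // x Dx Sx.
  by rewrite fg.
move=> f0 g0 fg; rewrite !ge0_integralE//.
apply: ge_ereal_sup => _ [h /= hf <-].
pose h' : {nnsfun T >-> R} := proj_nnsfun h mS.
have -> : sintegral nu h = sintegral nu h'.
  have sE (k : {nnsfun T >-> R}) : sintegral nu k = \int[nu]_x (k x)%:E.
    by rewrite integral_nnsfun// patch_setT.
  rewrite !sE; apply: ge0_ae_eq_integral => //.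
  - exact/measurable_EFinP.
  - exact/measurable_EFinP.
  - by move=> x _; rewrite lee_fin.
  - by move=> x _; rewrite lee_fin.
  exists (~` S); split => //; first exact: measurableC.
  move=> x /=; apply: contra_not => Sx _.
  by rewrite mindicE (mem_set Sx) mulr1.
apply: ereal_sup_ubound; exists h' => // x.
have [xS|xS] := boolP (x \in S); rewrite /h' /= mindicE.
  rewrite xS mulr1 (le_trans (hf x))// /patch; case: ifPn => // xD.
  by rewrite fg// -inE.
rewrite (negbTE xS) mulr0; apply: erestrict_ge0 => //.
Qed.

Lemma ge0_integral_density d (T : measurableType d)
    (nu mu : {measure set T -> \bar R}) (f : T -> R) (g : T -> \bar R) :
  measurable_fun setT f -> (forall x, (0 <= f x)%R) ->
  (forall A, measurable A -> nu A = \int[mu]_(x in A) (f x)%:E) ->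
  measurable_fun setT g -> (forall x, 0 <= g x) ->
  \int[nu]_x g x = \int[mu]_x (g x * (f x)%:E).
Proof.
move=> mf f0 nuE mg g0; pose h := nnsfun_approx measurableT mg.
have cvgh x : (h n x)%:E @[n --> \oo] --> g x by exact: cvg_nnsfun_approx.
have ndh x : {homo (fun n => (h n x)%:E) : m n / (m <= n)%N >-> m <= n}.
  by move=> m n mn; rewrite lee_fin; exact/lefP/nd_nnsfun_approx.
transitivity (limn (fun n => \int[nu]_x (h n x)%:E)).
  rewrite -monotone_convergence//.
  - by apply: eq_integral => x _; apply/esym/cvg_lim => //; exact: cvgh.
  - by move=> n; exact/measurable_EFinP.
  - by move=> n x _; rewrite lee_fin.
transitivity (limn (fun n => \int[mu]_x ((h n x)%:E * (f x)%:E))); last first.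
  rewrite -monotone_convergence//.
  - apply: eq_integral => x _; apply/cvg_lim => //.
    by apply: cvgeZr => //; exact: cvgh.
  - by move=> n; apply: emeasurable_funM; exact/measurable_EFinP.
  - by move=> n x _; rewrite mule_ge0// lee_fin.
  - by move=> x _ m n mn; rewrite lee_wpmul2r ?lee_fin//; exact: ndh.
congr (limn _); apply/funext => n; move: (h n) => {cvgh ndh} {}h.
have mi r : measurable_fun setT (fun x => (r * \1_(h @^-1` [set r]) x)%:E).
  by apply: (measurable_comp measurableT) => //; exact: measurable_funM.
transitivity (\int[nu]_x (\sum_(y \in range h) (y * \1_(h @^-1` [set y]) x)%:E)).
  by apply: eq_integral => t tE; rewrite /= fimfunE -fsumEFin.
rewrite ge0_integral_fsum//; last by move=> m x _; exact: nnfun_muleindic_ge0.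
transitivity (\int[mu]_x (\sum_(y \in range h)
    (y * \1_(h @^-1` [set y]) x)%:E * (f x)%:E)); last first.
  apply: eq_integral => x _; rewrite [in RHS]fimfunE -fsumEFin//.
  by rewrite ge0_mule_fsuml// => y; exact: nnfun_muleindic_ge0.
rewrite ge0_integral_fsum//; last 2 first.
  - by move=> y; apply: emeasurable_funM => //; exact/measurable_EFinP.
  - by move=> m x _; apply: mule_ge0; rewrite ?lee_fin// -lee_fin EFinM nnfun_muleindic_ge0.
apply: eq_fsbigr => r rh.
under [LHS]eq_integral do rewrite EFinM.
rewrite integralZl_indic_nnsfun//.
under [RHS]eq_integral do rewrite EFinM -muleA.
rewrite ge0_integralZl//.
- rewrite integral_indic// setIT nuE//; congr (_ * _).
  rewrite integral_mkcond; apply: eq_integral => x _.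
  by rewrite epatch_indic muleC.
- by apply: emeasurable_funM; exact/measurable_EFinP.
- by move=> x _; rewrite mule_ge0 ?lee_fin.
- by move: rh; rewrite inE => -[t _ <-]; rewrite lee_fin.
Qed.

End integration.

Section reference_measure.
Variable R : realType.
Local Open Scope ereal_scope.

(** A subgroup of the line that carries [mu]. *)
Definition lattice (s : setup) : set R :=
  match s with ContinuousCase => setT | DiscreteCase => range intr end.

Lemma measurable_lattice s : measurable (lattice s : set (measurableTypeR R)).
Proof. by case: s => //=; exact: measurable_ints. Qed.

Lemma mu_lattice s : mu R s (~` lattice s) = 0.
Proof.
case: s => /=; first by rewrite setCT.
by rewrite /counting_ints /mrestr setICl measure0.
Qed.

Lemma lattice0 s : lattice s 0%R.
Proof. by case: s => //=; exists 0%R. Qed.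

Lemma latticeB s x y : lattice s x -> lattice s y -> lattice s (x - y)%R.
Proof.
case: s => //= -[m _ <-] [n _ <-]; exists (m - n)%R => //.
by rewrite rmorphB.
Qed.

Lemma latticeD s x y : lattice s x -> lattice s y -> lattice s (x + y)%R.
Proof.
case: s => //= -[m _ <-] [n _ <-]; exists (m + n)%R => //.
by rewrite rmorphD.
Qed.

Lemma mu_sigma_finite s : sigma_finite setT (mu R s).
Proof.
case: s => /=; first exact: sigma_finiteT.
pose F (n : nat) : set R := [set x | (`|x| <= n%:R)%R].
exists F => [|n].
  apply/esym/seteqP; split => // x _; exists (Num.truncn `|x|).+1 => //.
  by rewrite /F /= ltW// truncnS_gt.
have mB : measurable ([set x | (`|x| <= n%:R)%R] : set (measurableTypeR R)).
  rewrite (_ : mkset _ = `[(- n%:R)%R, n%:R%R]%classic); first exact: measurable_itv.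
  by apply/seteqP; split => x /=; rewrite in_itv/= ler_norml.
split => //.
rewrite [mrestr _ _ _]/(counting (F n `&` range intr)) /F.
rewrite /counting asboolT ?ltry//.
apply: (@sub_finite_set _ _ ((fun k : nat => k%:R - n%:R : R)%R @` `I_(n + n).+1)).
  move=> _ [/=] /[swap] -[m _ <-]; rewrite -intr_norm -[n%:R%R]/((n%:Z)%:~R)%R.
  rewrite ler_int => mn; exists (absz (m + n%:Z)%R) => /=; first by lia.
  have absE (z : int) : (0 <= z)%R -> ((absz z)%:R : R)%R = (z%:~R)%R by case: z.
  by rewrite absE ?rmorphD /= ?addrK//; lia.
by apply: finite_image; exact: finite_II.
Qed.

(** [mu], as a set function on which further structure can be declared. *)
Definition rmu s (A : set (measurableTypeR R)) : \bar R := mu R s A.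

HB.instance Definition _ s := isMeasure.Build _ _ _ (rmu s)
  (measure0 (mu R s)) (measure_ge0 (mu R s))
  (@measure_semi_sigma_additive _ _ _ (mu R s)).

HB.instance Definition _ s :=
  @Measure_isSigmaFinite.Build _ _ _ (rmu s) (mu_sigma_finite s).

Lemma mu_translation s (a : R) (A : set (measurableTypeR R)) : lattice s a -> measurable A ->
  mu R s [set x | A (a + x)%R] = mu R s A.
Proof.
case: s => /= [_|[m _ <-]] mA.
  rewrite -[LHS]/(pushforward lebesgue_measure
    ((fun x => a + x)%R : measurableTypeR R -> measurableTypeR R) A).
  have ma : measurable_fun [set: measurableTypeR R]
      ((fun x => a + x)%R : measurableTypeR R -> measurableTypeR R).
    by apply: measurable_funD => //; exact: measurable_cst.
  apply/esym/lebesgue_measure_unique => //= _ [[b c]] _ <-.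
  rewrite /pushforward (_ : _ @^-1` _ = `](b - a)%R, (c - a)%R]%classic).
    rewrite !lebesgue_measure_itv/= !lte_fin ltrD2r.
    by case: ifPn => // _; rewrite -!EFinB; congr EFin; ring.
  by apply/seteqP; split => x /=; rewrite !in_itv/=; lra.
rewrite /counting_ints [LHS]/(counting ([set x | A (m%:~R + x)%R] `&` range intr)).
rewrite -[RHS]/(counting (A `&` range intr)).
set X := _ `&` _; set Z := _ `&` _.
have XZ : Z = (fun x => m%:~R + x)%R @` X.
  apply/seteqP; split => [z [Az [n _ nz]]|z [x [Ax [n _ nx]] xz]].
    exists ((n - m)%:~R)%R; last by rewrite -rmorphD /= addrC subrK.
    split; last by exists (n - m)%R.
    by rewrite /= -rmorphD /= addrC subrK nz.
  rewrite -xz; split => //; exists (m + n)%R => //.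
  by rewrite rmorphD /= nx.
have ZX : X = (fun x => x - m%:~R)%R @` Z.
  rewrite XZ; apply/esym/seteqP; split => [_ [_ [x Xx <-] <-]|x Xx] /=.
    by rewrite addrC addKr.
  by exists (m%:~R + x)%R; [exists x|rewrite addrC addKr].
have [fZ|fZ] := pselect (finite_set Z); last first.
  rewrite /counting !asboolF//; first by move=> /(finite_image (fun x => m%:~R + x)%R); rewrite -XZ.
have fX : finite_set X by rewrite ZX; exact: finite_image.
rewrite /counting !asboolT// XZ fset_set_image// card_imfset//.
Qed.

End reference_measure.

(** * The transfer operator *)

Section transfer.
Variables (R : realType) (s : setup) (V : R -> \bar R).
Hypothesis V_neqNy : forall x, V x != -oo%E.
Hypothesis V_cont : s = ContinuousCase -> continuous (fun x : R => expeR (- V x)%E).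
Local Open Scope ereal_scope.

Local Notation mR := (measurableTypeR R).

(** In the discrete set-up [V] is arbitrary between the integers; cutting the
    Boltzmann weight off there makes it measurable on the line without changing
    any integral. *)
Definition weight (x : R) : R := (fine (expeR (- V x)) * \1_(lattice s) x)%R.

Lemma weight_ge0 x : (0 <= weight x)%R.
Proof. by rewrite mulr_ge0// fine_ge0// expeR_ge0. Qed.

Lemma expeRN_fin x : expeR (- V x) = (fine (expeR (- V x)))%:E.
Proof. by have := V_neqNy x; case: (V x). Qed.

Lemma weightE x : lattice s x -> (weight x)%:E = expeR (- V x).
Proof.
by move=> sx; rewrite /weight indicE mem_set// mulr1 -expeRN_fin.
Qed.

Lemma measurable_weight : measurable_fun [set: mR] (weight : mR -> R).
Proof.
rewrite /weight; move: V_cont; case: s => /= [c|_].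
  have mc : measurable_fun [set: mR] ((fun x => expeR (- V x)) : mR -> \bar R).
    apply: lower_semicontinuous_measurable; apply/lower_semicontinuousP => a.
    rewrite (_ : [set x | _] = (fun x => expeR (- V x)) @^-1` [set y | a%:E < y]).
      apply: open_comp; first by move=> x _; exact: (c erefl).
      exact: open_ereal_gt_ereal.
    by [].
  rewrite (_ : (fun x => _) = fine \o (fun x => expeR (- V x))).
    by apply/measurable_EFinP; rewrite (_ : _ \o _ = (fun x => expeR (- V x)))//;
      apply/funext => x /=; rewrite -expeRN_fin.
  by apply/funext => x /=; rewrite indicT mulr1.
have cZ : countable (range (intr : int -> R)) by apply: sub_countable (card_image_le _ _) _; exact: countableP.
move=> _ B mB; rewrite setTI.
set f := fun x => _.
have -> : f @^-1` B = (f @^-1` B `&` range intr) `|` (f @^-1` B `&` ~` range intr).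
  by rewrite -setIUr setUv setIT.
apply: measurableU.
  by apply: countable_measurable => //; apply: sub_countable cZ; apply: subset_card_le; exact: subIsetr.
have [B0|B0] := pselect (B 0%R).
  rewrite (_ : _ `&` _ = ~` range intr); first by apply: measurableC; exact: measurable_ints.
  apply/seteqP; split => [x []//|x Zx]; split => //=.
  by rewrite /f indicE memNset// mulr0.
rewrite (_ : _ `&` _ = set0)//; apply/seteqP; split => // x [/= + Zx].
by rewrite /f indicE memNset// mulr0.
Qed.

Definition transfer (eps : {nonneg R}) (g : R -> \bar R) (x : R) : \bar R :=
  \int[site_measure s eps]_(y in `[0%R, +oo[) ((weight (y - x))%:E * g y).

(** The operator killed at the wall. *)
Definition ktransfer (g : R -> \bar R) (x : R) : \bar R :=
  \int[rmu s]_(y in `]0%R, +oo[) ((weight (y - x))%:E * g y).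

Lemma measurable_weight2 : measurable_fun [set: mR * mR]
  ((fun z => (weight (z.2 - z.1))%:E) : mR * mR -> \bar R).
Proof.
apply/measurable_EFinP; apply: (measurableT_comp measurable_weight).
by apply: measurable_funB.
Qed.

Lemma measurable_integrand (g : R -> \bar R) x : measurable_fun [set: mR] (g : mR -> \bar R) ->
  measurable_fun [set: mR] ((fun y => (weight (y - x))%:E * g y) : mR -> \bar R).
Proof.
move=> mg; apply: emeasurable_funM => //.
apply/measurable_EFinP; apply: (measurableT_comp measurable_weight).
by apply: measurable_funB => //; exact: measurable_cst.
Qed.

Lemma integrand_ge0 (g : R -> \bar R) x y : (forall z, 0 <= g z) -> 0 <= (weight (y - x))%:E * g y.
Proof. by move=> g0; rewrite mule_ge0// lee_fin weight_ge0. Qed.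

Lemma ktransfer_ge0 g x : (forall z, 0 <= g z) -> 0 <= ktransfer g x.
Proof. by move=> g0; apply: integral_ge0 => y _; exact: integrand_ge0. Qed.

Lemma measurable_ktransfer (g : R -> \bar R) : measurable_fun [set: mR] (g : mR -> \bar R) ->
  (forall z, 0 <= g z) -> measurable_fun [set: mR] (ktransfer g : mR -> \bar R).
Proof.
move=> mg g0.
pose f (z : mR * mR) := (weight (z.2 - z.1))%:E * g z.2 * (\1_(`]0%R, +oo[%classic : set R) z.2)%:E.
have mf : measurable_fun [set: mR * mR] f.
  apply: emeasurable_funM; first apply: emeasurable_funM.
  - exact: measurable_weight2.
  - exact: (measurableT_comp mg).
  - apply/measurable_EFinP; apply: (measurableT_comp _ measurable_snd).
    exact: measurable_indic.
have f0 z : 0 <= f z by rewrite mule_ge0 ?lee_fin//; exact: integrand_ge0.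
have := @measurable_fun_fubini_tonelli_F _ _ mR mR R (rmu s) f mf f0.
congr (measurable_fun _ _); apply/funext => x; rewrite /fubini_F /ktransfer.
by rewrite [RHS]integral_mkcond; apply: eq_integral => y _; rewrite epatch_indic.
Qed.

Lemma transferE eps (g : R -> \bar R) x : measurable_fun [set: mR] (g : mR -> \bar R) ->
  (forall z, 0 <= g z) ->
  transfer eps g x = ktransfer g x + eps%:num%:E * ((weight (0 - x))%:E * g 0%R).
Proof.
move=> mg g0; have mi := measurable_integrand x mg.
rewrite /transfer /site_measure ge0_integral_measure_add//; last 2 first.
- by move=> y _; exact: integrand_ge0.
- exact: measurable_funTS.
congr (_ + _); last first.
  rewrite ge0_integral_mscale//; last 2 first.
  - exact: measurable_funTS.
  - by move=> y _; exact: integrand_ge0.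
  rewrite integral_dirac//; last exact: measurable_funTS.
  by rewrite diracE mem_set ?mul1e//= in_itv/= lexx.
rewrite (_ : `[0%R, +oo[%classic = [set 0%R] `|` `]0%R, +oo[%classic); last first.
  apply/seteqP; split => x0 /=; rewrite !in_itv/= !andbT.
    by rewrite le_eqVlt => /predU1P[<-|]; [left|right].
  by move=> [->|/ltW].
rewrite ge0_integral_setU//.
- rewrite [X in X + _](_ : _ = 0) ?add0e.
    by apply: eq_measure_integral => A mA A0; transitivity (mu R s (A `&` `]0%R, +oo[%classic)) => //; rewrite setIidl.
  rewrite -(integral_measure_zero [set (0%R : mR)] (fun y : mR => (weight (y - x))%:E * g y)).
  apply: eq_measure_integral => A mA A0.
  transitivity (mu R s (A `&` `]0%R, +oo[%classic)) => //.
  rewrite (_ : A `&` _ = set0) ?measure0//; apply/seteqP; split => // y [/A0 -> /=].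
  by rewrite in_itv/= ltxx.
- exact: measurable_funTS mi.
- by move=> y _; exact: integrand_ge0.
- by apply/disj_setPS => y [/= -> ]; rewrite in_itv/= ltxx.
Qed.

Lemma transfer_ge0 eps g x : (forall z, 0 <= g z) -> 0 <= transfer eps g x.
Proof. by move=> g0; apply: integral_ge0 => y _; exact: integrand_ge0. Qed.

Lemma measurable_transfer eps (g : R -> \bar R) : measurable_fun [set: mR] (g : mR -> \bar R) ->
  (forall z, 0 <= g z) -> measurable_fun [set: mR] (transfer eps g : mR -> \bar R).
Proof.
move=> mg g0; rewrite (_ : transfer eps g =
    fun x => ktransfer g x + eps%:num%:E * ((weight (0 - x))%:E * g 0%R)).
  apply: emeasurable_funD; first exact: measurable_ktransfer.
  apply: emeasurable_funM; first exact: measurable_cst.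
  apply: emeasurable_funM; last exact: measurable_cst.
  apply/measurable_EFinP; apply: (measurableT_comp measurable_weight).
  by apply: measurable_funB => //; exact: measurable_cst.
by apply/funext => x; exact: transferE.
Qed.

Definition nnmeas (g : R -> \bar R) :=
  measurable_fun [set: mR] (g : mR -> \bar R) /\ forall z, 0 <= g z.

Lemma nnmeas_transfer eps n g : nnmeas g -> nnmeas (iter n (transfer eps) g).
Proof.
move=> gP; elim: n => //= n [mg g0]; split; first exact: measurable_transfer.
by move=> x; exact: transfer_ge0.
Qed.

Lemma nnmeas_ktransfer n g : nnmeas g -> nnmeas (iter n ktransfer g).
Proof.
move=> gP; elim: n => //= n [mg g0]; split; first exact: measurable_ktransfer.
by move=> x; exact: ktransfer_ge0.
Qed.

Lemma ktransferD f g x : nnmeas f -> nnmeas g ->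
  ktransfer (fun y => f y + g y) x = ktransfer f x + ktransfer g x.
Proof.
move=> [mf f0] [mg g0]; rewrite /ktransfer -ge0_integralD//.
- by apply: eq_integral => y _; rewrite ge0_muleDr.
- by move=> y _; exact: integrand_ge0.
- by apply: measurable_funTS; exact: measurable_integrand.
- by move=> y _; exact: integrand_ge0.
- by apply: measurable_funTS; exact: measurable_integrand.
Qed.

Lemma ktransferZ c g x : 0 <= c -> nnmeas g ->
  ktransfer (fun y => c * g y) x = c * ktransfer g x.
Proof.
move=> c0 [mg g0]; rewrite /ktransfer -ge0_integralZl//.
- by apply: eq_integral => y _; rewrite muleCA.
- by apply: measurable_funTS; exact: measurable_integrand.
- by move=> y _; exact: integrand_ge0.
Qed.

Lemma nnmeas0 : nnmeas (fun=> 0).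
Proof. by split => //; exact: measurable_cst. Qed.

Lemma nnmeasD f g : nnmeas f -> nnmeas g -> nnmeas (fun x => f x + g x).
Proof.
by move=> [mf f0] [mg g0]; split; [exact: emeasurable_funD|move=> x; exact: adde_ge0].
Qed.

Lemma nnmeasZ c g : 0 <= c -> nnmeas g -> nnmeas (fun x => c * g x).
Proof.
move=> c0 [mg g0]; split; last by move=> x; exact: mule_ge0.
by apply: emeasurable_funM => //; exact: measurable_cst.
Qed.

Lemma nnmeas_sum n (F : nat -> R -> \bar R) : (forall i, nnmeas (F i)) ->
  nnmeas (fun x => \sum_(i < n) F i x).
Proof.
move=> FP; elim: n => [|n IH].
  by under eq_fun do rewrite big_ord0; exact: nnmeas0.
by under eq_fun do rewrite big_ord_recr /=; exact: nnmeasD.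
Qed.

Lemma ktransfer_sum n (F : nat -> R -> \bar R) x : (forall i, nnmeas (F i)) ->
  ktransfer (fun y => \sum_(i < n) F i y) x = \sum_(i < n) ktransfer (F i) x.
Proof.
move=> FP; elim: n => [|n IH].
  rewrite big_ord0 /ktransfer integral0_eq// => y _.
  by rewrite big_ord0 mule0.
rewrite big_ord_recr /= -IH -ktransferD//; last exact: nnmeas_sum.
by congr ktransfer; apply/funext => y; rewrite big_ord_recr.
Qed.

Definition wall (x : R) : \bar R := (weight (0 - x))%:E.

Lemma nnmeas_wall : nnmeas wall.
Proof.
split; last by move=> x; rewrite lee_fin weight_ge0.
apply/measurable_EFinP; apply: (measurableT_comp measurable_weight).
by apply: measurable_funB => //; exact: measurable_cst.
Qed.

(** Renewal structure: the path is cut at its first contact with the wall,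
    after which it starts afresh from height 0. *)
Lemma iter_transfer_renewal eps N g x : nnmeas g ->
  iter N (transfer eps) g x = iter N ktransfer g x +
   \sum_(j < N) (eps%:num%:E * iter (N - j.+1) (transfer eps) g 0%R) *
      iter j ktransfer wall x.
Proof.
move=> gP; elim: N x => [|N IH] x; first by rewrite big_ord0 adde0.
have [mT T0] := nnmeas_transfer eps N gP.
pose c j := eps%:num%:E * iter (N - j.+1) (transfer eps) g 0%R.
have c0 j : 0 <= c j.
  by rewrite mule_ge0 ?lee_fin//; have [_] := nnmeas_transfer eps (N - j.+1) gP.
pose F j y := c j * iter j ktransfer wall y.
have FP j : nnmeas (F j).
  by apply: nnmeasZ => //; apply: nnmeas_ktransfer; exact: nnmeas_wall.
rewrite iterS transferE// big_ord_recl /= subSS subn0.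
have -> : ktransfer (iter N (transfer eps) g) x =
    ktransfer (fun y => iter N ktransfer g y + \sum_(j < N) F j y) x.
  by congr ktransfer; apply/funext => y; rewrite IH.
rewrite ktransferD//; [|exact: nnmeas_ktransfer|exact: nnmeas_sum].
rewrite ktransfer_sum// -addeA; congr (_ + _); rewrite addeC; congr (_ + _).
  by rewrite muleA muleAC.
apply: eq_bigr => j _; rewrite /F ktransferZ//.
by apply: nnmeas_ktransfer; exact: nnmeas_wall.
Qed.

Lemma site_measure_lattice (eps : {nonneg R}) : site_measure s eps (~` lattice s) = 0.
Proof.
rewrite /site_measure /measure_add/= /msum !big_ord_recl big_ord0 adde0 /=.
rewrite /mrestr /mscale /=.
rewrite diracE memNset ?mule0 ?adde0; last by move=> /(_ (lattice0 R s)).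
apply: (@subset_measure0 _ mR _ (mu R s) _ (~` lattice s)).
- apply: measurableI; last exact: measurable_pos.
  by apply: measurableC; exact: measurable_lattice.
- by apply: measurableC; exact: measurable_lattice.
- exact: subIsetl.
- exact: mu_lattice.
Qed.

(** On the lattice the iterated integrals of the partition functions are
    iterates of the transfer operator.  The constant [c] collects the weights
    of the steps already made. *)
Lemma iter_integral_transfer eps (G : nat -> R -> seq R -> \bar R) g :
  nnmeas g ->
  (forall n x xs, 0 <= G n x xs) ->
  (forall x, lattice s x -> G 0%N x [::] = g x) ->
  (forall n x y xs, G n.+1 x (y :: xs) = expeR (- V (y - x)) * G n y xs) ->
  forall n (c : R) x, (0 <= c)%R -> lattice s x ->
    iter_integral (site_measure s eps) n (fun xs => c%:E * G n x xs) =
    c%:E * iter n (transfer eps) g x.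
Proof.
move=> gP G0 Gnil Gcons; elim=> [|n IH] c x c0 sx; first by rewrite /= Gnil.
have [mT T0] := nnmeas_transfer eps n gP.
transitivity (\int[site_measure s eps]_(y in `[0%R, +oo[)
    (c%:E * ((weight (y - x))%:E * iter n (transfer eps) g y))); last first.
  rewrite ge0_integralZl_EFin//.
  - by move=> y _; exact: integrand_ge0.
  - by apply: measurable_funTS; exact: measurable_integrand.
apply: (@integral_conull _ _ mR _ (lattice s)) => //.
- exact: measurable_lattice.
- exact: site_measure_lattice.
- by move=> y _; apply: iter_integral_ge0 => xs; rewrite mule_ge0// lee_fin.
- by move=> y _; rewrite mule_ge0 ?lee_fin//; exact: integrand_ge0.
- move=> y _ sy; rewrite muleA -EFinM -IH//; last by rewrite mulr_ge0// weight_ge0.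
  congr iter_integral; apply/funext => xs.
  by rewrite Gcons EFinM -muleA weightE//; exact: latticeB.
Qed.

Lemma expeRND (a b : \bar R) : a != -oo -> b != -oo ->
  expeR (- (a + b)) = expeR (- a) * expeR (- b).
Proof.
move=> a0 b0; rewrite -expeRD oppeD//.
by case: a a0 b0 => [a||]; case: b => [b||].
Qed.

Lemma Zc_transfer eps N : Zc s V eps N = iter N (transfer eps) wall 0%R.
Proof.
pose G n x xs := expeR (- \sum_(0 <= i < n.+1)
  V (nth 0%R (x :: rcons xs 0%R) i.+1 - nth 0%R (x :: rcons xs 0%R) i)%R).
have Vsum n x xs : \sum_(0 <= i < n)
  V (nth 0%R (x :: rcons xs 0%R) i.+1 - nth 0%R (x :: rcons xs 0%R) i)%R != -oo.
  elim: n => [|n IH]; first by rewrite big_nil.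
  rewrite big_nat_recr//= adde_eq_ninfty negb_or IH; exact: V_neqNy.
have := @iter_integral_transfer eps G wall nnmeas_wall _ _ _ N 1%R 0%R ler01 (lattice0 R s).
rewrite mul1e => <-.
- rewrite /Zc; congr iter_integral; apply/funext => xs.
  by rewrite mul1e.
- by move=> n x xs; exact: expeR_ge0.
- move=> x sx; rewrite /G big_nat1 /= /wall weightE//.
  by apply: latticeB => //; exact: lattice0.
- move=> n x y xs; rewrite /G big_nat_recl// expeRND//.
  exact: (Vsum _ y xs).
Qed.

Lemma Zf_transfer eps N : Zf s V eps N = iter N (transfer eps) (fun=> 1) 0%R.
Proof.
pose G n x xs := expeR (- \sum_(0 <= i < n)
  V (nth 0%R (x :: rcons xs 0%R) i.+1 - nth 0%R (x :: rcons xs 0%R) i)%R).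
have Vsum n x xs : \sum_(0 <= i < n)
  V (nth 0%R (x :: rcons xs 0%R) i.+1 - nth 0%R (x :: rcons xs 0%R) i)%R != -oo.
  elim: n => [|n IH]; first by rewrite big_nil.
  rewrite big_nat_recr//= adde_eq_ninfty negb_or IH; exact: V_neqNy.
have one : nnmeas (fun=> 1) by split => //; exact: measurable_cst.
have := @iter_integral_transfer eps G _ one _ _ _ N 1%R 0%R ler01 (lattice0 R s).
rewrite mul1e => <-.
- rewrite /Zf; congr iter_integral; apply/funext => xs.
  by rewrite mul1e.
- by move=> n x xs; exact: expeR_ge0.
- by move=> x sx; rewrite /G big_nil oppe0 expeR0.
- move=> n x y xs; rewrite /G big_nat_recl// expeRND//.
  exact: (Vsum _ y xs).
Qed.

End transfer.

(** * The random walk kept positive *)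

Section mrestr_integral.
Local Open Scope ereal_scope.

Lemma ge0_integral_mrestr d (T : measurableType d) (R : realType)
    (m : {measure set T -> \bar R}) (D : set T) (mD : measurable D) (f : T -> \bar R) :
  measurable_fun setT f -> (forall x, 0 <= f x) ->
  \int[mrestr m mD]_x f x = \int[m]_(x in D) f x.
Proof.
move=> mf f0; rewrite -(setUv D) ge0_integral_setU//.
- rewrite [X in _ + X](_ : _ = 0) ?adde0.
    by apply: eq_measure_integral => A mA AD /=; rewrite /mrestr setIidl.
  rewrite -(integral_measure_zero (~` D) f).
  apply: eq_measure_integral => A mA AD /=; rewrite /mrestr /mzero.
  by rewrite (_ : A `&` D = set0) ?measure0//; apply/disjoints_subset.
- exact: measurableC.
- exact: measurable_funTS.
- by apply/disj_setPS => x [].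
Qed.

End mrestr_integral.

Section random_walk.
Context (d : measure_display) (T : measurableType d) (R : realType)
  (P : probability T R) (Y : nat -> {RV P >-> R}).
Local Open Scope ereal_scope.
Local Notation mR := (measurableTypeR R).

Definition stay_pos n : set T := [set w | forall i, (1 <= i <= n)%N -> (0 < walk Y i w)%R].

Lemma walkS n w : walk Y n.+1 w = (walk Y n w + Y n w)%R.
Proof. by rewrite /walk big_ord_recr. Qed.

Lemma walk0 w : walk Y 0 w = 0%R.
Proof. by rewrite /walk big_ord0. Qed.

Lemma measurable_walk n : measurable_fun [set: T] (walk Y n : T -> mR).
Proof.
elim: n => [|n IH].
  rewrite (_ : walk Y 0 = fun=> 0%R); first exact: measurable_cst.
  by apply/funext => w; rewrite walk0.
rewrite (_ : walk Y n.+1 = fun w => (walk Y n w + Y n w)%R); last first.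
  by apply/funext => w; rewrite walkS.
by apply: measurable_funD.
Qed.

Lemma stay_posS n : stay_pos n.+1 = stay_pos n `&` [set w | (0 < walk Y n.+1 w)%R].
Proof.
apply/seteqP; split => w /=.
  move=> H; split; last by apply: H; rewrite leqnn.
  by move=> i /andP[i1 iN]; apply: H; rewrite i1 leqW.
move=> [H Hn] i /andP[i1]; rewrite leq_eqVlt => /predU1P[->//|iN].
by apply: H; rewrite i1.
Qed.

Lemma stay_pos0 : stay_pos 0 = setT.
Proof. by apply/seteqP; split => // w _ i /andP[i1 /(leq_trans i1)]. Qed.

Lemma measurable_stay_pos n : measurable (stay_pos n).
Proof.
elim: n => [|n IH]; first by rewrite stay_pos0.
rewrite stay_posS; apply: measurableI => //.
rewrite (_ : [set w | _] = setT `&` walk Y n.+1 @^-1` `]0%R, +oo[%classic).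
  by apply: (measurable_walk n.+1) => //; exact: measurable_itv.
by rewrite setTI; apply/seteqP; split => w /=; rewrite in_itv/= andbT.
Qed.

Lemma measurable_preim (E : set T) (W : T -> mR) (C : set mR) : measurable E ->
  measurable_fun [set: T] W -> measurable C -> measurable (E `&` W @^-1` C).
Proof. by move=> mE mW mC; apply: measurableI => //; rewrite -[X in measurable X]setTI; exact: mW. Qed.

Section restricted_law.
Variables (E : set T) (W : T -> mR).

(** The proofs [mE] and [mW] are arguments so that unification finds them in the
    measure structure declared below. *)
Definition restricted_law (mE : measurable E) (mW : measurable_fun [set: T] W)
  (C : set mR) : \bar R := P (W @^-1` C `&` E).

Variables (mE : measurable E) (mW : measurable_fun [set: T] W).
Local Notation rlaw := (restricted_law mE mW).

Let m : {measure set mR -> \bar R} := 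
  measure_function_pushforward__canonical__measure_function_Measure (mrestr P mE) mW.

HB.instance Definition _ := isMeasure.Build _ _ _ rlaw
  (measure0 m) (measure_ge0 m) (@measure_semi_sigma_additive _ _ _ m).

Let fin : fin_num_fun rlaw.
Proof.
move=> C mC; rewrite ge0_fin_numE; last exact: (measure_ge0 m).
rewrite (le_lt_trans (probability_le1 P _)) ?ltry//.
by rewrite setIC; exact: measurable_preim.
Qed.

HB.instance Definition _ := Measure_isFinite.Build _ _ _ rlaw fin.

Lemma ge0_integral_restricted_law (f : mR -> \bar R) :
  measurable_fun setT f -> (forall x, 0 <= f x) ->
  \int[rlaw]_x f x = \int[P]_(w in E) f (W w).
Proof.
move=> mf f0; have fW : measurable_fun [set: T] (f \o W) by exact: measurableT_comp.
rewrite -(ge0_integral_mrestr P mE fW); last by move=> x; exact: f0.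
exact: (ge0_integral_pushforward mW (mrestr P mE) measurableT mf (fun y _ => f0 y)).
Qed.

End restricted_law.

Hypothesis Y_indep : mutually_independent Y.
Variable law : {finite_measure set mR -> \bar R}.
Hypothesis Y_law : forall i (A : set mR), measurable A -> P (Y i @^-1` A) = law A.

Definition cylinder (I : {fset nat}) (A : nat -> set mR) : set T :=
  \bigcap_(i in [set` I]) (Y i @^-1` A i).

Lemma measurable_step i : measurable_fun [set: T] (Y i : T -> mR).
Proof. exact: (measurable_funPT (Y i)). Qed.

Lemma measurable_cylinder I A : (forall i, measurable (A i)) -> measurable (cylinder I A).
Proof.
move=> mA; apply: bigcap_measurableType => i _.
by rewrite -[X in measurable X]setTI; apply: measurable_step.
Qed.

Lemma measurable_walk_step n :
  measurable_fun [set: T] ((fun w => (walk Y n w, Y n w)) : T -> mR * mR).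
Proof.
by apply: measurable_fun_pair; [exact: measurable_walk|exact: measurable_step].
Qed.

(** A measure on the plane is determined by its values on rectangles.  The
    constant [c] makes it possible to take for [m1] the law of the walk on a
    smaller event than [E], when the two are proportional. *)
Lemma joint_law n (E : set T) (mE : measurable E)
    (m1 : {finite_measure set mR -> \bar R}) (c : {nonneg R}) :
  (forall C A, measurable C -> measurable A ->
    c%:num%:E * P ((walk Y n @^-1` C `&` Y n @^-1` A) `&` E) = m1 C * law A) ->
  forall X : set (mR * mR), measurable X ->
    c%:num%:E * P ((fun w => (walk Y n w, Y n w)) @^-1` X `&` E) = (m1 \x law) X.
Proof.
move=> rect X mX; apply/esym.
pose m' : {measure set (mR * mR) -> \bar R} := mscale c
  (measure_function_pushforward__canonical__measure_function_Measure
    (mrestr P mE) (measurable_walk_step n)).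
exact: (@product_measure_unique _ _ mR mR R m1 law m' rect X mX).
Qed.

(** The induction on [n] goes through because the event about later steps is
    arbitrary: it may contain the step [n]. *)
Lemma walk_indep n : forall (I : {fset nat}) (A : nat -> set mR),
  (forall i, i \in I -> (n <= i)%N) -> (forall i, measurable (A i)) ->
  forall C, measurable C ->
  P ((walk Y n @^-1` C `&` cylinder I A) `&` stay_pos n) =
  P (walk Y n @^-1` C `&` stay_pos n) * \prod_(i <- I) law (A i).
Proof.
elim: n => [|n IH] I A nI mA C mC.
  rewrite stay_pos0 !setIT; have [C0|C0] := pselect (C 0%R).
    have -> : walk Y 0 @^-1` C = setT.
      by apply/seteqP; split => // w _; rewrite /= walk0.
    rewrite setTI probability_setT mul1e /cylinder Y_indep//.
    by apply: eq_bigr => i _; exact: Y_law.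
  have -> : walk Y 0 @^-1` C = set0.
    by apply/seteqP; split => // w /=; rewrite walk0.
  by rewrite set0I measure0 mul0e.
have p0 : (0 <= \prod_(i <- I) fine (law (A i)))%R.
  by apply: prodr_ge0 => i _; apply: fine_ge0.
pose p := NngNum p0.
have pE : \prod_(i <- I) law (A i) = p%:num%:E.
  rewrite -prodEFin; apply: eq_bigr => i _; rewrite fineK//.
  exact: fin_num_measure.
pose J := cylinder I A; pose S := stay_pos n.
have mJ : measurable J by exact: measurable_cylinder.
have mS : measurable S by exact: measurable_stay_pos.
have nI' i : i \in I -> (n <= i)%N by move=> /nI /ltnW.
have mEJ : measurable (S `&` J) by exact: measurableI.
pose D : set (mR * mR) := (fun z => z.1 + z.2)%R @^-1` (C `&` `]0%R, +oo[%classic).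
have mD : measurable D.
  rewrite -[D]setTI; apply: measurable_funD => //.
  by apply: measurableI => //; exact: measurable_itv.
have DE E : (walk Y n.+1 @^-1` C `&` E) `&` stay_pos n.+1 =
    (fun w => (walk Y n w, Y n w)) @^-1` D `&` (S `&` E).
  rewrite stay_posS; apply/seteqP; split => w /=; rewrite /D /= !walkS in_itv/= andbT; tauto.
have stepI (k : {fset nat}) C' A' : (forall i, i \in k -> (n < i)%N) ->
    measurable C' -> measurable A' ->
    P ((walk Y n @^-1` C' `&` Y n @^-1` A') `&` (S `&` cylinder k A)) =
    P (walk Y n @^-1` C' `&` S) * \prod_(i <- k) law (A i) * law A'.
  move=> nk mC' mA'; pose B i := if i == n then A' else A i.
  have nNk : n \notin k by apply/negP => /nk; rewrite ltnn.
  have kn i : i \in k -> (i == n) = false by move=> /nk; apply: contraTF => /eqP ->; rewrite ltnn.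
  have -> : (walk Y n @^-1` C' `&` Y n @^-1` A') `&` (S `&` cylinder k A) =
      (walk Y n @^-1` C' `&` cylinder (n |` k)%fset B) `&` S.
    apply/seteqP; split => w.
      move=> [[Wn An] [Sn kA]]; split => //; split => // i /=; rewrite in_fset1U /B.
      by case: eqP => [-> //|/= _]; exact: kA.
    move=> [[Wn An] Sn]; split; first split => //.
      by have := An n; rewrite /= in_fset1U eqxx /B eqxx; apply.
    split => // i /= ik; have := An i.
    by rewrite /= in_fset1U ik orbT /B kn//; apply.
  rewrite IH//.
  - rewrite big_fsetU1//= /B eqxx -muleA; congr (_ * _); rewrite muleC; congr (_ * _).
    by apply: eq_big_seq => i ik; rewrite kn.
  - by move=> i; rewrite in_fset1U => /predU1P[->//|/nk/ltnW].
  - by move=> i; rewrite /B; case: eqP.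
have all C' : measurable C' -> P (walk Y n @^-1` C' `&` (S `&` J)) =
    P (walk Y n @^-1` C' `&` S) * p%:num%:E.
  move=> mC'; have := stepI I C' setT nI mC' measurableT.
  by rewrite -(Y_law 0)// !preimage_setT setIT probability_setT mule1 pE.
pose m1 := restricted_law mEJ (measurable_walk n).
rewrite pE DE (_ : walk Y n.+1 @^-1` C `&` stay_pos n.+1 =
  (fun w => (walk Y n w, Y n w)) @^-1` D `&` (S `&` setT)); last first.
  by rewrite -DE setIT.
rewrite setIT muleC (@joint_law n S mS m1)//.
  rewrite -(@joint_law n (S `&` J) mEJ m1 ((1 : R)%:nng)%R)//; first by rewrite mul1e.
  by move=> C' A' mC' mA'; rewrite mul1e stepI// pE -all.
move=> C' A' mC' mA'; rewrite -[RHS]/(P (walk Y n @^-1` C' `&` (S `&` J)) * law A') all//.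
have := stepI fset0 C' A' (fun i => _) mC' mA'.
rewrite /cylinder set_fset0 bigcap_set0 setIT big_seq_fset0 mule1 => ->//.
by rewrite muleA [_ * P _]muleC.
Qed.

Lemma joint_law_stay_pos n (X : set (mR * mR)) : measurable X ->
  P ((fun w => (walk Y n w, Y n w)) @^-1` X `&` stay_pos n) =
  (restricted_law (measurable_stay_pos n) (measurable_walk n) \x law) X.
Proof.
move=> mX; rewrite -(@joint_law n _ (measurable_stay_pos n) _ ((1 : R)%:nng)%R)//=.
  by rewrite mul1e.
move=> C A mC mA; rewrite mul1e.
have := walk_indep (I := [fset n]%fset) (A := fun=> A) (n := n) _ _ mC.
rewrite big_seq_fset1 /restricted_law => <-//; last by move=> i; rewrite inE => /eqP ->.
congr (P (_ `&` _)); rewrite /cylinder; congr (_ `&` _).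
apply/seteqP; split => [w An i|w]; first by rewrite /= inE => /eqP ->.
by apply; rewrite /= inE.
Qed.

Lemma ge0_integral_walk_step n (F : mR * mR -> \bar R) :
  measurable_fun setT F -> (forall z, 0 <= F z) ->
  \int[P]_(w in stay_pos n) F (walk Y n w, Y n w) =
  \int[restricted_law (measurable_stay_pos n) (measurable_walk n)]_x \int[law]_y F (x, y).
Proof.
move=> mF F0; pose nu := restricted_law (measurable_stay_pos n) (measurable_walk n).
have mFW : measurable_fun [set: T] (F \o (fun w => (walk Y n w, Y n w))).
  by apply: measurableT_comp => //; exact: measurable_walk_step.
rewrite -(@fubini_tonelli1 _ _ mR mR R nu law F mF F0).
rewrite -(ge0_integral_mrestr P (measurable_stay_pos n) mFW); last by move=> x; exact: F0.
pose m' : {measure set (mR * mR) -> \bar R} :=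
  measure_function_pushforward__canonical__measure_function_Measure
    (mrestr P (measurable_stay_pos n)) (measurable_walk_step n).
transitivity (\int[m']_z F z).
  apply/esym; exact: (ge0_integral_pushforward (measurable_walk_step n)
    (mrestr P (measurable_stay_pos n)) measurableT mF (fun y _ => F0 y)).
apply: eq_measure_integral => A mA _.
exact: joint_law_stay_pos.
Qed.

End random_walk.

Section potential_walk.
Context (d : measure_display) (T : measurableType d) (R : realType)
  (P : probability T R) (Y : nat -> {RV P >-> R}) (s : setup) (V : R -> \bar R).
Hypothesis V_neqNy : forall x, V x != -oo%E.
Hypothesis V_cont : s = ContinuousCase -> continuous (fun x : R => expeR (- V x)%E).
Hypothesis Y_iid : iid_with_potential Y s V.
Local Open Scope ereal_scope.
Local Notation mR := (measurableTypeR R).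
Local Notation kappa := (kappa s V).

Let law : {finite_measure set mR -> \bar R} :=
  restricted_law P measurableT (measurable_step Y 0).

Let Y_law i (A : set mR) : measurable A -> P (Y i @^-1` A) = law A.
Proof.
move=> mA; have [_ H] := Y_iid; have := H i A mA; rewrite -(H 0%N A mA).
by rewrite -[law A]/(P (_ `&` _)) setIT.
Qed.

Let step_density x := (kappa^-1 * weight s V x)%R.

Let step_density_ge0 x : (0 <= step_density x)%R.
Proof. by rewrite mulr_ge0 ?weight_ge0// invr_ge0 kappa_ge0. Qed.

Let measurable_step_density : measurable_fun [set: mR] (step_density : mR -> R).
Proof. by apply: measurable_funM => //; exact: measurable_weight. Qed.

Lemma law_density (A : set mR) : measurable A ->
  law A = \int[rmu s]_(x in A) (step_density x)%:E.
Proof.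
move=> mA; rewrite -(Y_law 0)//; have [_ /(_ 0%N A mA)] := Y_iid.
rewrite -[P _]/(distribution P (Y 0%N) A) => ->.
have -> : \int[mu R s]_(x in A) expeR (- V x) = \int[rmu s]_(x in A) (weight s V x)%:E.
  apply: (@integral_conull R _ mR (mu R s) (lattice s)) => //.
  - exact: measurable_lattice.
  - exact: mu_lattice.
  - by move=> x _; exact: expeR_ge0.
  - by move=> x _; rewrite lee_fin weight_ge0.
  - by move=> x _ sx; rewrite weightE.
rewrite -ge0_integralZl_EFin//.
- by move=> x _; rewrite lee_fin weight_ge0.
- by apply/measurable_EFinP; apply: measurable_funTS; exact: measurable_weight.
- by rewrite invr_ge0 kappa_ge0.
Qed.

Lemma law_lattice : law (~` lattice s) = 0.
Proof.
rewrite law_density; last by apply: measurableC; exact: measurable_lattice.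
by apply: integral0_eq => x sx; rewrite /step_density /weight indicE memNset// !mulr0.
Qed.

Lemma walk_lattice n : P (walk Y n @^-1` (~` lattice s)) = 0.
Proof.
have mN : measurable (~` lattice s : set mR).
  by apply: measurableC; exact: measurable_lattice.
elim: n => [|n IH].
  rewrite (_ : _ @^-1` _ = set0) ?measure0//.
  by apply/seteqP; split => // w /=; rewrite walk0; have := lattice0 R s.
have mW k : measurable (walk Y k @^-1` (~` lattice s)).
  by rewrite -[X in measurable X]setTI; exact: measurable_walk.
have mY : measurable (Y n @^-1` (~` lattice s)).
  by rewrite -[X in measurable X]setTI; apply: measurable_step.
apply: (@subset_measure0 _ _ _ P _
  (walk Y n @^-1` (~` lattice s) `|` Y n @^-1` (~` lattice s))) => //.
- exact: measurableU.
- move=> w /=; rewrite walkS -not_andP; apply: contra_not => -[].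
  exact: latticeD.
- by apply: null_set_setU => //; rewrite -law_lattice -(Y_law n).
Qed.

Let positive_part (g : R -> \bar R) z := g z * (\1_(`]0%R, +oo[%classic : set R) z)%:E.

Let measurable_positive_part g : nnmeas g -> measurable_fun [set: mR] (positive_part g : mR -> \bar R).
Proof.
move=> [mg g0]; apply: emeasurable_funM => //.
by apply/measurable_EFinP; exact: measurable_indic.
Qed.

Let positive_part_ge0 g z : nnmeas g -> 0 <= positive_part g z.
Proof. by move=> [mg g0]; rewrite mule_ge0// lee_fin. Qed.

Lemma ge0_integral_translation (a : R) (h : mR -> \bar R) : lattice s a ->
  measurable_fun setT h -> (forall x, 0 <= h x) ->
  \int[rmu s]_x h (a + x)%R = \int[rmu s]_x h x.
Proof.
move=> sa mh h0.
have ma : measurable_fun [set: mR] ((fun x => a + x)%R : mR -> mR).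
  by apply: measurable_funD => //; exact: measurable_cst.
pose m' : {measure set mR -> \bar R} :=
  measure_function_pushforward__canonical__measure_function_Measure (rmu s) ma.
transitivity (\int[m']_z h z).
  apply/esym; exact: (ge0_integral_pushforward ma (rmu s) measurableT mh (fun y _ => h0 y)).
apply: eq_measure_integral => A mA _.
exact: mu_translation.
Qed.

Lemma step_ktransfer g x : nnmeas g -> lattice s x ->
  \int[law]_y positive_part g (x + y)%R = kappa^-1%:E * ktransfer s V g x.
Proof.
move=> gP sx; have [mg g0] := gP.
have mpx : measurable_fun [set: mR] ((fun y => positive_part g (x + y)%R) : mR -> \bar R).
  apply: (measurableT_comp (measurable_positive_part gP)).
  by apply: measurable_funD => //; exact: measurable_cst.
rewrite (ge0_integral_density measurable_step_density step_density_ge0 law_density)//; last first.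
  by move=> y; exact: positive_part_ge0.
rewrite /ktransfer -ge0_integralZl_EFin//.
- pose h z := positive_part g z * (step_density (z - x))%:E.
  transitivity (\int[rmu s]_y h (x + y)%R).
    by apply: eq_integral => y _; rewrite /h; congr (_ * (step_density _)%:E); ring.
  rewrite ge0_integral_translation//.
  + rewrite [RHS]integral_mkcond; apply: eq_integral => y _.
    by rewrite epatch_indic /h /positive_part /step_density EFinM [LHS]muleC [LHS]muleA [in RHS]muleA.
  + apply: emeasurable_funM; first exact: measurable_positive_part.
    apply/measurable_EFinP; apply: (measurableT_comp measurable_step_density).
    by apply: measurable_funB => //; exact: measurable_cst.
  + by move=> y; rewrite mule_ge0 ?positive_part_ge0// lee_fin.
- by move=> y _; exact: integrand_ge0.
- by apply: measurable_funTS; exact: measurable_integrand.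
- by rewrite invr_ge0 kappa_ge0.
Qed.

(** A step of the walk has density [exp (- V) / kappa], so that a step followed by
    the test of positivity is [ktransfer] divided by [kappa]. *)
Lemma integral_stay_pos n g : nnmeas g ->
  \int[P]_(w in stay_pos Y n) g (walk Y n w) =
  (kappa ^- n)%:E * iter n (ktransfer s V) g 0%R.
Proof.
elim: n g => [|n IH] g gP; have [mg g0] := gP.
  rewrite stay_pos0 (eq_integral (cst (g 0%R))) => [|w _]; last by rewrite walk0.
  transitivity (g 0%R * P [set: T]); first exact: integral_cst.
  by have -> : P [set: T] = 1 := probability_setT P; rewrite mule1 expr0 invr1 mul1e.
have kP : nnmeas (fun x => kappa^-1%:E * ktransfer s V g x).
  apply: nnmeasZ; first by rewrite lee_fin invr_ge0 kappa_ge0.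
  exact: (nnmeas_ktransfer V_neqNy V_cont 1%N gP).
have mW := measurable_walk Y n; have mS := measurable_stay_pos Y n.
transitivity (\int[P]_(w in stay_pos Y n) positive_part g (walk Y n w + Y n w)%R).
  rewrite stay_posS integral_mkcondr; apply: eq_integral => w _.
  by rewrite epatch_indic /positive_part -walkS; congr (_ * _%:E);
    rewrite !indicE; congr ((_ : bool)%:R); apply/idP/idP; rewrite !inE /= in_itv/= andbT.
rewrite (@ge0_integral_walk_step _ _ _ _ _ _ law Y_law n (fun z => positive_part g (z.1 + z.2)%R)).
- transitivity (\int[restricted_law P mS mW]_x (kappa^-1%:E * ktransfer s V g x)).
  + apply: (@integral_conull R _ mR (restricted_law P mS mW) (lattice s)) => //.
    * exact: measurable_lattice.
    * rewrite -[LHS]/(P (walk Y n @^-1` (~` lattice s) `&` stay_pos Y n)).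
      apply: (@subset_measure0 _ _ _ P _ (walk Y n @^-1` (~` lattice s))).
      -- rewrite setIC; apply: measurable_preim => //.
         by apply: measurableC; exact: measurable_lattice.
      -- rewrite -[X in measurable X]setTI; apply: mW => //.
         by apply: measurableC; exact: measurable_lattice.
      -- exact: subIsetl.
      -- exact: walk_lattice.
    * by move=> x _; apply: integral_ge0 => y _; exact: positive_part_ge0.
    * by move=> x _; have [_] := kP.
    * by move=> x _ sx; exact: step_ktransfer.
  + rewrite ge0_integral_restricted_law; [|by case: kP|by case: kP].
    have kgP := nnmeas_ktransfer V_neqNy V_cont 1%N gP; have [mkg kg0] := kgP.
    rewrite ge0_integralZl_EFin//.
    * by rewrite (IH _ kgP) [in RHS]iterSr muleA -EFinM exprS invfM.
    * by move=> w _; exact: kg0.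
    * by apply: measurable_funTS; exact: (measurableT_comp mkg mW).
    * by rewrite invr_ge0 kappa_ge0.
- by have [] := Y_iid.
- apply: (measurableT_comp (measurable_positive_part gP)).
  by apply: measurable_funD.
- by move=> z; exact: positive_part_ge0.
Qed.

Lemma pos_probE n :
  (pos_prob Y n)%:E = (kappa ^- n)%:E * iter n (ktransfer s V) (fun=> 1) 0%R.
Proof.
have oneP : nnmeas (fun=> 1 : \bar R) by split => //; exact: measurable_cst.
rewrite -(integral_stay_pos n oneP).
have -> : \int[P]_(w in stay_pos Y n) 1 = P (stay_pos Y n).
  transitivity (1 * P (stay_pos Y n)); last by rewrite mul1e.
  by apply: integral_cst; exact: measurable_stay_pos.
rewrite fineK//; apply: fin_num_measure; exact: measurable_stay_pos.
Qed.

Lemma pos_prob_ge0 n : (0 <= pos_prob Y n)%R.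
Proof. exact: fine_ge0. Qed.

Lemma pos_prob_nonincreasing m n : (m <= n)%N -> (pos_prob Y n <= pos_prob Y m)%R.
Proof.
move=> mn; apply: fine_le.
- by apply: fin_num_measure; exact: (measurable_stay_pos Y n).
- by apply: fin_num_measure; exact: (measurable_stay_pos Y m).
- apply: le_measure; rewrite ?inE; [exact: (measurable_stay_pos Y n)|exact: (measurable_stay_pos Y m)|].
  by move=> w H i /andP[i1 im]; apply: H; rewrite i1 (leq_trans im).
Qed.

End potential_walk.

(** * The partition functions at criticality *)

Section renewal_equation.
Variable R : realType.

(** [u] is the inverse of [1 - q] for convolution, and as [q 0 = 0] the equation
    for [f] determines it by recursion. *)
Lemma renewal_equation_solution (q u p f : nat -> R) : q 0 = 0 -> u 0 = 1 ->
  (forall n, u n.+1 = \sum_(k < n.+1) q k.+1 * u (n - k)%N) ->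
  (forall n, f n = p n + \sum_(k < n) q k.+1 * f (n - k.+1)%N) ->
  f =1 conv u p.
Proof.
move=> q0 u0 uS fE.
have convq g n : conv q g n = \sum_(k < n) q k.+1 * g (n - k.+1)%N.
  by rewrite /conv big_ord_recl q0 mul0r add0r.
have uE n : u n = (n == 0)%:R + conv q u n.
  case: n => [|n]; first by rewrite convq big_ord0 u0 addr0.
  by rewrite convq uS add0r; apply: eq_bigr => k _; rewrite subSS.
have cE n : conv u p n = p n + conv q (conv u p) n.
  rewrite (eq_conv (x' := fun n => (n == 0)%:R + conv q u n) (y' := p))//.
  rewrite convDl convA; congr (_ + _).
  by rewrite /conv big_ord_recl mul1r subn0 big1 ?addr0// => k _; rewrite mul0r.
elim/ltn_ind => n IH; rewrite fE cE convq; congr (_ + _).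
by apply: eq_bigr => k _; rewrite IH//; have := ltn_ord k; nat_lia.
Qed.

End renewal_equation.

Definition Zc0 (R : realType) (s : setup) (V : R -> \bar R) n : \bar R :=
  Zc s V (0 : R)%:nng n.

Section partition.
Variables (R : realType) (s : setup) (V : R -> \bar R).
Hypothesis V_neqNy : forall x, V x != -oo%E.
Hypothesis V_cont : s = ContinuousCase -> continuous (fun x : R => expeR (- V x)%E).

Local Notation kappa := (kappa s V).
Local Notation gamma := (fine (egamma s V)).
Local Notation Zc := (Zc s V).
Local Notation Zc0 := (Zc0 s V).

Lemma transfer0 g x : nnmeas g -> transfer s V (0 : R)%:nng g x = ktransfer s V g x.
Proof. by move=> [mg g0]; rewrite transferE//= mul0e adde0. Qed.

Lemma iter_transfer0 n g : nnmeas g ->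
  iter n (transfer s V (0 : R)%:nng) g = iter n (ktransfer s V) g.
Proof.
move=> gP; elim: n => //= n IH; apply/funext => x.
by rewrite transfer0 IH//; exact: nnmeas_ktransfer.
Qed.

Lemma Zc0E n : Zc0 n = iter n (ktransfer s V) (wall s V) 0.
Proof. by rewrite /Zc0 Zc_transfer// iter_transfer0//; exact: nnmeas_wall. Qed.

Lemma Zc_ge0 eps n : (0 <= Zc eps n)%E.
Proof. by apply: iter_integral_ge0 => xs; exact: expeR_ge0. Qed.

(** For the pinned path and the free one alike, decomposition at the first contact
    with the wall. *)
Lemma Zc_renewal eps N : Zc eps N =
  (Zc0 N + \sum_(j < N) (eps%:num%:E * Zc eps (N - j.+1)) * Zc0 j)%E.
Proof.
rewrite Zc_transfer// iter_transfer_renewal//; last exact: nnmeas_wall.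
rewrite -Zc0E; congr (_ + _)%E; apply: eq_bigr => j _.
by rewrite Zc0E// Zc_transfer.
Qed.

Lemma Zf_renewal eps N : Zf s V eps N =
  (iter N (ktransfer s V) (fun=> 1) 0%R +
   \sum_(j < N) (eps%:num%:E * Zf s V eps (N - j.+1)) * Zc0 j)%E.
Proof.
have oneP : nnmeas (fun=> 1 : \bar R)%E.
  by split => [|y]; [exact: measurable_cst|exact: lee01].
rewrite Zf_transfer// iter_transfer_renewal//.
congr (_ + _)%E; apply: eq_bigr => j _.
by rewrite Zc0E// Zf_transfer.
Qed.

Hypotheses (kappa_gt0 : 0 < kappa) (gamma_gt0 : 0 < gamma).

Let gammaE : egamma s V = gamma%:E.
Proof. by move: gamma_gt0; case: (egamma s V) => //=; rewrite ltxx. Qed.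

Lemma gamma_series : (\sum_(0 <= n < N) Zc0 n * ((kappa ^+ n.+1)^-1)%:E @[N --> \oo]
  --> gamma%:E)%E.
Proof.
pose a (n : nat) := (Zc0 n.-1 * ((kappa ^+ n)^-1)%:E)%E.
have a0 n : (0 <= a n)%E.
  by apply: mule_ge0; [exact: Zc_ge0|rewrite lee_fin invr_ge0 exprn_ge0// ltW].
have : (\sum_(1 <= n < N) a n)%E @[N --> \oo] --> egamma s V.
  exact: (is_cvg_nneseries (fun n _ _ => a0 n)).
by rewrite -cvg_shiftS gammaE; under eq_fun do rewrite big_add1.
Qed.

(* A term of the convergent series for [gamma] is finite. *)
Let Zc0_fin n : Zc0 n = (fine (Zc0 n))%:E.
Proof.
have t0 k : (0 <= Zc0 k * ((kappa ^+ k.+1)^-1)%:E)%E.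
  by apply: mule_ge0; [exact: Zc_ge0|rewrite lee_fin invr_ge0 exprn_ge0// ltW].
have : (Zc0 n * ((kappa ^+ n.+1)^-1)%:E <= gamma%:E)%E.
  rewrite -(cvg_lim _ gamma_series)//.
  apply: (@le_trans _ _ (\sum_(0 <= k < n.+1) Zc0 k * ((kappa ^+ k.+1)^-1)%:E)%E).
    by rewrite big_nat_recr//= leeDr// sume_ge0.
  by apply: nneseries_lim_ge => k _ _; exact: t0.
have kn : 0 < (kappa ^+ n.+1)^-1 by rewrite invr_gt0 exprn_gt0.
have : (0 <= Zc0 n)%E by exact: Zc_ge0.
case: (Zc0 n) => [//|_ /=|//].
by rewrite gt0_mulye ?lte_fin// leye_eq.
Qed.

Let z n := fine (Zc0 n).

Lemma qS n : Defs.q s V n.+1 = gamma^-1 * z n / kappa ^+ n.+1.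
Proof. by []. Qed.

Lemma q_ge0 n : 0 <= Defs.q s V n.
Proof.
apply: mulr_ge0; last by rewrite invr_ge0 exprn_ge0// ltW.
apply: mulr_ge0; first by rewrite invr_ge0 ltW.
by apply: fine_ge0; exact: Zc_ge0.
Qed.

Lemma q_sum : \sum_(0 <= k < n) Defs.q s V k.+1 @[n --> \oo] --> (1 : R).
Proof.
have H : \sum_(0 <= k < n) z k / kappa ^+ k.+1 @[n --> \oo] --> gamma.
  have : EFin \o (fun n => \sum_(0 <= k < n) z k / kappa ^+ k.+1) @ \oo --> gamma%:E.
    have := gamma_series.
    under eq_fun do under eq_bigr do rewrite Zc0_fin; under eq_fun do rewrite sumEFin.
    exact.
  by move/fine_cvgP => [].
rewrite -(mulVf (lt0r_neq0 gamma_gt0)).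
under eq_fun do (under eq_bigr do rewrite qS -mulrA; rewrite -mulr_sumr).
exact: cvgMr.
Qed.

Lemma Zc_fin eps n : Zc eps n = (fine (Zc eps n))%:E.
Proof.
elim/ltn_ind: n => n IH; rewrite fineK// Zc_renewal Zc0_fin fin_numD/=.
rewrite sum_fin_num; apply/allP => y /mapP[j _ ->]; have jn := ltn_ord j.
have {}jn : (n - j.+1 < n)%N by nat_lia.
by rewrite inE (IH _ jn) Zc0_fin.
Qed.

Local Notation eps := (eps_of s V (1 : R)%:nng).

Let epsE : eps%:num = gamma^-1.
Proof. by rewrite /= mul1r. Qed.

Let u N := fine (tildeZc s V (1 : R)%:nng N).

Let uS' n : u n.+1 = gamma^-1 * fine (Zc eps n) / kappa ^+ n.+1.
Proof. by rewrite /u /tildeZc Zc_fin epsE. Qed.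

(** With [eps = 1 / gamma] the weight of a contact turns the unpinned partition
    functions into the probabilities [q]. *)
Lemma tildeZc_renewal n : u n.+1 = \sum_(k < n.+1) Defs.q s V k.+1 * u (n - k)%N.
Proof.
have -> : u n.+1 = gamma^-1 * (z n + \sum_(j < n) gamma^-1 * fine (Zc eps (n - j.+1)) * z j) / kappa ^+ n.+1.
  rewrite uS'; congr (_ * _ / _); apply: EFin_inj; rewrite -Zc_fin Zc_renewal Zc0_fin EFinD; congr (_ + _)%E.
  by rewrite -sumEFin; apply: eq_bigr => j _; rewrite epsE Zc_fin Zc0_fin !EFinM.
rewrite big_ord_recr/= subnn [u 0](_ : _ = 1)// mulr1 qS mulrDr mulrDl addrC; congr (_ + _).
rewrite mulr_sumr mulr_suml; apply: eq_bigr => j _.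
have jn := ltn_ord j; have -> : (n - j = (n - j.+1).+1)%N by nat_lia.
rewrite uS' qS.
have -> : kappa ^+ n.+1 = kappa ^+ j.+1 * kappa ^+ (n - j.+1).+1.
  by rewrite -exprD; congr (_ ^+ _); nat_lia.
by rewrite invfM; ring.
Qed.

Section free.
Variable p : nat -> R.
Hypothesis pE : forall n,
  (p n)%:E = ((kappa ^- n)%:E * iter n (ktransfer s V) (fun=> 1) 0%R)%E.

Let freeE n : iter n (ktransfer s V) (fun=> 1%E) 0 = (kappa ^+ n * p n)%:E.
Proof.
by rewrite EFinM pE muleA -EFinM mulfV ?mul1e// expf_neq0// gt_eqF.
Qed.

Let Zf_fin n : Zf s V eps n = (fine (Zf s V eps n))%:E.
Proof.
elim/ltn_ind: n => n IH; rewrite fineK// Zf_renewal freeE fin_numD/=.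
rewrite sum_fin_num; apply/allP => y /mapP[j _ ->]; have jn := ltn_ord j.
have {}jn : (n - j.+1 < n)%N by nat_lia.
by rewrite inE (IH _ jn) Zc0_fin.
Qed.

Let f N := fine (tildeZf s V (1 : R)%:nng N).

Lemma tildeZf_renewal n : f n = p n + \sum_(k < n) Defs.q s V k.+1 * f (n - k.+1)%N.
Proof.
have fE m : f m = fine (Zf s V eps m) / kappa ^+ m by rewrite /f /tildeZf Zf_fin.
have -> : f n = (kappa ^+ n * p n + \sum_(j < n) gamma^-1 * fine (Zf s V eps (n - j.+1)) * z j) / kappa ^+ n.
  rewrite fE; congr (_ / _); apply: EFin_inj; rewrite -Zf_fin Zf_renewal freeE EFinD; congr (_ + _)%E.
  by rewrite -sumEFin; apply: eq_bigr => j _; rewrite epsE Zf_fin Zc0_fin !EFinM.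
rewrite mulrDl mulrAC divff ?mul1r ?expf_neq0 ?gt_eqF//; congr (_ + _).
rewrite mulr_suml; apply: eq_bigr => j _.
rewrite fE qS; have -> : kappa ^+ n = kappa ^+ j.+1 * kappa ^+ (n - j.+1).
  by rewrite -exprD; congr (_ ^+ _); have := ltn_ord j; nat_lia.
by rewrite invfM; ring.
Qed.

End free.

End partition.

(** * Asymptotics at the critical point *)

Section truncated_variance.
Context (d : measure_display) (T : measurableType d) (R : realType)
  (P : probability T R) (Y : nat -> {RV P >-> R}).

Let h (t y : R) : R := `|y| ^+ 2 * (`|y| <= t)%R%:R.

Let h_ge0 t y : 0 <= h t y.
Proof. by rewrite mulr_ge0. Qed.

Let h_le t y : h t y <= t ^+ 2.
Proof.
rewrite /h; case: (lerP `|y| t) => [yt|_]; last by rewrite mulr0 sqr_ge0.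
by rewrite mulr1 ler_sqr ?nnegrE// (le_trans _ yt).
Qed.

Let h_homo t t' y : t <= t' -> h t y <= h t' y.
Proof.
move=> tt'; rewrite /h ler_wpM2l// ler_nat.
by case: (lerP `|y| t) => // yt; rewrite (le_trans yt tt').
Qed.

Let measurable_h t : measurable_fun [set: T] (fun w => h t (Y 0%N w)).
Proof.
have mY := measurable_step Y 0.
rewrite (_ : (fun w => _) = (fun w => `|Y 0%N w| ^+ 2 * \1_(`[- t, t]%classic : set (measurableTypeR R)) (Y 0%N w))).
  apply: measurable_funM.
    by apply: measurable_funX; apply: measurableT_comp.
  by apply: (measurableT_comp _ mY); apply: measurable_indic; exact: measurable_itv.
apply/funext => w; rewrite /h indicE; congr (_ * (_ : bool)%:R).
by apply/idP/idP; rewrite inE /= in_itv/= ler_norml.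
Qed.

Let EhE t : truncated_variance Y t = fine (\int[P]_w (h t (Y 0%N w))%:E).
Proof. by rewrite /truncated_variance unlock. Qed.

Let Eh_fin t : (\int[P]_w (h t (Y 0%N w))%:E)%E \is a fin_num.
Proof.
rewrite ge0_fin_numE; last by apply: integral_ge0 => w _; rewrite lee_fin.
apply: (@le_lt_trans _ _ (\int[P]_w (cst (t ^+ 2)%:E) w)%E).
  apply: ge0_le_integral => //.
  - by move=> w _; rewrite lee_fin.
  - by apply/measurable_EFinP; exact: measurable_h.
  - by move=> w _; rewrite lee_fin.
rewrite (_ : (\int[P]_w _)%E = ((t ^+ 2)%:E * P [set: T])%E); last exact: integral_cst.
by have -> : P [set: T] = 1%E := probability_setT P; rewrite mule1 ltry.
Qed.

Lemma truncated_variance_ge0 t : 0 <= truncated_variance Y t.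
Proof. by rewrite EhE; apply/fine_ge0/integral_ge0 => w _; rewrite lee_fin. Qed.

Lemma truncated_variance_homo t t' : t <= t' ->
  truncated_variance Y t <= truncated_variance Y t'.
Proof.
move=> tt'; rewrite !EhE; apply: fine_le; [exact: Eh_fin|exact: Eh_fin|].
apply: ge0_le_integral => //.
- by move=> w _; rewrite lee_fin.
- by apply/measurable_EFinP; exact: measurable_h.
- by apply/measurable_EFinP; exact: measurable_h.
- by move=> w _; rewrite lee_fin; exact: h_homo.
Qed.

End truncated_variance.

Lemma powR_neg_three_half (R : realType) (x : R) : 0 < x ->
  x `^ (- (3%:R / 2%:R)) = (x * Num.sqrt x)^-1.
Proof.
move=> x0; rewrite powRN (_ : 3%:R / 2%:R = 1 + 2^-1); last by lra.
by rewrite powRD ?powRr1 ?powR12_sqrt ?ltW// ?gt_eqF ?implybT.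
Qed.

Lemma cvg_sqrt_cbin (R : realType) :
  Num.sqrt n%:R * cbin R n @[n --> \oo] --> (Num.sqrt pi)^-1.
Proof.
have -> : (fun n => Num.sqrt n%:R * cbin R n) = Num.sqrt \o (fun n => n%:R * cbin R n ^+ 2).
  by apply/funext => n /=; rewrite sqrtrM// sqrtr_sqr ger0_norm// ltW// cbin_gt0.
rewrite -sqrtrV ?pi_ge0//.
exact: (@continuous_cvg nat _ _ \oo _ _ Num.sqrt _ (@sqrt_continuous R _) (@cvg_cbin_sq R)).
Qed.

Theorem lemma3p2 (R : realType) (s : setup) (V : R -> \bar R)
    (d : measure_display) (T : measurableType d) (P : probability T R)
    (Y : nat -> {RV P >-> R}) (L : R -> R) (cq : R)
    (V_neqNy : forall x, V x != -oo%E)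
    (V0_fin : (V 0%R < +oo)%E)
    (kappa_fin : (ekappa s V < +oo)%E)
    (V_cont : s = ContinuousCase -> continuous (fun x : R => expeR (- V x)%E))
    (Y_iid : iid_with_potential Y s V)
    (Y_int : P.-integrable [set: T] (EFin \o Y 0%N))
    (Y_centered : ('E_P[Y 0%N] = 0)%E)
    (Y_var : slowly_varying (truncated_variance Y))
    (L_sv : slowly_varying L)
    (L_def : asymp_equiv +oo%R L
       (fun x => (Num.sqrt (truncated_variance Y (Num.sqrt x / L x)))^-1))
    (cq_gt0 : 0 < cq)
    (q_asymp : asymp_equiv \oo (q s V)
       (fun n => cq * L n%:R * n%:R `^ (- (3%:R / 2%:R))))
    (L'_sv : slowly_varying_seq (fun n => Num.sqrt n%:R * pos_prob Y n)) :
  asymp_equiv \oo (fun N => fine (tildeZc s V (1 : R)%:nng N))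
    (fun N => (2%:R * pi)^-1 * (cq * L N%:R * Num.sqrt N%:R)^-1) /\
  asymp_equiv \oo (fun N => fine (tildeZf s V (1 : R)%:nng N))
    (fun N => (Num.sqrt N%:R * pos_prob Y N) / (2%:R * cq * L N%:R)).
Proof.
have q_neq0 : \forall n \near \oo, (0 < n)%N /\ q s V n != 0.
  near=> n; split; first by near: n; exact: nbhs_infty_gt.
  have : q s V n / (cq * L n%:R * n%:R `^ (- (3%:R / 2%:R))) != 0.
    by near: n; apply: (cvgr_neq0 (1 : R)) => //; exact: oner_neq0.
  by apply: contra_neq => ->; rewrite mul0r.
have [gamma_gt0 kappa_gt0] : 0 < fine (egamma s V) /\ 0 < kappa s V.
  have [n [n0 +]] := filter_ex q_neq0.
  rewrite /q mulf_eq0 mulf_eq0 !invr_eq0 !negb_or expf_eq0 n0/= => /andP[/andP[g _] k].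
  by rewrite !lt_neqAle eq_sym g eq_sym k gamma_ge0 kappa_ge0.
have L_usv : usv (fun n => L n%:R).
  exact: (usv_asymptotic_inverse (truncated_variance_homo Y) (truncated_variance_ge0 Y)
    Y_var L_sv L_def).
have p_ge0 := pos_prob_ge0 Y.
have p_usv : usv (fun n => Num.sqrt n%:R * pos_prob Y n).
  exact: (usv_of_monotone (pos_prob_nonincreasing Y) p_ge0 L'_sv).
pose c : R := Num.sqrt pi.
have c0 : 0 < c by rewrite sqrtr_gt0 pi_gt0.
have cc : c * c = pi by rewrite -expr2 sqr_sqrtr// pi_ge0.
pose B n : R := Num.sqrt n%:R * cbin R n.
have Bc : B n @[n --> \oo] --> c^-1 := @cvg_sqrt_cbin R.
(* The formula for [q] also has a value at 0, where a law of return times has no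
   mass. *)
pose q' n := if n == 0%N then 0 else q s V n.
(* Every asymptotic relation below is an identity between [A], [B] and their
   limits, valid as soon as the denominators are positive. *)
pose A n := q' n / (cq * L n%:R * n%:R `^ (- (3%:R / 2%:R))).
have Ac : A n @[n --> \oo] --> (1 : R).
  apply: near_eq_cvg_to q_asymp; near=> n; rewrite /A /q' ifF//.
  by apply/negbTE; rewrite -lt0n; near: n; exact: nbhs_infty_gt.
have q'_ge0 n : 0 <= q' n by rewrite /q'; case: eqP => // _; exact: q_ge0.
have n_gt0 : \forall n \near \oo, (0 < n%:R :> R).
  by near=> n; rewrite ltr0n; near: n; exact: nbhs_infty_gt.
have q'_gt0 : \forall n \near \oo, 0 < q' n.
  near=> n; have [n0 qn] : (0 < n)%N /\ q s V n != 0 by near: n.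
  by rewrite lt_neqAle q'_ge0 andbT eq_sym /q' gtn_eqF.
have q'_sum : \sum_(k < n.+1) q' k @[n --> \oo] --> (1 : R).
  rewrite (_ : (fun n => _) = fun n => \sum_(0 <= k < n) q s V k.+1).
    exact: q_sum.
  by apply/funext => n; rewrite big_ord_recl add0r big_mkord.
have q'_usv : usv (fun n => 2 * n%:R * q' n / cbin R n).
  apply: (usv_asymp _ _ (usvM (usv_cst (mulr_gt0 (mulr_gt0 (ltr0n R 2) cq_gt0) c0)) L_usv)).
    near=> n; rewrite divr_gt0 ?cbin_gt0// !mulr_gt0//; near: n => //.
  have H : A n / (B n * c) @[n --> \oo] --> (1 : R).
    rewrite -[X in _ --> X]mulr1 -[X in _ * X](invr1); apply: cvgM => //.
    apply: cvgV; first exact: oner_neq0.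
    by rewrite -(mulVf (lt0r_neq0 c0)); exact: cvgMl.
  apply: near_eq_cvg_to H; near=> n.
  have n0 : 0 < n%:R :> R by near: n.
  have L0 : 0 < L n%:R by near: n; case: L_usv.
  have b0 := cbin_gt0 R n; have s0 : 0 < Num.sqrt n%:R :> R by rewrite sqrtr_gt0.
  rewrite /A /B powR_neg_three_half//.
  field.
  by rewrite !gt_eqF.
have q'S n : q' n.+1 = q s V n.+1 by [].
have u_rec := tildeZc_renewal V_neqNy V_cont kappa_gt0 gamma_gt0.
set u := fun N : nat => fine (tildeZc _ _ _ N).
have u_asymp : asymp_equiv \oo u (fun n => cbin R n ^+ 2 / (2 * n%:R * q' n)).
  exact: (renewal_asymp (q := q')).
have f_conv : (fun N => fine (tildeZf s V (1 : R)%:nng N)) = conv u (pos_prob Y).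
  apply/funext; apply: (renewal_equation_solution (q := q')) => //.
  apply: tildeZf_renewal => // n; exact: pos_probE.
have p_usv' : usv (fun n => pos_prob Y n / cbin R n).
  apply: (usv_asymp _ _ (usvM p_usv (usv_cst c0))).
    near=> n; rewrite divr_gt0 ?cbin_gt0//.
    have : 0 < Num.sqrt n%:R * pos_prob Y n by near: n; case: p_usv.
    by rewrite pmulr_rgt0// sqrtr_gt0; near: n.
  have H : (B n * c)^-1 @[n --> \oo] --> (1 : R).
    rewrite -[X in _ --> X](invr1); apply: cvgV; first exact: oner_neq0.
    by rewrite -(mulVf (lt0r_neq0 c0)); exact: cvgMl.
  apply: near_eq_cvg_to H; near=> n.
  have n0 : 0 < n%:R :> R by near: n.
  have b0 := cbin_gt0 R n; have s0 : 0 < Num.sqrt n%:R :> R by rewrite sqrtr_gt0.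
  have : 0 < Num.sqrt n%:R * pos_prob Y n by near: n; case: p_usv.
  rewrite pmulr_rgt0// => p0.
  by rewrite /B; field; rewrite !gt_eqF.
have f_asymp : asymp_equiv \oo (conv u (pos_prob Y)) (fun n => pos_prob Y n / (2 * n%:R * q' n)).
  exact: (renewal_conv_asymp (q := q')).
rewrite f_conv; split.
  apply: asymp_trans u_asymp _.
    by near=> n; rewrite divr_gt0 ?exprn_gt0 ?cbin_gt0// !mulr_gt0//; near: n.
  have H : pi * B n ^+ 2 / A n @[n --> \oo] --> (1 : R).
    have -> : (1 : R) = pi * (c^-1 ^+ 2) / 1.
      by rewrite divr1 -cc expr2; field; rewrite gt_eqF.
    apply: cvgM; last by apply: cvgV => //; exact: oner_neq0.
    by apply: cvgMr; rewrite !expr2; apply: cvgM.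
  apply: near_eq_cvg_to H; near=> n.
  have n0 : 0 < n%:R :> R by near: n.
  have L0 : 0 < L n%:R by near: n; case: L_usv.
  have qn : 0 < q' n by near: n.
  have b0 := cbin_gt0 R n; have s0 : 0 < Num.sqrt n%:R :> R by rewrite sqrtr_gt0.
  rewrite /A /B powR_neg_three_half//; move: (pi_gt0 R); generalize (@pi R) => p p0.
  by field; rewrite !gt_eqF.
apply: asymp_trans f_asymp _.
  near=> n; rewrite divr_gt0//; last by rewrite !mulr_gt0//; near: n.
  have : 0 < Num.sqrt n%:R * pos_prob Y n by near: n; case: p_usv.
  by rewrite pmulr_rgt0// sqrtr_gt0; near: n.
have H : (A n)^-1 @[n --> \oo] --> (1 : R).
  by rewrite -[X in _ --> X]invr1; apply: cvgV => //; exact: oner_neq0.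
apply: near_eq_cvg_to H; near=> n.
have n0 : 0 < n%:R :> R by near: n.
have L0 : 0 < L n%:R by near: n; case: L_usv.
have qn : 0 < q' n by near: n.
have s0 : 0 < Num.sqrt n%:R :> R by rewrite sqrtr_gt0.
have : 0 < Num.sqrt n%:R * pos_prob Y n by near: n; case: p_usv.
rewrite pmulr_rgt0// => p0.
rewrite /A powR_neg_three_half//.
by field; rewrite !gt_eqF.
Unshelve. all: by end_near. Qed.
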